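(* Let $m$ be a unit vector field in $W^{2,\infty}(\mathbb T^2;\mathbb R^2)$ admitting a controlled adapted covering. Then there exists $K_m>0$, depending only on the chosen covering and $\|m\|_{W^{2,\infty}}$, such that every $u,e\in V$ satisfies, with $r=e\cdot m$, $$|b(e,u,e)|\le K_m\lambda_1^{-1/2}\|u\|_{L^2}\|\mathcal A_m\|_{L^\infty}\|\nabla e\|_{L^2}^2+K_m\|\nabla u\|_{L^2}\|\nabla e\|_{L^2}|r|_{L^2}\,\mathcal L_m(r)^{1/2}.$$ Consequently, for every $\varepsilon>0$, one has $$|b(e,u,e)|\le\Bigl(K_m\lambda_1^{-1/2}\|u\|_{L^2}\|\mathcal A_m\|_{L^\infty}+\varepsilon\Bigr)\|\nabla e\|_{L^2}^2+\frac{K_m}{\varepsilon}\|\nabla u\|_{L^2}^2\,\mathcal L_m(r)\,|r|_{L^2}^2 .$$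
   Context: $\mathbb T^2=(\mathbb R/2\pi\mathbb Z)^2$. $H$ is the space of divergence-free, mean-zero fields in $L^2(\mathbb T^2)^2$, and $V=H^1(\mathbb T^2)^2\cap H$. $|\cdot|_{L^2}$ denotes the $L^2$ norm. $\lambda_1>0$ is a fixed Poincaré constant: $\lambda_1\|u\|_{L^2}^2\le\|\nabla u\|_{L^2}^2$ for $u\in V$ (one may take $\lambda_1=1$). $b(u,v,w)=\int_{\mathbb T^2}(u\cdot\nabla v)\cdot w\,dx$. For a unit field $m$ ($|m|=1$ a.e.), $n:=m^\perp=(-m_2,m_1)$, $D_nF:=n\cdot\nabla F$ (componentwise on vectors), and the shear-defect vector is $\mathcal A_m:=D_nn-(\nabla\cdot n)n$. A unit field $m\in W^{2,\infty}(\mathbb T^2;\mathbb R^2)$ admits a controlled adapted covering if there exist $L_y,L_s>0$, the torus $\widehat{\mathbb T}^2=(\mathbb R/L_y\mathbb Z)\times(\mathbb R/L_s\mathbb Z)$ with periodic coordinates $Y=(y,s)$, a smooth finite covering map $\Phi:\widehat{\mathbb T}^2\to\mathbb T^2$, and a positive function $q\in W^{2,\infty}(\widehat{\mathbb T}^2)$ such that $\partial_s\Phi=q\,(n\circ\Phi)$ and, with $\Gamma(Y):=(D\Phi(Y))^{-1}$, $$\mathfrak C_\Phi:=\|D\Phi\|_{W^{2,\infty}}+\|\Gamma\|_{W^{2,\infty}}+\|q\|_{W^{2,\infty}}+\|q^{-1}\|_{W^{2,\infty}}<\infty .$$ One such covering is chosen and fixed. For $r\in H^1(\mathbb T^2)$,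 $\mathcal L_m(r):=1+\log\Bigl(1+\frac{\|r\|_{H^1(\mathbb T^2)}^2}{|r|_{L^2(\mathbb T^2)}^2}\Bigr)$ if $r\not\equiv0$, and $\mathcal L_m(r):=1$ if $r\equiv0$. *)

(* Defs.v *)
(* MathComp-Analysis *)
From HB Require Import structures.
From mathcomp Require Import all_boot all_order all_algebra.
From mathcomp Require Import all_classical all_reals all_analysis.
Set Implicit Arguments.
Unset Strict Implicit.
Unset Printing Implicit Defensive.
Import Order.TTheory GRing.Theory Num.Theory.
Import numFieldNormedType.Exports.
Local Open Scope classical_set_scope.
Local Open Scope ring_scope.

(* The torus with period pair L is R^2 modulo the lattice L.1 Z x L.2 Z.
   A function on it is an L-periodic function on R^2; elements of Lebesgue and
   Sobolev spaces are Borel periodic representatives, and every notion below is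
   invariant under a.e. modification of the representative. *)

Section Defs.
Context {R : realType}.
Local Notation plane := (R * R)%type.
Implicit Types (L x y : plane) (f g : plane -> R) (u v w m F : plane -> plane).

Definition cmp (i : 'I_2) x : R := if i == 0 then x.1 else x.2.

Definition evec (i : 'I_2) : plane := ((i == 0)%:R, (i == 1)%:R).

Definition dot x y : R := \sum_(i < 2) cmp i x * cmp i y.

Definition perp x : plane := (- x.2, x.1).

Definition congr_lattice L x y : Prop :=
  exists k l : int, y = (x.1 + k%:~R * L.1, x.2 + l%:~R * L.2).

Definition lattice_periodic L f : Prop :=
  forall x y, congr_lattice L x y -> f x = f y.

Definition cell L : set plane := `[0, L.1[ `*` `[0, L.2[.

Lemma measurable_cell L : measurable (cell L).
Proof. by apply: measurableX; exact: measurable_itv. Qed.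

Definition torus_measure L :=
  mrestr (lebesgue_measure \x lebesgue_measure)%E (measurable_cell L).

HB.instance Definition _ L := Measure.on (torus_measure L).

Definition T2 : plane := (2 * pi, 2 * pi).

Definition partial (i : 'I_2) f : plane -> R := 'D_(evec i) f.

Fixpoint Ck (k : nat) (U : set plane) f : Prop :=
  (forall x, U x -> {for x, continuous f}) /\
  (if k is k'.+1 then
     forall i : 'I_2, (forall x, U x -> derivable f x (evec i)) /\
                      Ck k' U (partial i f)
   else True).

(* only meaningful on an open set U *)
Definition smooth_on (U : set plane) f : Prop := forall k, Ck k U f.

Definition memLp L (p : \bar R) f : Prop :=
  lattice_periodic L f /\ f \in Lfun (torus_measure L) p.

Definition is_weak_partial L (i : 'I_2) f g : Prop :=
  [/\ memLp L 1%E f, memLp L 1%E g &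
      forall phi, smooth_on setT phi -> lattice_periodic L phi ->
        \int[torus_measure L]_x (f x * partial i phi x) =
        - \int[torus_measure L]_x (g x * phi x)].

(* the weak partial derivative, unique up to a.e. equality (junk value 0 when
   it does not exist) *)
Definition weak_partial L (i : 'I_2) f : plane -> R :=
  xget (fun=> 0) [set g | is_weak_partial L i f g].

(* f belongs to W^{k,p} of the torus *)
Fixpoint sobolev L (p : \bar R) (k : nat) f : Prop :=
  memLp L p f /\
  (if k is k'.+1 then
     forall i : 'I_2, exists2 g, is_weak_partial L i f g & sobolev L p k' g
   else True).

Definition Linf_norm L f : \bar R := ('N[torus_measure L]_+oo[EFin \o f])%E.

(* max over |alpha| <= k of the L^oo norms of the weak derivatives *)
Fixpoint max_partials L (k : nat) f : \bar R :=
  if k is k'.+1 then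
    Order.max (Linf_norm L f)
      (\big[Order.max/0%E]_(i < 2) max_partials L k' (weak_partial L i f))
  else Linf_norm L f.

(* the W^{k,oo} norm, equal to +oo outside W^{k,oo} *)
Definition Winf_norm L (k : nat) f : \bar R :=
  if `[< sobolev L +oo%E k f >] then max_partials L k f else +oo%E.

Definition Winf_normv L (k : nat) u : \bar R :=
  \big[Order.max/0%E]_(i < 2) Winf_norm L k (cmp i \o u).

Definition Winf_normM L (k : nat) (A : plane -> 'M[R]_2) : \bar R :=
  \big[Order.max/0%E]_(i < 2) \big[Order.max/0%E]_(j < 2)
    Winf_norm L k (fun x => A x i j).

Definition L2norm f : R :=
  fine ('N[torus_measure T2]_2%:E[EFin \o f])%E.

Definition L2normv u : R :=
  Num.sqrt (\sum_(i < 2) L2norm (cmp i \o u) ^+ 2).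

Definition L2norm_grad u : R :=
  Num.sqrt (\sum_(i < 2) \sum_(j < 2)
    L2norm (weak_partial T2 j (cmp i \o u)) ^+ 2).

Definition H1norm f : R :=
  Num.sqrt (L2norm f ^+ 2 + \sum_(i < 2) L2norm (weak_partial T2 i f) ^+ 2).

Definition inH u : Prop :=
  [/\ forall i, memLp T2 2%:E (cmp i \o u),
      forall phi, smooth_on setT phi -> lattice_periodic T2 phi ->
        \int[torus_measure T2]_x
          (\sum_(i < 2) cmp i (u x) * partial i phi x) = 0 &
      forall i, \int[torus_measure T2]_x cmp i (u x) = 0].

Definition inV u : Prop :=
  (forall i, sobolev T2 2%:E 1 (cmp i \o u)) /\ inH u.

Definition trilinear u v w : R :=
  \int[torus_measure T2]_x
    (\sum_(i < 2) \sum_(j < 2)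
      cmp j (u x) * weak_partial T2 j (cmp i \o v) x * cmp i (w x)).

Definition poincare_constant (lambda1 : R) : Prop :=
  0 < lambda1 /\
  forall u, inV u -> lambda1 * L2normv u ^+ 2 <= L2norm_grad u ^+ 2.

Definition unit_field m : Prop :=
  {ae torus_measure T2, forall x, dot (m x) (m x) = 1}.

Definition dirder (n : plane -> plane) f : plane -> R :=
  fun x => \sum_(j < 2) cmp j (n x) * weak_partial T2 j f x.

Definition divergence u : plane -> R :=
  fun x => \sum_(j < 2) weak_partial T2 j (cmp j \o u) x.

Definition shear_defect m (i : 'I_2) : plane -> R :=
  let n := perp \o m in
  fun x => dirder n (cmp i \o n) x - divergence n x * cmp i (n x).

Definition shear_defect_norm m : R :=
  fine (Linf_norm T2
    (fun x => Num.sqrt (\sum_(i < 2) shear_defect m i x ^+ 2))).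

(* F : R^2 -> R^2 is a lift of an N-sheeted smooth covering map from the torus
   with periods L onto the one with periods L': every point has an open
   neighbourhood U whose preimage is the disjoint union of N open (lattice
   invariant) sheets V i, each mapped diffeomorphically onto U; the inverse
   diffeomorphism U -> V i is given by a smooth lift G. *)
Definition smooth_finite_covering L L' F : Prop :=
  [/\ forall i, smooth_on setT (cmp i \o F),
      forall x y, congr_lattice L x y -> congr_lattice L' (F x) (F y) &
      exists2 N : nat, (0 < N)%N &
      forall x, exists (U : set plane) (V : 'I_N -> set plane),
        [/\ open U /\ U x,
            forall i, open (V i) /\
              (forall y y', congr_lattice L y y' -> V i y -> V i y'),
            trivIset setT V,
            \bigcup_i V i =
              [set y | exists2 z, U z & congr_lattice L' (F y) z] &
            forall i, exists G : plane -> plane,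
              [/\ forall j, smooth_on U (cmp j \o G),
                  forall z, U z -> V i (G z) /\ congr_lattice L' (F (G z)) z &
                  forall y z, V i y -> U z -> congr_lattice L' (F y) z ->
                    congr_lattice L y (G z)]]].

Definition Dmap F x : 'M[R]_2 :=
  \matrix_(i < 2, j < 2) partial j (cmp i \o F) x.

Definition covering_constant L F (q : plane -> R) : \bar R :=
  (Winf_normM L 2 (Dmap F) + Winf_normM L 2 (fun x => invmx (Dmap F x)) +
   Winf_norm L 2 q + Winf_norm L 2 (fun x => (q x)^-1%R))%E.

(* The periodic coordinates are Y = (y, s), so d/ds is the partial derivative
   of index 1; (L.1, L.2) = (L_y, L_s). *)
Definition controlled_adapted_covering m L F (q : plane -> R) : Prop :=
  [/\ 0 < L.1 /\ 0 < L.2,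
      smooth_finite_covering L T2 F,
      {ae torus_measure L, forall x, 0 < q x},
      {ae torus_measure L, forall x, forall i,
        partial 1 (cmp i \o F) x = q x * cmp i (perp (m (F x)))} &
      (covering_constant L F q < +oo)%E].

Definition Lm (r : plane -> R) : R :=
  if `[< {ae torus_measure T2, forall x, r x = 0} >] then 1
  else 1 + ln (1 + H1norm r ^+ 2 / L2norm r ^+ 2).

End Defs.

(* Main.v *)
Require Import Defs.
From HB Require Import structures.
From mathcomp Require Import all_boot all_order all_algebra.
From mathcomp Require Import all_classical all_reals all_analysis.
From mathcomp Require Import measurable_realfun ess_sup_inf ring lra.
Import Order.TTheory GRing.Theory Num.Theory.
Import numFieldNormedType.Exports.
Set Implicit Arguments.
Unset Strict Implicit.
Unset Printing Implicit Defensive.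
Local Open Scope classical_set_scope.
Local Open Scope ring_scope.

(** Put [n = perp m], [r = e . m], [s = e . n] and [w = u . n], so that
    [e = r m + s n] and [b(e, u, e)] is the integral of the sum of the
    [e_j (d_j u_i) e_i].  The only part of the integrand without a factor [r] is
    [s^2 n_i n_j d_j u_i].  Moving the derivative off [u] turns it into
    [- s^2 u . A_m], with [A_m = D_n n - (div n) n], and a multiple of
    [s w div (s n)]; as [div e = 0], [div (s n) = - div (r m)], and one more
    integration by parts puts a factor [r] in front of all that is left.  This is
    [shear_identity], a pointwise statement: the integrand is the divergence of
    the flux [s^2 w n + 2 r s w m], minus [s^2 u . A_m], plus [r] times a
    remainder that is bilinear in [(e, De)] and [(u, Du)], with coefficients
    controlled by [m] and [Dm].

    The defect term is at most [|A_m|_oo |e|_L4^2 |u|_L2], and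
    [|e|_L4^2 <= C |De|_L2^2] for mean-zero [e] ([L4_mean0]).  The factor
    [lambda1^(-1/2)] can be inserted because Poincare constants are bounded above
    ([poincare_bounded]).

    In the remainder, Cauchy-Schwarz leaves the norms of [r e] and [r u], and
    [H^1] narrowly fails to embed in [L^oo] in dimension two.  The substitute is
    [log_product], which bounds the square of the norm of [r f], for mean-zero
    [f], by [C |r|^2 |Df|^2 (1 + log (1 + |r|_H1^2 / |r|^2))].  Cut the torus into
    [4^N] dyadic squares.  Telescoping along the ancestors of a square, the mean
    of [f] on it is at most [C sqrt N |Df|] ([dyadic_tree]), while the
    fluctuations of [f] on the small squares are controlled by the local Sobolev
    inequality [square_L4], with a factor [2^-N] that absorbs the [L^4] norm of
    [r] once [N] is of the order of the logarithm.

    All weak derivatives are handled on lines.  [ac_line j f f'] says that [f] is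
    absolutely continuous with derivative [f'] on almost every closed line in
    direction [j] of the torus.  Testing a weak derivative with trigonometric
    polynomials, and the completeness of the trigonometric system
    ([trig_orth_eq0]), give such a description ([weak_partial_ac_line]), and
    conversely ([ac_line_weak]).  The class is stable under products, and the
    derivative integrates to zero as soon as it is summable ([ac_line_int0]).  For
    the flux this holds since it is cubic in [e] and [u], which are in [L^4] with
    derivatives in [L^2] ([graded_int0]). *)

(** * The torus as a product of two circles *)

(** Two measurable structures on one carrier can have the same measurable sets
    without being identical; transport along the identity map shows that they
    define the same integrals. *)
Lemma integral_retype d1 d2 (X : measurableType d1) (Y : measurableType d2)
    (R : realType) (p : X -> Y) (m1 : {measure set X -> \bar R})
    (m2 : {measure set Y -> \bar R}) (f : Y -> \bar R) :
  measurable_fun setT p ->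
  (forall A, measurable A -> m2 A = m1 (p @^-1` A)) ->
  measurable_fun setT f ->
  (\int[m2]_y f y = \int[m1]_x f (p x))%E.
Proof.
move=> mp m12 mf.
have H g : measurable_fun setT g -> (forall x, 0 <= g x)%E ->
    (\int[m2]_y g y = \int[m1]_x g (p x))%E.
  move=> mg g0; rewrite -[RHS]/(\int[m1]_(x in p @^-1` setT) (g \o p) x)%E.
  rewrite -ge0_integral_pushforward//.
  by apply: eq_measure_integral => A mA _; rewrite m12.
rewrite integralE [RHS]integralE; congr (_ - _)%E.
  rewrite (H (f^\+)%E)//; last exact: measurable_funepos.
  by apply: eq_integral => x _; rewrite unlock.
rewrite (H (f^\-)%E)//; last exact: measurable_funeneg.
by apply: eq_integral => x _; rewrite unlock.
Qed.

Section Circle.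
Context {R : realType}.

Definition arc : set R := `[0, 2 * pi[%classic.

Lemma measurable_arc : measurable arc.
Proof. exact: measurable_itv. Qed.

Lemma arc_lty : (lebesgue_measure arc < +oo)%E.
Proof. by rewrite lebesgue_measure_itv/=; case: ifP => _; rewrite ?ltry// -EFinD ltry. Qed.

(** Restricting the measure instead of the domain keeps all functions defined,
    and all integrals taken, over the whole line; the torus then carries a
    product of two finite measures. *)
Definition circ : set R -> \bar R := mrestr (@lebesgue_measure R) measurable_arc.

Let circ0 : circ set0 = 0%E. Proof. by rewrite /circ /mrestr set0I measure0. Qed.
Let circ_ge0 A : (0 <= circ A)%E. Proof. exact: measure_ge0. Qed.
Let circ_sigma : semi_sigma_additive circ.
Proof. exact: (@measure_semi_sigma_additive _ _ _ (mrestr (@lebesgue_measure R) measurable_arc)). Qed.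
HB.instance Definition _ := isMeasure.Build _ R R circ circ0 circ_ge0 circ_sigma.

Let circ_fin : fin_num_fun circ.
Proof.
move=> U mU; rewrite /circ /mrestr ge0_fin_numE ?measure_ge0//.
by rewrite (le_lt_trans _ arc_lty)// le_measure// ?inE//; [exact: measurableI mU measurable_arc|exact: measurable_arc].
Qed.

HB.instance Definition _ := Measure_isFinite.Build _ _ _ circ circ_fin.

(** The set function [torus_measure T2], as a measure for the product of the
    canonical measurable structures of [R]. *)
Definition tor : set (R * R) -> \bar R := torus_measure T2.
Let tor0 : tor set0 = 0%E. Proof. exact: (@measure0 _ _ _ (torus_measure T2)). Qed.
Let tor_ge0 A : (0 <= tor A)%E. Proof. exact: (@measure_ge0 _ _ _ (torus_measure T2)). Qed.
Let tor_sigma : semi_sigma_additive tor.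
Proof. exact: (@measure_semi_sigma_additive _ _ _ (torus_measure T2)). Qed.
HB.instance Definition _ := isMeasure.Build _ _ _ tor tor0 tor_ge0 tor_sigma.

(** Both are finite measures that agree on the measurable boxes. *)
Lemma torus_measureE (A : set (R * R)) : measurable A ->
  tor A = (circ \x circ)%E A.
Proof.
move=> mA; symmetry.
apply: (@product_measure_unique _ _ _ _ _ circ circ tor) => //.
move=> B C mB mC.
transitivity ((@lebesgue_measure R \x @lebesgue_measure R)%E ((B `&` arc) `*` (C `&` arc))).
  by congr (product_measure1 _ _ _); apply/seteqP; split=> -[x y] /= [[? ?] [? ?]].
by rewrite product_measure1E//; [exact: measurableI mB measurable_arc|exact: measurableI mC measurable_arc].
Qed.

Lemma integral_torusE (f : R * R -> \bar R) : measurable_fun setT f ->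
  (\int[torus_measure T2]_z f z = \int[(circ \x circ)%E]_z f z)%E.
Proof.
move=> mf.
transitivity (\int[tor]_z f z)%E; last first.
  by apply: eq_measure_integral => A mA _; apply: torus_measureE.
exact/esym/integral_retype.
Qed.

Lemma Rintegral_torusE (f : R * R -> R) : measurable_fun setT f ->
  \int[torus_measure T2]_z f z = \int[(circ \x circ)%E]_z f z.
Proof. by move=> mf; congr (fine _); apply: integral_torusE; apply/measurable_EFinP. Qed.

Lemma integrable_torusE (f : R * R -> \bar R) :
  (torus_measure T2).-integrable setT f <-> (circ \x circ)%E.-integrable setT f.
Proof.
split => /integrableP[mf fi]; apply/integrableP; split; [exact: mf| |exact: mf|].
  by rewrite -integral_torusE//; apply: measurableT_comp.
by rewrite integral_torusE//; apply: measurableT_comp.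
Qed.

Lemma ae_torusE (P : R * R -> Prop) :
  {ae torus_measure T2, forall z, P z} <-> {ae (circ \x circ)%E, forall z, P z}.
Proof.
split=> -[A [mA A0 PA]]; exists A; split; [exact: mA| |exact: PA|exact: mA| |exact: PA].
  by rewrite -torus_measureE.
by rewrite -[LHS]/(tor A) torus_measureE.
Qed.

Lemma circE_arc (A : set R) : A `<=` arc -> circ A = lebesgue_measure A.
Proof. by move=> Aarc; rewrite /circ /mrestr setIidl. Qed.

Lemma circ_setC : circ (~` arc) = 0%E.
Proof. by rewrite /circ /mrestr setICl measure0. Qed.

Lemma integral_circE (f : R -> \bar R) : measurable_fun setT f ->
  (\int[circ]_x f x = \int[lebesgue_measure]_(x in arc) f x)%E.
Proof.
move=> mf.
have marc := measurable_arc.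
transitivity (\int[mrestr (@lebesgue_measure R) measurable_arc]_x f x)%E.
  exact: integral_retype.
set mu := mrestr _ _.
rewrite -[LHS]/(\int[mu]_(x in setT) f x)%E.
rewrite -(setUv arc) integral_setU//=; [|exact: measurableC|by rewrite setUv|by apply/disj_setPS; rewrite setICr].
rewrite [X in (_ + X)%E]null_set_integral ?circ_setC ?adde0//; first last.
- exact: circ_setC.
- exact: measurable_funTS.
- exact: measurableC.
by apply: eq_measure_integral => A mA Aarc; apply: circE_arc.
Qed.

Lemma ae_circ_arc : {ae circ, forall x, arc x}.
Proof. by exists (~` arc); split; [exact: measurableC measurable_arc|exact: circ_setC|]. Qed.

End Circle.

(** * Real-valued integrals and Fubini *)

Lemma eq_lexx d (T : porderType d) (x y : T) : x = y -> (x <= y)%O.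
Proof. by move=> ->. Qed.

Notation summable mu f := (mu.-integrable setT (EFin \o f)).

Section RealIntegral.
Context d (T : measurableType d) (R : realType) (mu : {measure set T -> \bar R}).
Implicit Types f g h : T -> R.

Lemma summable_measurable f : summable mu f -> measurable_fun setT f.
Proof. by move=> /measurable_int/measurable_EFinP. Qed.

Lemma summableD f g : summable mu f -> summable mu g -> summable mu (fun x => f x + g x).
Proof. by move=> fi gi; apply: (integrableD measurableT fi gi). Qed.

Lemma summableB f g : summable mu f -> summable mu g -> summable mu (fun x => f x - g x).
Proof. by move=> fi gi; apply: (integrableB measurableT fi gi). Qed.

Lemma summableZ k f : summable mu f -> summable mu (fun x => k * f x).
Proof. by move=> fi; apply: (integrableZl measurableT k fi). Qed.

Lemma summable_le f g : measurable_fun setT f -> (forall x, `|f x| <= `|g x|) ->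
  summable mu g -> summable mu f.
Proof.
move=> mf fg gi; apply: (le_integrable measurableT _ _ gi).
  exact/measurable_EFinP.
by move=> x _; rewrite /= lee_fin.
Qed.

Lemma summable_ae_le f g : measurable_fun setT f ->
  {ae mu, forall x, `|f x| <= `|g x|} ->
  summable mu g -> summable mu f.
Proof.
move=> mf fg gi; have mg := summable_measurable gi.
apply/integrableP; split; first exact/measurable_EFinP.
move/integrableP: gi => [_]; apply: le_lt_trans.
apply: ae_ge0_le_integral => //.
- by do 2 apply: measurableT_comp => //.
- by do 2 apply: measurableT_comp => //.
- by apply: filterS fg => x fgx _; rewrite /= lee_fin.
Qed.

Lemma summableMb h f (C : R) : measurable_fun setT h -> (forall x, `|h x| <= C) ->
  summable mu f -> summable mu (fun x => h x * f x).
Proof.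
move=> mh hC fi; have mf := summable_measurable fi.
apply: (@summable_le _ (fun x => C * f x)); last exact: summableZ.
  exact: measurable_funM.
by move=> x; rewrite !normrM ler_wpM2r// (le_trans (hC x))// ler_norm.
Qed.

Lemma RintD f g : summable mu f -> summable mu g ->
  \int[mu]_x (f x + g x) = \int[mu]_x f x + \int[mu]_x g x.
Proof. exact: RintegralD. Qed.

Lemma RintB f g : summable mu f -> summable mu g ->
  \int[mu]_x (f x - g x) = \int[mu]_x f x - \int[mu]_x g x.
Proof. exact: RintegralB. Qed.

Lemma RintZ k f : summable mu f -> \int[mu]_x (k * f x) = k * \int[mu]_x f x.
Proof. by move=> fi; apply: RintegralZl. Qed.

Lemma Rint0 : \int[mu]_x (0 : R) = 0.
Proof. by rewrite /Rintegral integral0. Qed.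

Lemma eq_Rint f g : (forall x, f x = g x) -> \int[mu]_x f x = \int[mu]_x g x.
Proof. by move=> fg; apply: eq_Rintegral => x _. Qed.

Lemma RintE f : summable mu f -> (\int[mu]_x (f x)%:E)%E = (\int[mu]_x f x)%:E.
Proof. by move=> fi; rewrite /Rintegral fineK//; apply: integrable_fin_num. Qed.

Lemma ae_eq_Rint f g : measurable_fun setT f -> measurable_fun setT g ->
  {ae mu, forall x, f x = g x} -> \int[mu]_x f x = \int[mu]_x g x.
Proof.
move=> mf mg fg; congr fine; apply: ae_eq_integral => //.
- exact/measurable_EFinP.
- exact/measurable_EFinP.
- by apply: filterS fg => x fgx _; rewrite fgx.
Qed.

Lemma ae_summable f g : measurable_fun setT f ->
  {ae mu, forall x, f x = g x} -> summable mu g -> summable mu f.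
Proof. by move=> mf fg; apply: summable_ae_le => //; apply: filterS fg => x ->. Qed.

Lemma ae_le_Rint f g : summable mu f -> summable mu g ->
  {ae mu, forall x, f x <= g x} -> \int[mu]_x f x <= \int[mu]_x g x.
Proof.
move=> fi gi fg; rewrite -subr_ge0 -RintB//.
have mf := summable_measurable fi; have mg := summable_measurable gi.
rewrite (@ae_eq_Rint _ (fun x => `|g x - f x|)).
- by apply: Rintegral_ge0.
- exact: measurable_funB.
- by apply: measurableT_comp => //; apply: measurable_funB.
- by apply: filterS fg => x fgx; rewrite ger0_norm// subr_ge0.
Qed.

Lemma norm_Rint_le f g : summable mu f -> summable mu g ->
  {ae mu, forall x, `|f x| <= g x} -> `|\int[mu]_x f x| <= \int[mu]_x g x.
Proof.
move=> fi gi fg; apply: (le_trans (le_normr_Rintegral measurableT fi)).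
by apply: ae_le_Rint => //; apply: integrable_norm.
Qed.

Lemma summable_cst (k : R) : (mu setT < +oo)%E -> summable mu (fun=> k).
Proof.
move=> muT; apply: measurable_bounded_integrable => //.
by exists `|k|; split; [exact: num_real|move=> M kM x _ /=; exact: ltW].
Qed.

End RealIntegral.

Section RealFubini.
Context d1 d2 (T1 : measurableType d1) (T2 : measurableType d2) (R : realType).
Variables (m1 : {sigma_finite_measure set T1 -> \bar R})
  (m2 : {sigma_finite_measure set T2 -> \bar R}).
Implicit Types (f g : T1 * T2 -> R) (P : T1 * T2 -> Prop).
Local Notation nu := (m1 \x m2)%E.

Lemma ae_section1 P : {ae nu, forall z, P z} ->
  {ae m1, forall x, {ae m2, forall y, P (x, y)}}.
Proof.
move=> [A [mA A0 PA]].
have mxA := measurable_fun_xsection m2 mA.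
have : (\int[m1]_x `|m2 (xsection A x)| = 0)%E.
  by rewrite -A0; apply: eq_integral => x _; rewrite gee0_abs.
move/(ae_eq_integral_abs m1 measurableT mxA); apply: filterS => x /= /(_ I) xA0.
exists (xsection A x); split => //; first exact: measurable_xsection.
by move=> y nP; apply/xsectionP; apply: PA.
Qed.

Lemma ae_section2 P : {ae nu, forall z, P z} ->
  {ae m2, forall y, {ae m1, forall x, P (x, y)}}.
Proof.
move=> [A [mA A0 PA]].
have myA := measurable_fun_ysection m1 mA.
have : (\int[m2]_y `|m1 (ysection A y)| = 0)%E.
  rewrite -[RHS]A0 (@product_measure_unique _ _ _ _ _ m1 m2 (m1 \x^ m2)%E)//.
    by apply: eq_integral => x _; rewrite gee0_abs.
  by move=> B C mB mC; apply: product_measure2E.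
move/(ae_eq_integral_abs m2 measurableT myA); apply: filterS => x /= /(_ I) xA0.
exists (ysection A x); split => //; first exact: measurable_ysection.
by move=> y nP; apply/ysectionP; apply: PA.
Qed.

(** Tonelli for [|f - g|]: its integral vanishes line by line. *)
Lemma ae_prod_eq f g : measurable_fun setT f -> measurable_fun setT g ->
  {ae m1, forall x, {ae m2, forall y, f (x, y) = g (x, y)}} ->
  {ae nu, forall z, f z = g z}.
Proof.
move=> mf mg fg.
have mfg : measurable_fun setT (fun z => (f z - g z)%:E).
  by apply/measurable_EFinP; apply: measurable_funB.
have : (\int[nu]_z `|(f z - g z)%:E| = 0)%E.
  rewrite fubini_tonelli1//; last exact: measurableT_comp.
  have : ae_eq m1 setT (fubini_F m2 (fun z => `|(f z - g z)%:E|%E)) (cst 0%E).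
    apply: filterS fg => x fgx _ /=; rewrite /fubini_F.
    rewrite (ae_eq_integral (cst 0%E))//; first by rewrite integral0.
      apply: measurableT_comp => //.
      by apply: measurableT_comp => //; apply: measurable_funB; exact: measurable_fun_pair2.
    by apply: filterS fgx => y -> _; rewrite subrr normr0.
  have mF : measurable_fun setT (fubini_F m2 (fun z => `|(f z - g z)%:E|%E)).
    by apply: measurable_fun_fubini_tonelli_F => //; exact: measurableT_comp.
  move=> /(ae_eq_integral_abs m1 measurableT mF) <-.
  by apply: eq_integral => x _; rewrite gee0_abs//; apply: integral_ge0.
move/(ae_eq_integral_abs nu measurableT mfg); apply: filterS => z /= /(_ I) /eqP.
by rewrite eqe subr_eq0 => /eqP.
Qed.

Lemma ae_summable1 f : summable nu f ->
  {ae m1, forall x, summable m2 (fun y => f (x, y))}.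
Proof. by move=> /ae_integrable1. Qed.

Lemma ae_summable2 f : summable nu f ->
  {ae m2, forall y, summable m1 (fun x => f (x, y))}.
Proof. by move=> /ae_integrable2. Qed.

Lemma summable_Fubini1 f : summable nu f ->
  summable m1 (fun x => \int[m2]_y f (x, y)).
Proof.
move=> fi; apply: (le_integrable measurableT _ _ (integrable_fubini_F fi)).
  apply/measurable_EFinP.
  exact: (measurableT_comp (@fine_measurable R setT measurableT) (measurable_fubini_F fi)).
by move=> x _; rewrite /= /Rintegral /fubini_F; case: (integral _ _ _) => [r| |] //=; rewrite ?normr0 ?leey.
Qed.

Lemma summable_Fubini2 f : summable nu f ->
  summable m2 (fun y => \int[m1]_x f (x, y)).
Proof.
move=> fi; have mf := measurable_int _ fi.
have mG : measurable_fun setT (fun y => \int[m1]_x f (x, y)).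
  exact: (measurableT_comp (@fine_measurable R setT measurableT) (measurable_fubini_G fi)).
apply/integrableP; split; first exact/measurable_EFinP.
have := (@integrable21ltyP _ _ _ _ _ m1 m2 _ mf).1 fi; apply: le_lt_trans.
apply: ge0_le_integral => //.
- by apply: measurableT_comp => //; exact/measurable_EFinP.
- apply: (measurable_fun_fubini_tonelli_G (fun z => `|(EFin \o f) z|%E)) => //.
  exact: measurableT_comp.
move=> y _; apply: (@le_trans _ _ `|\int[m1]_x (f (x, y))%:E|%E).
  by rewrite /= /Rintegral; case: (integral _ _ _) => [r| |] //=; rewrite ?normr0 ?leey.
apply: le_abse_integral => //; apply/measurable_EFinP.
exact: measurable_fun_pair1 (summable_measurable fi).
Qed.

Lemma Rint_Fubini1 f : summable nu f ->
  \int[nu]_z f z = \int[m1]_x \int[m2]_y f (x, y).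
Proof.
move=> fi; congr fine; rewrite -(integral12_prod_meas1 fi).
apply: ae_eq_integral => //.
- exact: (measurable_fubini_F fi).
- exact/measurable_EFinP/summable_measurable/summable_Fubini1.
- by apply: filterS (ae_summable1 fi) => x fxi _; rewrite -RintE.
Qed.

Lemma Rint_Fubini2 f : summable nu f ->
  \int[nu]_z f z = \int[m2]_y \int[m1]_x f (x, y).
Proof.
move=> fi; congr fine; rewrite -(integral21_prod_meas1 fi).
apply: ae_eq_integral => //.
- exact: (measurable_fubini_G fi).
- exact/measurable_EFinP/summable_measurable/summable_Fubini2.
- by apply: filterS (ae_summable2 fi) => x fxi _; rewrite -RintE.
Qed.

End RealFubini.

(** * Primitives on the circle *)

Section Primitive.
Context {R : realType}.
Implicit Types (f g h : R -> R) (x t : R).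
Local Notation circ := (@circ R).
Local Notation nu := (circ \x circ)%E.

Lemma measurable_bool2R d (T : measurableType d) (b : T -> bool) :
  measurable_fun setT b -> measurable_fun setT (fun y => (b y)%:R : R).
Proof.
move=> mb; rewrite (_ : (fun _ => _) = (fun y => if b y then 1 else 0 : R)).
  exact: measurable_fun_ifT.
by apply/funext => y; case: (b y).
Qed.

Lemma measurable_step x : measurable_fun setT (fun t => (t < x)%R%:R : R).
Proof. by apply: measurable_bool2R; apply: measurable_fun_ltr. Qed.

Lemma measurable_step2 : measurable_fun setT (fun z : R * R => (z.1 < z.2)%R%:R : R).
Proof. by apply: measurable_bool2R; apply: measurable_fun_ltr. Qed.

Lemma measurable_step2' : measurable_fun setT (fun z : R * R => (z.2 < z.1)%R%:R : R).
Proof. by apply: measurable_bool2R; apply: measurable_fun_ltr. Qed.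

Lemma normr_bool (b : bool) : `|b%:R : R| <= 1.
Proof. by case: b; rewrite ?normr1 ?normr0. Qed.

Definition prim g x := \int[circ]_t ((t < x)%R%:R * g t).

Lemma summable_step g x : summable circ g -> summable circ (fun t => (t < x)%R%:R * g t).
Proof.
by move=> gi; apply: (summableMb (measurable_step x) _ gi) => t; apply: normr_bool.
Qed.

Lemma primD f g x : summable circ f -> summable circ g ->
  prim (fun t => f t + g t) x = prim f x + prim g x.
Proof.
move=> fi gi; rewrite /prim -RintD; [|exact: summable_step|exact: summable_step].
by apply: eq_Rintegral => t _; rewrite mulrDr.
Qed.

Lemma primZ k f x : summable circ f -> prim (fun t => k * f t) x = k * prim f x.
Proof.
move=> fi; rewrite /prim -RintZ; last exact: summable_step.
by apply: eq_Rintegral => t _; rewrite mulrCA.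
Qed.

Lemma eq_prim f g x : measurable_fun setT f -> measurable_fun setT g ->
  {ae circ, forall t, f t = g t} -> prim f x = prim g x.
Proof.
move=> mf mg fg; apply: ae_eq_Rint.
- by apply: measurable_funM => //; exact: measurable_step.
- by apply: measurable_funM => //; exact: measurable_step.
- by apply: filterS fg => t ->.
Qed.

Lemma prim_end f : measurable_fun setT f -> prim f (2 * pi) = \int[circ]_t f t.
Proof.
move=> mf; apply: ae_eq_Rint => //.
- by apply: measurable_funM => //; exact: measurable_step.
- apply: filterS ae_circ_arc => t; rewrite /arc /= in_itv/= => /andP[_ ->].
  by rewrite mul1r.
Qed.

Lemma prim_le f x : summable circ f -> `|prim f x| <= \int[circ]_t `|f t|.
Proof.
move=> fi; apply: norm_Rint_le; [exact: summable_step|exact: integrable_norm|].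
apply: aeW => t; rewrite normrM ler_piMl//; exact: normr_bool.
Qed.

Lemma summable_prod f g : summable circ f -> summable circ g ->
  summable nu (fun z => f z.1 * g z.2).
Proof.
move=> fi gi; have mf := summable_measurable fi; have mg := summable_measurable gi.
have mfg : measurable_fun setT (fun z : R * R => f z.1 * g z.2).
  by apply: measurable_funM; [exact: (measurableT_comp mf)|exact: (measurableT_comp mg)].
apply/integrable12ltyP; first exact/measurable_EFinP.
under eq_integral => x _.
  under eq_integral do rewrite /= normrM EFinM.
  rewrite ge0_integralZl//; last first.
    by apply/measurable_EFinP; apply: measurableT_comp.
  over.
rewrite /= ge0_integralZr//; last 2 first.
- by apply/measurable_EFinP; apply: measurableT_comp.
- exact: integral_ge0.
move/integrableP: fi => [_ fi]; move/integrableP: gi => [_ gi].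
by apply: lte_mul_pinfty => //; [exact: integral_ge0|rewrite ge0_fin_numE//; exact: integral_ge0].
Qed.

Lemma circ_lty : (circ setT < +oo)%E.
Proof. exact: (fin_num_fun_lty (fin_num_measure circ)). Qed.

Lemma summable_step2 f : summable circ f ->
  summable nu (fun z => (z.1 < z.2)%R%:R * f z.1).
Proof.
move=> fi; apply: (@summableMb _ _ _ _ _ (fun z => f z.1) 1) => [||].
- exact: measurable_step2.
- by move=> z; apply: normr_bool.
- have := summable_prod fi (@summable_cst _ _ _ circ 1 circ_lty).
  by congr (integrable _ _ _); apply/funext => z /=; rewrite mulr1.
Qed.

Lemma measurable_prim f : summable circ f -> measurable_fun setT (prim f).
Proof.
move=> fi; have := summable_Fubini2 (summable_step2 fi).
exact: summable_measurable.
Qed.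

Lemma circ_set1 x : circ [set x] = 0%E.
Proof.
apply/eqP; rewrite eq_le measure_ge0 andbT.
rewrite -[leRHS](lebesgue_measure_set1 x) /circ /mrestr.
by apply: le_measure; rewrite ?inE//; exact: measurableI (measurable_set1 x) measurable_arc.
Qed.

Lemma ae_circ_neq x : {ae circ, forall t, t != x}.
Proof.
exists [set x]; split; [exact: measurable_set1|exact: circ_set1|].
by move=> t /= /negP; rewrite negbK => /eqP.
Qed.

(** Split the square [[0, x]^2] along its diagonal, which is a null set, and
    apply Fubini to each half. *)
Lemma primM f g x : summable circ f -> summable circ g ->
  prim f x * prim g x = prim (fun t => f t * prim g t + prim f t * g t) x.
Proof.
move=> fi gi.
have mf := summable_measurable fi; have mg := summable_measurable gi.
pose F1 z : R := (z.2 < z.1)%R%:R * (((z.1 < x)%R%:R * f z.1) * g z.2).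
pose F2 z : R := (z.1 < z.2)%R%:R * (f z.1 * ((z.2 < x)%R%:R * g z.2)).
have F1i : summable nu F1.
  apply: (@summableMb _ _ _ nu (fun z : R * R => (z.2 < z.1)%R%:R) (fun z : R * R => ((z.1 < x)%R%:R * f z.1) * g z.2) 1).
  - exact: measurable_step2'.
  - by move=> z; apply: normr_bool.
  - by apply: (@summable_prod (fun t => (t < x)%R%:R * f t)) => //; exact: summable_step.
have F2i : summable nu F2.
  apply: (@summableMb _ _ _ nu (fun z : R * R => (z.1 < z.2)%R%:R) (fun z : R * R => f z.1 * ((z.2 < x)%R%:R * g z.2)) 1).
  - exact: measurable_step2.
  - by move=> z; apply: normr_bool.
  - by apply: (@summable_prod f (fun t => (t < x)%R%:R * g t)) => //; exact: summable_step.
have E1 : \int[nu]_z F1 z = prim (fun t => f t * prim g t) x.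
  rewrite Rint_Fubini1//; apply: eq_Rintegral => t _.
  rewrite /F1 /= mulrA /prim -RintZ; last exact: summable_step.
  by apply: eq_Rintegral => s _; rewrite mulrCA.
have E2 : \int[nu]_z F2 z = prim (fun t => prim f t * g t) x.
  rewrite Rint_Fubini2//; apply: eq_Rintegral => t _.
  transitivity (((t < x)%R%:R * g t) * prim f t); last by ring.
  rewrite /prim -RintZ; last exact: summable_step.
  by apply: eq_Rintegral => s _; rewrite /F2 /=; ring.
have fPg : summable circ (fun t => f t * prim g t).
  under eq_fun do rewrite mulrC.
  exact: (summableMb (measurable_prim gi) (fun t => prim_le t gi)).
have Pfg : summable circ (fun t => prim f t * g t).
  exact: (summableMb (measurable_prim fi) (fun t => prim_le t fi)).
rewrite primD// -E1 -E2 -RintD// Rint_Fubini1; last exact: summableD.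
rewrite mulrC -RintZ; last exact: summable_step.
apply: eq_Rintegral => t _; rewrite /= mulrC -RintZ; last exact: summable_step.
have mst := measurable_step x.
apply: ae_eq_Rint.
- apply: measurable_funM => //; exact: measurable_funM.
- apply: measurable_funD.
    exact: (measurable_fun_pair2 t (summable_measurable F1i)).
  exact: (measurable_fun_pair2 t (summable_measurable F2i)).
- apply: filterS (ae_circ_neq t) => s snt; rewrite /F1 /F2 /=.
  case: (ltgtP s t) snt => [st _|ts _|//].
    case: (ltP t x) => tx; last by rewrite !(mul0r, mulr0) addr0.
    by rewrite (lt_trans st tx) !mul1r mul0r addr0.
  case: (ltP s x) => sx; last by rewrite !(mul0r, mulr0) addr0.
  by rewrite (lt_trans ts sx) !mul1r mul0r add0r.
Qed.

(** These are the absolutely continuous functions on the circle, up to a null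
    set; the vanishing integral of [f'] says that the primitive closes up. *)
Definition ac_circ f f' := [/\ measurable_fun setT f, summable circ f',
  \int[circ]_t f' t = 0 & exists c, {ae circ, forall x, f x = c + prim f' x}].

Lemma ac_circ_cst c : ac_circ (fun=> c) (fun=> 0).
Proof.
have p0 x : prim (fun=> 0) x = 0.
  transitivity (\int[circ]_t (0 : R)); last by rewrite Rintegral_cst ?mul0r.
  by apply: eq_Rintegral => t _; rewrite mulr0.
split=> //; first by apply: summable_cst; exact: circ_lty.
  by rewrite Rintegral_cst ?mul0r.
by exists c; apply: aeW => x; rewrite p0 addr0.
Qed.

Lemma ac_circ_add f f' g g' : ac_circ f f' -> ac_circ g g' ->
  ac_circ (fun x => f x + g x) (fun x => f' x + g' x).
Proof.
move=> [mf fi f0 [c fc]] [mg gi g0 [d gd]]; split.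
- exact: measurable_funD.
- exact: summableD.
- by rewrite RintD// f0 g0 addr0.
- exists (c + d); apply: filterS2 fc gd => x -> ->.
  by rewrite primD// addrACA.
Qed.

Lemma ac_circ_bounded f f' : ac_circ f f' -> exists C, {ae circ, forall x, `|f x| <= C}.
Proof.
move=> [mf fi f0 [c fc]]; exists (`|c| + \int[circ]_t `|f' t|).
apply: filterS fc => x ->; apply: (le_trans (ler_normD _ _)).
by rewrite lerD2l prim_le.
Qed.

(** From [primM], with the constants of integration taken along. *)
Lemma ac_circ_mul f f' g g' : ac_circ f f' -> ac_circ g g' ->
  ac_circ (fun x => f x * g x) (fun x => f' x * g x + f x * g' x).
Proof.
move=> [mf fi f0 [c fc]] [mg gi g0 [d gd]].
have mf' := summable_measurable fi; have mg' := summable_measurable gi.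
have mPf := measurable_prim fi; have mPg := measurable_prim gi.
pose h x := (c * g' x + d * f' x) + (f' x * prim g' x + prim f' x * g' x).
have fPg : summable circ (fun t => f' t * prim g' t).
  under eq_fun do rewrite mulrC.
  exact: (summableMb mPg (fun t => prim_le t gi)).
have Pfg : summable circ (fun t => prim f' t * g' t).
  exact: (summableMb mPf (fun t => prim_le t fi)).
have hi : summable circ h.
  apply: (@summableD _ _ _ _ (fun x => c * g' x + d * f' x)); last exact: summableD.
  by apply: summableD; exact: summableZ.
have mfg : measurable_fun setT (fun x => f' x * g x + f x * g' x).
  by apply: measurable_funD; exact: measurable_funM.
have hE : {ae circ, forall x, f' x * g x + f x * g' x = h x}.
  by apply: filterS2 fc gd => x -> ->; rewrite /h; ring.
have primh x : prim h x = c * prim g' x + d * prim f' x + prim f' x * prim g' x.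
  rewrite /h (@primD (fun x => c * g' x + d * f' x)); last 2 first.
  - by apply: summableD; exact: summableZ.
  - exact: summableD.
  by rewrite primM// primD ?primZ//; exact: summableZ.
split.
- exact: measurable_funM.
- exact: ae_summable hE hi.
- rewrite (ae_eq_Rint mfg (summable_measurable hi) hE) -prim_end; last exact: (summable_measurable hi).
  by rewrite primh !prim_end// f0 g0 !mulr0 !addr0.
- exists (c * d); apply: filterS2 fc gd => x -> ->.
  rewrite (@eq_prim _ h _ mfg (summable_measurable hi) hE) primh; ring.
Qed.

(** [F] is the primitive itself, for which the bound holds at every point. *)
Lemma ac_circ_osc f f' a b : ac_circ f f' ->
  exists2 F, {ae circ, forall x, f x = F x} &
  forall x y, a <= x < b -> a <= y < b ->
    `|F x - F y| <= \int[circ]_t ((a <= t < b)%R%:R * `|f' t|).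
Proof.
move=> [mf fi f0 [c fc]]; exists (fun x => c + prim f' x) => // x y xab yab.
have mab : measurable_fun setT (fun t : R => (a <= t < b)%R%:R : R).
  apply: measurable_bool2R; apply: measurable_and => //.
    exact: measurable_fun_ler.
  exact: measurable_fun_ltr.
rewrite opprD addrACA subrr add0r /prim -RintB; [|exact: summable_step|exact: summable_step].
apply: norm_Rint_le.
- by apply: summableB; exact: summable_step.
- apply: (summableMb (C := 1) mab) => [t|]; first exact: normr_bool.
  exact: integrable_norm.
apply: aeW => t; rewrite -mulrBl normrM ler_wpM2r//.
move: xab yab => /andP[ax xb] /andP[ay yb].
case: (leP a t) => /= at_; last by rewrite (lt_le_trans at_ ax) (lt_le_trans at_ ay) subrr normr0.
case: (ltP t b) => tb; first by case: (t < x)%R; case: (t < y)%R; rewrite /= ?mulr1n ?mulr0n ?subrr ?subr0 ?sub0r ?normrN ?normr1 ?normr0 ?ler01 ?lexx.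
by rewrite !ltNge (ltW (lt_le_trans xb tb)) (ltW (lt_le_trans yb tb)) subrr normr0.
Qed.

End Primitive.

(** * Trigonometric monomials *)

Section Trig.
Context {R : realType}.
Implicit Types (f g h : R -> R) (x t : R).
Local Notation circ := (@circ R).
Local Notation nu := (circ \x circ)%E.

(** The fundamental theorem of calculus, for the measure [circ]. *)
Lemma prim_C1 (F f : R -> R) x : (forall y : R, is_derive y (1 : R) F (f y)) -> continuous f ->
  0 <= x <= 2 * pi -> prim f x = F x - F 0.
Proof.
move=> dF cf /andP[x0 x2pi].
have mf : measurable_fun setT f by exact: continuous_measurable_fun.
have cF : continuous F.
  move=> y; apply: differentiable_continuous; apply/derivable1_diffP.
  exact: (@ex_derive _ _ _ _ _ _ _ (dF y)).
move: x0; rewrite le_eqVlt => /predU1P[<-|x0].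
  rewrite subrr /prim (@ae_eq_Rint _ _ _ circ _ (fun=> 0)).
  - by rewrite Rintegral_cst ?mul0r.
  - by apply: measurable_funM => //; exact: measurable_step.
  - exact: measurable_cst.
  - apply: filterS ae_circ_arc => t; rewrite /arc /= in_itv/= => /andP[t0 _].
    by rewrite ltNge t0 mul0r.
have : (\int[circ]_t (((t < x)%R%:R * f t)%:E) = (F x)%:E - (F 0)%:E)%E; last first.
  by rewrite /prim /Rintegral => ->.
rewrite integral_circE; last first.
  by apply/measurable_EFinP; apply: measurable_funM => //; exact: measurable_step.
transitivity (\int[lebesgue_measure]_(t in arc `&` [set t : R | (t < x)%R]) (f t)%:E)%E.
  rewrite integral_mkcondr; apply: eq_integral => t _; rewrite patchE.
  case: ifPn => [|/negP]; rewrite inE /= => tx; first by rewrite tx mul1r.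
  by rewrite (negbTE (introN idP tx)) mul0r.
have -> : arc `&` [set t : R | (t < x)%R] = `[0, x[%classic.
  apply/seteqP; split=> t; rewrite /arc /= !in_itv/=; first by case=> /andP[-> _] ->.
  by move=> /andP[t0 tx]; rewrite t0 tx (lt_le_trans tx).
rewrite integral_itv_bndo_bndc; last exact/measurable_EFinP/measurable_funTS.
apply: continuous_FTC2 => //.
- exact: continuous_subspaceT.
- split.
  + by move=> y _; exact: (@ex_derive _ _ _ _ _ _ _ (dF y)).
  + by apply: cvg_at_right_filter; exact: cF.
  + by apply: cvg_at_left_filter; exact: cF.
- by move=> y _; rewrite derive1E; exact: (@derive_val _ _ _ _ _ _ _ (dF y)).
Qed.

(** The phase makes products, derivatives and antiderivatives of trigonometric
    monomials stay in the family. *)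
Definition trig (k : int) (th : R) x : R := cos (k%:~R * x + th).

Lemma trig_le1 k th x : `|trig k th x| <= 1.
Proof. exact: cos_max. Qed.

Lemma is_derive_trig k th x :
  is_derive x (1 : R) (trig k th) (k%:~R * trig k (th + pi / 2) x).
Proof.
have dL : is_derive x (1 : R) (fun y => k%:~R * y + th) (k%:~R : R).
  have := is_deriveD (is_deriveM (is_derive_cst (k%:~R : R) x (1 : R)) (is_derive_id x (1 : R))) (is_derive_cst th x (1 : R)).
  by move=> H; apply: (is_derive_eq H); rewrite scaler0 !addr0 /GRing.scale /= mulr1.
apply: (is_derive_eq (is_derive1_comp (is_derive_cos _) dL)).
by rewrite /trig addrA cosDpihalf mulrC.
Qed.

Lemma continuous_trig k th : continuous (trig k th).
Proof.
move=> y; apply: differentiable_continuous; apply/derivable1_diffP.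
exact: (@ex_derive _ _ _ _ _ _ _ (is_derive_trig k th y)).
Qed.

Lemma measurable_trig k th : measurable_fun setT (trig k th).
Proof. by apply: continuous_measurable_fun; exact: continuous_trig. Qed.

Lemma trig0 th x : trig 0 th x = cos th.
Proof. by rewrite /trig mul0r add0r. Qed.

Lemma trigM k l th et x : trig k th x * trig l et x =
  2^-1 * (trig (k + l) (th + et) x + trig (k - l) (th - et) x).
Proof.
have -> : trig (k + l) (th + et) x = cos ((k%:~R * x + th) + (l%:~R * x + et)).
  by rewrite /trig intrD; congr cos; ring.
have -> : trig (k - l) (th - et) x = cos ((k%:~R * x + th) - (l%:~R * x + et)).
  by rewrite /trig rmorphB /=; congr cos; ring.
by rewrite cosD cosB /trig; field.
Qed.

Lemma trig_period k th (j : int) x : trig k th (x + j%:~R * (2 * pi)) = trig k th x.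
Proof.
rewrite /trig mulrDr -addrA (addrC _ th) addrA mulrA -intrM.
move: (k * j) (_ + th) => n y.
have pn (p : nat) z : cos (z + p%:R * (2 * pi)) = cos z :> R.
  by rewrite -[RHS](periodicn (@cosD2pi R) p z) -[(pi *+ 2) *+ p]mulr_natl -[pi *+ 2]mulr_natl.
case: n => n; first exact: pn.
rewrite NegzE intrN mulNr -[in RHS](subrK (n.+1%:R * (2 * pi)) y) pn //.
Qed.
End Trig.

(** * Completeness of the trigonometric system *)

Section Orthogonality.
Context d (T : measurableType d) (R : realType) (mu : {measure set T -> \bar R}).
Implicit Types (F h : T -> R).

Lemma cvg_Rint_dominated F (hn : nat -> T -> R) h : summable mu F ->
  (forall n, measurable_fun setT (hn n)) -> measurable_fun setT h ->
  (exists C, forall n x, `|hn n x| <= C) ->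
  {ae mu, forall x, hn n x @[n --> \oo] --> h x} ->
  (\int[mu]_x (F x * hn n x)) @[n --> \oo] --> \int[mu]_x (F x * h x).
Proof.
move=> Fi mhn mh [C hC] hnh; have mF := summable_measurable Fi.
have gi : summable mu (fun x => C * `|F x|) by apply: summableZ; exact: integrable_norm.
have [hi _ L] := @dominated_convergence _ _ _ mu setT measurableT
  (fun n x => (F x * hn n x)%:E) (fun x => (F x * h x)%:E) (EFin \o (fun x => C * `|F x|))
  (fun n => (measurable_EFinP _ _).2 (measurable_funM mF (mhn n)))
  ((measurable_EFinP _ _).2 (measurable_funM mF mh))
  ltac:(apply: filterS hnh => x hx _; apply: cvg_EFin; [exact: nearW|exact: cvgMr])
  gi
  ltac:(by apply: aeW => x n _; rewrite /= lee_fin normrM mulrC ler_wpM2r).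
apply: fine_cvg; move: L; rewrite fineK//; exact: integrable_fin_num.
Qed.

Lemma orth_lim F (hn : nat -> T -> R) h : summable mu F ->
  (forall n, measurable_fun setT (hn n)) -> measurable_fun setT h ->
  (exists C, forall n x, `|hn n x| <= C) ->
  {ae mu, forall x, hn n x @[n --> \oo] --> h x} ->
  (forall n, \int[mu]_x (F x * hn n x) = 0) -> \int[mu]_x (F x * h x) = 0.
Proof.
move=> Fi mhn mh hC hnh h0; have := cvg_Rint_dominated Fi mhn mh hC hnh.
by under eq_fun do rewrite h0; move=> /(cvg_unique _ (cvg_cst 0)) <-.
Qed.

(** The partial sums of the exponential series converge boundedly. *)
Lemma orth_exp F h (C : R) : summable mu F -> measurable_fun setT h ->
  (forall x, `|h x| <= C) -> (forall k, \int[mu]_x (F x * h x ^+ k) = 0) ->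
  \int[mu]_x (F x * expR (h x)) = 0.
Proof.
move=> Fi mh hC h0.
pose S n x := series (exp_coeff (h x)) n.
have mexp k : measurable_fun setT (fun x => exp_coeff (h x) k).
  by apply: measurable_funM => //; apply: measurable_funX.
have mS n : measurable_fun setT (S n) by apply: measurable_sum.
have SC n x : `|S n x| <= expR C.
  have : [normed series (exp_coeff (h x))] n <= expR `|h x|.
    rewrite normed_series_exp_coeff; apply: nondecreasing_cvgn_le.
      by apply: nondecreasing_series => k _ _; apply: exp_coeff_ge0.
    exact: is_cvg_series_exp_coeff.
  move=> /(le_trans (ler_norm_sum _ _ _)) /le_trans; apply.
  by rewrite ler_expR.
apply: (@orth_lim _ S) => //.
- by apply: measurableT_comp.
- by exists (expR C).
- apply: aeW => x; exact: is_cvg_series_exp_coeff.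
elim=> [|n IHn].
  by rewrite -[RHS](Rint0 mu); apply: eq_Rint => x; rewrite /S /series /= big_geq// mulr0.
transitivity (\int[mu]_x (F x * S n x + (n`!%:R)^-1 * (F x * h x ^+ n))).
  by apply: eq_Rint => x; rewrite /S /series /= big_nat_recr//= mulrDr /exp_coeff /=; ring.
have Fh : summable mu (fun x => F x * h x ^+ n).
  under eq_fun do rewrite mulrC.
  apply: (@summableMb _ _ _ _ _ _ (C ^+ n)) => //; first exact: measurable_funX.
  by move=> x; rewrite normrX lerXn2r// nnegrE// (le_trans _ (hC x)).
rewrite RintD; first by rewrite IHn RintZ// h0 mulr0 addr0.
- under eq_fun do rewrite mulrC.
  exact: (summableMb (mS n) (SC n)).
- exact: summableZ.
Qed.

End Orthogonality.

Section Fundamental.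
Context {R : realType}.
Local Notation circ := (@circ R).
Implicit Types (F g h : R -> R).

Definition trig_orth F := forall k th, \int[circ]_x (F x * trig k th x) = 0.

Lemma summable_trig F k th : summable circ F -> summable circ (fun x => F x * trig k th x).
Proof.
move=> Fi; under eq_fun do rewrite mulrC.
exact: (summableMb (measurable_trig k th) (trig_le1 k th) Fi).
Qed.

(** By [trigM] the product of two monomials is a sum of two monomials. *)
Lemma trig_orthM F c d : summable circ F -> trig_orth F ->
  trig_orth (fun x => F x * (trig 1 c x + d)).
Proof.
move=> Fi F0 k th.
transitivity (\int[circ]_x (2^-1 * (F x * trig (1 + k) (c + th) x) +
   (2^-1 * (F x * trig (1 - k) (c - th) x) + d * (F x * trig k th x)))).
  by apply: eq_Rint => x; rewrite mulrDr mulrDl -mulrA trigM; ring.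
rewrite RintD; last 2 first.
- by apply: summableZ; apply: summable_trig.
- by apply: summableD; apply: summableZ; apply: summable_trig.
rewrite RintD; last 2 first.
- by apply: summableZ; apply: summable_trig.
- by apply: summableZ; apply: summable_trig.
by rewrite !RintZ ?F0 ?mulr0 ?addr0//; apply: summable_trig.
Qed.

Lemma trig_bounded c d x : `|trig 1 c x + d| <= 1 + `|d| :> R.
Proof. by rewrite (le_trans (ler_normD _ _))// lerD2r trig_le1. Qed.

Lemma trig_orth_pow F c d j : summable circ F -> trig_orth F ->
  summable circ (fun x => F x * (trig 1 c x + d) ^+ j) /\
  trig_orth (fun x => F x * (trig 1 c x + d) ^+ j).
Proof.
move=> Fi F0; elim: j => [|j [IHs IHo]].
  by under eq_fun do rewrite expr0 mulr1.
under eq_fun do rewrite exprSr mulrA.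
split; last exact: trig_orthM.
under eq_fun do rewrite mulrC.
apply: (summableMb _ (trig_bounded c d)) => //.
by apply: measurable_funD => //; exact: measurable_trig.
Qed.

(** Exponentiate twice: powers of [exp (- n g)] are again exponentials of
    multiples of [g], so [orth_exp] applies to [exp (- n g)] as it does to [-
    n g]. *)
Lemma orth_expexp F c d n : summable circ F -> trig_orth F ->
  \int[circ]_x (F x * expR (- expR (- (n%:R * (trig 1 c x + d))))) = 0.
Proof.
move=> Fi F0.
have mg : measurable_fun setT (fun x => trig 1 c x + d).
  by apply: measurable_funD => //; exact: measurable_trig.
have nb (l : nat) (x : R) : `|- (l%:R * (trig 1 c x + d))| <= l%:R * (1 + `|d|) :> R.
  by rewrite normrN normrM normr_nat ler_wpM2l// trig_bounded.
have mng (l : nat) : measurable_fun setT (fun x : R => - (l%:R * (trig 1 c x + d))).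
  by apply: measurableT_comp => //; apply: measurable_funM.
have E1 l : \int[circ]_x (F x * expR (- (l%:R * (trig 1 c x + d)))) = 0.
  apply: (orth_exp Fi (mng l) (nb l)) => k.
  have [Fgi Fgo] := trig_orth_pow c d k Fi F0.
  transitivity (\int[circ]_x ((- l%:R) ^+ k * (F x * (trig 1 c x + d) ^+ k))).
    by apply: eq_Rint => x; rewrite -mulNr exprMn; ring.
  rewrite RintZ// (_ : \int[circ]_x _ = 0) ?mulr0// -[RHS](Fgo 0 0).
  by apply: eq_Rint => x; rewrite trig0 cos0 mulr1.
apply: (@orth_exp _ _ _ _ _ _ (expR (n%:R * (1 + `|d|)))) => //.
- by do 2 apply: measurableT_comp => //.
- move=> x; rewrite normrN ger0_norm ?expR_ge0// ler_expR.
  exact: (le_trans (ler_norm _) (nb n x)).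
- move=> k; transitivity (\int[circ]_x ((-1) ^+ k * (F x * expR (- ((k * n)%:R * (trig 1 c x + d)))))).
    apply: eq_Rint => x; rewrite -[in LHS]mulN1r exprMn mulrCA; congr (_ * (_ * _)).
    by rewrite -expRM_natl natrM mulrN mulrA.
  rewrite RintZ ?E1 ?mulr0//.
  under eq_fun do rewrite mulrC.
  apply: (@summableMb _ _ _ _ _ _ (expR ((k * n)%:R * (1 + `|d|)))) => //.
    by apply: measurableT_comp.
  move=> x; rewrite ger0_norm ?expR_ge0// ler_expR.
  exact: (le_trans (ler_norm _) (nb _ x)).
Qed.

Lemma cvg_expR_natN (c : R) : 0 < c -> expR (- (n%:R * c)) @[n --> \oo] --> (0 : R).
Proof.
move=> c0; under eq_fun do rewrite -mulrN expRM_natl.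
by apply: cvg_expr; rewrite ger0_norm ?expR_ge0// expR_lt1 oppr_lt0.
Qed.

(** The sequence sharpens to the indicator of the positive half line. *)
Lemma cvg_expexp (c : R) : c != 0 ->
  expR (- expR (- (n%:R * c))) @[n --> \oo] --> ((0 < c)%R%:R : R).
Proof.
case: ltgtP => // c0 _.
- rewrite (_ : true%:R = expR (- 0)); last by rewrite oppr0 expR0.
  apply: (@cvg_comp _ _ _ _ expR _ _ _ _ (@continuous_expR R (- 0))).
  by apply: cvgN; apply: cvg_expR_natN.
- apply: (@squeeze_cvgr _ _ _ _ (fun=> 0) (fun n => expR (- (n%:R * (- c))))).
  + near=> n; rewrite expR_ge0/= ler_expR lerN2 mulrN.
    by rewrite (le_trans _ (expR_ge1Dx _))// lerDr.
  + exact: cvg_cst.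
  + by apply: cvg_expR_natN; rewrite oppr_gt0.
Unshelve. all: by end_near. Qed.

(** The arc from [a] to [2 pi] is the set where a cosine centred at its
    midpoint exceeds the common value at its end points. *)
Lemma cos_arc (a x : R) : 0 <= a < 2 * pi -> 0 < x < 2 * pi -> x != a ->
  let g := trig 1 (- ((a + 2 * pi) / 2)) x - cos ((2 * pi - a) / 2) in
  g != 0 /\ (0 < g) = (a < x).
Proof.
move=> /andP[a0 a2] /andP[x0 x2] xa; rewrite /trig mul1r /=.
set c := (a + 2 * pi) / 2; set d := (2 * pi - a) / 2.
have dlt t : 0 <= t -> t < d -> cos d < cos t.
  by move=> t0 td; rewrite ltr_cos// in_itv/=; apply/andP; split; move: td; rewrite /d; lra.
have dgt t : d < t -> t <= pi -> cos t < cos d.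
  by move=> dt tpi; rewrite ltr_cos// in_itv/=; apply/andP; split; move: dt; rewrite /d; lra.
move: xa; case: (ltgtP a x) => // [ax|xa] _.
  have : cos d < cos (x - c).
    rewrite -[X in _ < X]cos_norm; apply: dlt => //; rewrite ltr_norml /c /d; apply/andP; split; lra.
  by rewrite -subr_gt0 => g0; rewrite gt_eqF// g0.
have : cos (x - c) < cos d.
  rewrite -[X in X < _]cosN opprB; have [cx|cx] := leP (c - x) pi.
    by apply: dgt => //; rewrite /c /d; lra.
  rewrite -[X in X < _]cosN -[X in X < _](@cosD2pi R); apply: dgt; move: cx; rewrite mulr2n /c /d; lra.
by rewrite -subr_lt0 => g0; rewrite lt_eqF// ltNge (ltW g0).
Qed.

(** Choose [g] as in [cos_arc]; the indicator of the arc is the bounded limit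
    of the functions [exp (- exp (- n g))], to which [F] is orthogonal. *)
Lemma trig_orth_ray F a : summable circ F -> trig_orth F ->
  \int[circ]_x (F x * (a < x)%R%:R) = 0.
Proof.
move=> Fi F0; have mF := summable_measurable Fi.
have mst b : measurable_fun setT (fun x : R => (b < x)%R%:R : R).
  by apply: measurable_bool2R; apply: measurable_fun_ltr.
have [a0|a0] := ltP a 0.
  transitivity (\int[circ]_x (F x * trig 0 0 x)); last exact: F0.
  apply: ae_eq_Rint.
  - exact: measurable_funM.
  - by apply: measurable_funM => //; exact: measurable_trig.
  apply: filterS ae_circ_arc => x; rewrite /arc /= in_itv/= => /andP[x0 _].
  by rewrite (lt_le_trans a0 x0) trig0 cos0.
have [a2|a2] := leP (2 * pi) a.
  rewrite -(Rint0 circ); apply: ae_eq_Rint => //; first exact: measurable_funM.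
  apply: filterS ae_circ_arc => x; rewrite /arc /= in_itv/= => /andP[_ x2].
  by rewrite ltNge (ltW (lt_le_trans x2 a2)) mulr0.
have a02 : 0 <= a < 2 * pi by rewrite a0.
pose g x := trig 1 (- ((a + 2 * pi) / 2)) x - cos ((2 * pi - a) / 2) : R.
have mg : measurable_fun setT g.
  by apply: measurable_funD => //; exact: measurable_trig.
apply: (@orth_lim _ _ _ _ _ (fun n x => expR (- expR (- (n%:R * g x))))) => //.
- move=> n; do 2 (apply: measurableT_comp => //; apply: measurableT_comp => //).
  exact: measurable_funM.
- by exists 1 => n x; rewrite ger0_norm ?expR_ge0// expR_le1 oppr_le0 expR_ge0.
- apply: filterS3 ae_circ_arc (ae_circ_neq 0) (ae_circ_neq a) => x.
  rewrite /arc /= in_itv/= => /andP[x0 x2] xn0 xa.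
  have x02 : 0 < x < 2 * pi by rewrite lt_neqAle eq_sym xn0 x0 x2.
  have [gn0 <-] := cos_arc a02 x02 xa.
  exact: cvg_expexp.
- by move=> n; exact: orth_expexp.
Qed.

(** By [trig_orth_ray] the integrals of [F] over rays vanish; rays generate
    the Borel sets and are stable under intersection, so the integral of [F]
    over every Borel set vanishes. *)
Lemma trig_orth_eq0 F : summable circ F -> trig_orth F -> {ae circ, forall x, F x = 0}.
Proof.
move=> Fi F0; have mF := summable_measurable Fi.
suff H A : measurable A -> (\int[circ]_(x in A) (F x)%:E = 0)%E.
  have L : ae_eq circ setT (EFin \o F) (cst 0%E).
    by apply: integral_ae_eq => // E _ mE; rewrite integral0 (H E mE).
  by apply: filterS L => x /(_ I) [].
have FA B : measurable B -> circ.-integrable B (EFin \o F).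
  by move=> mB; apply: (integrableS measurableT).
move=> mA; move: mA; rewrite -[measurable A]/(measurableR A).
rewrite /measurableR (RGenOInfty.measurableE R) => mA.
have F00 : \int[circ]_x F x = 0.
  by rewrite -[RHS](F0 0 0); apply: eq_Rint => x; rewrite trig0 cos0 mulr1.
suff D : forall S, <<s @RGenOInfty.G R >> S -> (\int[circ]_(x in S) (F x)%:E = 0)%E.
  exact: D.
apply: (@dynkin_induction _ R) => //.
- exact: RGenOInfty.measurableE.
- move=> _ _ [x ->] [y ->]; exists (Num.max x y).
  by apply/seteqP; split=> z /=; rewrite !in_itv/= !andbT gt_max => /andP.
- by rewrite -[LHS]/(\int[circ]_x (EFin \o F) x)%E (RintE Fi) F00.
- move=> _ [a ->]; rewrite integral_mkcond.
  transitivity (\int[circ]_x (F x * (a < x)%R%:R)%R)%:E; last by rewrite trig_orth_ray.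
  rewrite -RintE; last first.
    under eq_fun do rewrite mulrC.
    apply: (summableMb (C := 1) _ _ Fi) => [|x]; last exact: normr_bool.
    by apply: measurable_bool2R; apply: measurable_fun_ltr.
  apply: eq_integral => x _; rewrite patchE.
  case: ifPn => [|/negP]; rewrite inE /= in_itv/= andbT => ax; first by rewrite ax mulr1.
  by rewrite (negbTE (introN idP ax)) mulr0.
- move=> S mS S0.
  have := @integral_setU _ _ _ circ S (~` S) (EFin \o F) mS (measurableC mS).
  rewrite setUv S0 add0e => <-.
  + by rewrite (RintE Fi) F00.
  + exact/measurable_EFinP.
  + by apply/disj_setPS; rewrite setICr.
- move=> S mS tS S0; rewrite integral_bigcup//; last exact: FA (bigcup_measurable _).
  by rewrite eseries0.
Qed.

End Fundamental.

(** * Weak derivatives on the circle *)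

Section WeakDerivativeCircle.
Context {R : realType}.
Local Notation circ := (@circ R).
Local Notation nu := (circ \x circ)%E.
Implicit Types (f g : R -> R).

Lemma twopi_ge0 : 0 <= 2 * pi :> R.
Proof. by rewrite mulr_ge0// pi_ge0. Qed.

Lemma circT : circ setT = (2 * pi)%:E.
Proof.
rewrite -[LHS]/(lebesgue_measure (setT `&` arc)) setTI lebesgue_measure_itv/= lte_fin.
by rewrite mulr_gt0// ?pi_gt0// oppr0 adde0.
Qed.

Lemma Rint_circ_cst (k : R) : \int[circ]_x k = k * (2 * pi).
Proof. by rewrite Rintegral_cst//; congr (_ * _); exact: (congr1 fine circT). Qed.

Lemma summable_bounded f (C : R) : measurable_fun setT f -> (forall x, `|f x| <= C) ->
  summable circ f.
Proof.
move=> mf fC; have := summableMb mf fC (summable_cst 1 circ_lty).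
by under eq_fun do rewrite mulr1.
Qed.

(** Integration by parts, as Fubini on the triangle [t < x]; both [f] and [g]
    have mean zero, which removes the boundary terms. *)
Lemma Rint_mul_prim F f g : (forall y : R, is_derive y (1 : R) F (f y)) ->
  continuous f -> F (2 * pi) = F 0 -> (exists C, forall x, `|f x| <= C) ->
  summable circ g -> \int[circ]_x g x = 0 ->
  \int[circ]_x (prim g x * f x) = - \int[circ]_x (g x * F x).
Proof.
move=> dF cf Fper [C fC] gi g0.
have mf : measurable_fun setT f by exact: continuous_measurable_fun.
have cF : continuous F.
  move=> y; apply: differentiable_continuous; apply/derivable1_diffP.
  exact: (@ex_derive _ _ _ _ _ _ _ (dF y)).
have mF : measurable_fun setT F by exact: continuous_measurable_fun.
have fi := summable_bounded mf fC.
have pi20 := twopi_ge0.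
have f0 : \int[circ]_x f x = 0.
  by rewrite -prim_end// (prim_C1 dF cf) ?Fper ?subrr// lexx andbT.
pose K z : R := (z.1 < z.2)%R%:R * (g z.1 * f z.2).
have Ki : summable nu K.
  apply: (@summableMb _ _ _ nu (fun z : R * R => (z.1 < z.2)%R%:R) (fun z : R * R => g z.1 * f z.2) 1).
  - exact: measurable_step2.
  - by move=> z; apply: normr_bool.
  - exact: summable_prod.
transitivity (\int[nu]_z K z).
  rewrite Rint_Fubini2//; apply: eq_Rint => x.
  rewrite mulrC /prim -RintZ; last exact: summable_step.
  by apply: eq_Rint => t; rewrite /K /=; ring.
rewrite Rint_Fubini1//.
have mstep (t : R) : measurable_fun setT (fun x : R => (t < x)%R%:R : R).
  by apply: measurable_bool2R; apply: measurable_fun_ltr.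
have E t : arc t -> \int[circ]_x K (t, x) = g t * (F 0 - F t).
  rewrite /arc /= in_itv/= => /andP[t0 t2].
  rewrite /K /=; under eq_Rint do rewrite mulrCA.
  rewrite RintZ; last by apply: (summableMb (mstep t) _ fi) => x; apply: normr_bool.
  congr (_ * _).
  transitivity (\int[circ]_x f x - prim f t); last first.
    by rewrite f0 sub0r (prim_C1 dF cf) ?opprB// t0 ltW.
  rewrite /prim -RintB//; last exact: summable_step.
  apply: ae_eq_Rint; first by apply: measurable_funM.
    by apply: measurable_funB => //; apply: measurable_funM => //; apply: measurable_step.
  apply: filterS (ae_circ_neq t) => x; case: (ltgtP x t) => // _ _.
    by rewrite mul0r mul1r subrr.
  by rewrite mul0r mul1r subr0.
have bF : exists D, {ae circ, forall t, `|F t| <= D}.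
  exists (`|F 0| + C * (2 * pi)); apply: filterS ae_circ_arc => t.
  rewrite /arc /= in_itv/= => /andP[t0 t2].
  have -> : F t = F 0 + prim f t by rewrite (prim_C1 dF cf) ?t0 ?ltW// addrC subrK.
  rewrite (le_trans (ler_normD _ _))// lerD2l (le_trans (prim_le _ fi))//.
  rewrite -Rint_circ_cst.
  apply: ae_le_Rint; [exact: integrable_norm|apply: summable_cst; exact: circ_lty|].
  exact: aeW.
have [D FD] := bF.
have gF : summable circ (fun t => g t * F t).
  apply: (@summable_ae_le _ _ _ _ _ (fun t => D * g t)); last exact: summableZ.
    by apply: measurable_funM => //; exact: summable_measurable gi.
  apply: filterS FD => t FDt; rewrite !normrM mulrC ler_wpM2r//.
  by rewrite (le_trans FDt)// ler_norm.
transitivity (\int[circ]_t (F 0 * g t - g t * F t)).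
  apply: ae_eq_Rint.
  - exact: summable_measurable (summable_Fubini1 Ki).
  - apply: summable_measurable (summableB _ gF); exact: summableZ.
  by apply: filterS ae_circ_arc => t /E ->; rewrite mulrBr mulrC.
rewrite RintB//; last exact: summableZ.
by rewrite RintZ// g0 mulr0 sub0r.
Qed.

(** By [Rint_mul_prim], [f - prim g] is orthogonal to every monomial of
    nonzero frequency, so it is constant by [trig_orth_eq0]. *)
Lemma weak_ac_circ f g : summable circ f -> summable circ g ->
  (forall k th, \int[circ]_x (f x * (k%:~R * trig k (th + pi / 2) x)) =
     - \int[circ]_x (g x * trig k th x)) ->
  ac_circ f g.
Proof.
move=> fi gi fg.
have mf := summable_measurable fi; have mg := summable_measurable gi.
have g0 : \int[circ]_x g x = 0.
  transitivity (\int[circ]_x (g x * trig 0 0 x)).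
    by apply: eq_Rint => x; rewrite trig0 cos0 mulr1.
  rewrite -[LHS]opprK -fg -[RHS]oppr0 -(Rint0 circ); congr (- _).
  by apply: eq_Rint => x; rewrite mul0r mulr0.
have Gi : summable circ (prim g).
  exact: (summable_bounded (measurable_prim gi) (fun x => prim_le x gi)).
have Hi : summable circ (fun x => f x - prim g x) by exact: summableB.
pose c := (\int[circ]_x (f x - prim g x)) / (2 * pi).
have ci : summable circ (fun=> c) by apply: summable_cst; exact: circ_lty.
have per k th : trig k th (2 * pi) = trig k th 0 :> R.
  by rewrite -(trig_period k th 1 0) mul1r add0r.
have bd k th : exists C, forall x : R, `|k%:~R * trig k (th + pi / 2) x| <= C.
  by exists `|k%:~R| => x; rewrite normrM ler_piMr// trig_le1.
have ctk k th : continuous (fun x : R => k%:~R * trig k (th + pi / 2) x).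
  by move=> x; apply: cvgM; [exact: cvg_cst|exact: continuous_trig].
have tk0 k th : k != 0 -> \int[circ]_x trig k th x = 0.
  move=> k0; have kR : k%:~R != 0 :> R by rewrite intr_eq0.
  apply: (mulfI kR); rewrite mulr0 -RintZ; last first.
    exact: (summable_bounded (measurable_trig k th) (trig_le1 k th)).
  rewrite -(subrK (pi / 2) th) -prim_end; last first.
    by apply: measurable_funM => //; exact: measurable_trig.
  rewrite (prim_C1 (is_derive_trig k _) (ctk k _)) ?per ?subrr//.
  by rewrite lexx twopi_ge0.
have H0 : trig_orth (fun x => f x - prim g x - c).
  move=> k th; have [->|k0] := eqVneq k 0.
    transitivity (\int[circ]_x (cos th * (f x - prim g x - c))).
      by apply: eq_Rint => x; rewrite trig0 mulrC.
    rewrite RintZ; last exact: summableB.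
    rewrite RintB// Rint_circ_cst /c mulfVK ?subrr ?mulr0//.
    by rewrite mulf_neq0// gt_eqF// pi_gt0.
  have kR : k%:~R != 0 :> R by rewrite intr_eq0.
  have bi h : summable circ h -> summable circ (fun x => h x * (k%:~R * trig k (th - pi / 2 + pi / 2) x)).
    move=> hi; have [C bC] := bd k (th - pi / 2).
    under eq_fun do rewrite mulrC.
    by apply: (summableMb _ bC hi); apply: measurable_funM => //; exact: measurable_trig.
  apply: (mulfI kR); rewrite mulr0 -RintZ; last by apply: summable_trig; exact: summableB.
  transitivity (\int[circ]_x ((f x * (k%:~R * trig k (th - pi / 2 + pi / 2) x) -
     prim g x * (k%:~R * trig k (th - pi / 2 + pi / 2) x)) - (c * k%:~R) * trig k th x)).
    by apply: eq_Rint => x; rewrite subrK; ring.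
  rewrite RintB; last 2 first.
  - by apply: summableB; exact: bi.
  - by apply: summableZ; exact: (summable_bounded (measurable_trig k th) (trig_le1 k th)).
  rewrite RintB; [|exact: bi|exact: bi].
  rewrite fg (Rint_mul_prim (is_derive_trig k _) (ctk k _) _ (bd k _)) ?per// subrr sub0r.
  rewrite RintZ ?tk0 ?mulr0 ?oppr0//.
  exact: (summable_bounded (measurable_trig k th) (trig_le1 k th)).
split => //; exists c.
apply: filterS (trig_orth_eq0 (summableB Hi ci) H0) => x /eqP.
by rewrite subr_eq0 => /eqP <-; rewrite subrK.
Qed.

(** This brings smooth test functions into the class, so that they can be
    multiplied with weakly differentiable functions. *)
Lemma C1_ac_circ (F f : R -> R) : (forall y : R, is_derive y (1 : R) F (f y)) ->
  continuous f -> F (2 * pi) = F 0 -> ac_circ F f.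
Proof.
move=> dF cf Fper.
have cF : continuous F.
  move=> y; apply: differentiable_continuous; apply/derivable1_diffP.
  exact: (@ex_derive _ _ _ _ _ _ _ (dF y)).
have mF : measurable_fun setT F by exact: continuous_measurable_fun.
have mf : measurable_fun setT f by exact: continuous_measurable_fun.
have pi20 := twopi_ge0.
have fi : summable circ f.
  have : lebesgue_measure.-integrable `[0, 2 * pi] (EFin \o f).
    apply: continuous_compact_integrable; first exact: segment_compact.
    exact: continuous_subspaceT.
  move=> /integrableP[_ fi]; apply/integrableP; split; first exact/measurable_EFinP.
  apply: le_lt_trans fi; rewrite integral_circE; last by do 2 apply: measurableT_comp => //.
  apply: ge0_subset_integral => //=.
  - exact: measurable_arc.
  - by apply: measurable_funTS; do 2 apply: measurableT_comp => //.
  - by move=> x; rewrite /arc /= !in_itv/= => /andP[-> /ltW].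
split => //; first by rewrite -prim_end// (prim_C1 dF cf) ?Fper ?subrr// lexx andbT.
exists (F 0); apply: filterS ae_circ_arc => x; rewrite /arc /= in_itv/= => /andP[x0 x2].
by rewrite (prim_C1 dF cf) ?x0 ?ltW// addrC subrK.
Qed.
End WeakDerivativeCircle.

(** * Absolute continuity on lines *)

Section Lines.
Context {R : realType}.
Local Notation circ := (@circ R).
Local Notation nu := (circ \x circ)%E.
Local Notation plane := (R * R)%type.
Implicit Types (f g : plane -> R) (j : 'I_2).

(** The coordinate that varies along the line comes last. *)
Definition pt j (t s : R) : plane := if j == 0 then (s, t) else (t, s).

Lemma measurable_line f j t : measurable_fun setT f ->
  measurable_fun setT (fun s => f (pt j t s)).
Proof.
move=> mf; rewrite /pt; case: (j == 0); first exact: measurable_fun_pair1.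
exact: measurable_fun_pair2.
Qed.

Lemma ae_line (P : plane -> Prop) j : {ae nu, forall z, P z} ->
  {ae circ, forall t, {ae circ, forall s, P (pt j t s)}}.
Proof.
rewrite /pt; case: (j == 0) => h; first exact: (ae_section2 h).
exact: (ae_section1 h).
Qed.

Lemma ae_line_eq f g j : measurable_fun setT f -> measurable_fun setT g ->
  {ae circ, forall t, {ae circ, forall s, f (pt j t s) = g (pt j t s)}} ->
  {ae nu, forall z, f z = g z}.
Proof.
move=> mf mg; rewrite /pt; case: (j == 0); last exact: ae_prod_eq.
move=> fg; pose sw (z : plane) := (z.2, z.1).
have msw : measurable_fun setT sw.
  by apply: measurable_fun_pair; [exact: measurable_snd|exact: measurable_fst].
have := ae_prod_eq (measurableT_comp mf msw) (measurableT_comp mg msw) fg.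
move=> [A [mA A0 PA]]; exists (sw @^-1` A); split.
- by rewrite -[X in measurable X]setTI; exact: msw.
- rewrite -A0.
  transitivity (pushforward nu sw A); first by [].
  symmetry; apply: (@product_measure_unique _ _ _ _ _ circ circ (pushforward nu sw)) => //.
  move=> B C mB mC.
  transitivity ((circ \x circ)%E (C `*` B)).
    by congr (product_measure1 _ _ _); apply/seteqP; split => -[x y] /= [].
  by rewrite product_measure1E// muleC.
- move=> [x y] /= h; apply: PA => /= h'; exact: h.
Qed.

Lemma summable_line f j : summable nu f ->
  {ae circ, forall t, summable circ (fun s => f (pt j t s))}.
Proof.
rewrite /pt; case: (j == 0) => h; first exact: (ae_summable2 h).
exact: (ae_summable1 h).
Qed.

Lemma summable_Rint_line f j : summable nu f ->
  summable circ (fun t => \int[circ]_s f (pt j t s)).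
Proof.
rewrite /pt; case: (j == 0) => h; first exact: (summable_Fubini2 h).
exact: (summable_Fubini1 h).
Qed.

Lemma Rint_line f j : summable nu f ->
  \int[nu]_z f z = \int[circ]_t \int[circ]_s f (pt j t s).
Proof.
rewrite /pt; case: (j == 0) => h; first exact: (Rint_Fubini2 h).
exact: (Rint_Fubini1 h).
Qed.

(** Absolute continuity along almost all closed lines in direction [j].
    Unlike a weak derivative, this notion is stable under products without any
    condition of integrability on the product. *)
Definition ac_line j f f' := [/\ measurable_fun setT f, measurable_fun setT f' &
  {ae circ, forall t, ac_circ (fun s => f (pt j t s)) (fun s => f' (pt j t s))}].

Lemma ac_line_cst j c : ac_line j (fun=> c) (fun=> 0).
Proof. by split => //; apply: aeW => t; apply: ac_circ_cst. Qed.

Lemma ac_line_add j f f' g g' : ac_line j f f' -> ac_line j g g' ->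
  ac_line j (fun x => f x + g x) (fun x => f' x + g' x).
Proof.
move=> [mf mf' hf] [mg mg' hg]; split; [exact: measurable_funD|exact: measurable_funD|].
by apply: filterS2 hf hg => t; apply: ac_circ_add.
Qed.

Lemma ac_line_mul j f f' g g' : ac_line j f f' -> ac_line j g g' ->
  ac_line j (fun x => f x * g x) (fun x => f' x * g x + f x * g' x).
Proof.
move=> [mf mf' hf] [mg mg' hg]; split; first exact: measurable_funM.
  by apply: measurable_funD; exact: measurable_funM.
by apply: filterS2 hf hg => t; apply: ac_circ_mul.
Qed.

Lemma ac_line_scale j c f f' : ac_line j f f' -> ac_line j (fun x => c * f x) (fun x => c * f' x).
Proof.
move=> /(ac_line_mul (ac_line_cst j c)); congr ac_line.
by apply/funext => x; rewrite mul0r add0r.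
Qed.

(** Fubini: on each line the derivative of a periodic function integrates to
    zero. *)
Lemma ac_line_int0 j f f' : ac_line j f f' -> summable nu f' -> \int[nu]_z f' z = 0.
Proof.
move=> [mf mf' hf] f'i; rewrite (Rint_line j f'i) -(Rint0 circ).
apply: ae_eq_Rint => //; first exact: summable_measurable (summable_Rint_line j f'i).
by apply: filterS hf => t [].
Qed.

(** The primitive of the difference [g - g2] is almost everywhere constant;
    integration by parts against trigonometric monomials makes [g - g2]
    orthogonal to all of them. *)
Lemma ac_circ_unique (f g f2 g2 : R -> R) : ac_circ f g -> ac_circ f2 g2 ->
  {ae circ, forall x, f x = f2 x} -> {ae circ, forall x, g x = g2 x}.
Proof.
move=> [_ gi g0 [c fc]] [_ g2i g20 [c2 f2c]] ff2.
have hi : summable circ (fun x => g x - g2 x) by exact: summableB.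
have Ph : {ae circ, forall x, prim (fun t => g t - g2 t) x = c2 - c}.
  near=> x; have fx : f x = c + prim g x by near: x.
  have f2x : f2 x = c2 + prim g2 x by near: x.
  have ffx : f x = f2 x by near: x.
  have := @primD _ g (fun t => (-1) * g2 t) x gi (summableZ (-1) g2i).
  under [X in prim X]eq_fun do rewrite mulN1r.
  by move=> ->; rewrite primZ//; lra.
have h0 : \int[circ]_x (g x - g2 x) = 0 by rewrite RintB// g0 g20 subrr.
suff H : trig_orth (fun x => g x - g2 x).
  by apply: filterS (trig_orth_eq0 hi H) => x /eqP; rewrite subr_eq0 => /eqP.
move=> k th.
have per : trig k th (2 * pi) = trig k th 0 :> R.
  by rewrite -(trig_period k th 1 0) mul1r add0r.
have ctk : continuous (fun x : R => k%:~R * trig k (th + pi / 2) x).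
  by move=> x; apply: cvgM; [exact: cvg_cst|exact: continuous_trig].
have bd : exists C, forall x : R, `|k%:~R * trig k (th + pi / 2) x| <= C.
  by exists `|k%:~R| => x; rewrite normrM ler_piMr// trig_le1.
have mtk := continuous_measurable_fun ctk.
rewrite -[LHS]opprK -(Rint_mul_prim (is_derive_trig k th) ctk per bd hi h0).
rewrite (@ae_eq_Rint _ _ _ circ _ (fun x => (c2 - c) * (k%:~R * trig k (th + pi / 2) x))).
- rewrite RintZ; last by have [C bC] := bd; exact: summable_bounded mtk bC.
  rewrite -(prim_end mtk) (prim_C1 (is_derive_trig k _) ctk).
    by rewrite per subrr mulr0 oppr0.
  by rewrite lexx twopi_ge0.
- by apply: measurable_funM => //; exact: measurable_prim.
- exact: measurable_funM.
- by apply: filterS Ph => x ->.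
Unshelve. all: by end_near. Qed.

Lemma ac_line_unique j f g f2 g2 : ac_line j f g -> ac_line j f2 g2 ->
  {ae nu, forall z, f z = f2 z} -> {ae nu, forall z, g z = g2 z}.
Proof.
move=> [mf mg fg] [mf2 mg2 fg2] ff2; apply: (@ae_line_eq _ _ j) => //.
apply: filterS3 fg fg2 (ae_line j ff2) => t h1 h2 h3; exact: (ac_circ_unique h1 h2 h3).
Qed.

End Lines.

(** * Weak partial derivatives on the torus *)

Section Smooth.
Context {R : realType}.
Local Notation circ := (@circ R).
Local Notation nu := (circ \x circ)%E.
Local Notation plane := (R * R)%type.
Implicit Types (f g phi : plane -> R) (j : 'I_2).

(** An open set is the union of the boxes with rational data that it contains.
    *)
Lemma open_plane_measurable (U : set plane) : open U -> measurable U.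
Proof.
move=> oU.
pose B (k : nat * int * int) : set plane :=
  [set z | `|z.1 - k.1.2%:~R / k.1.1.+1%:R| < k.1.1.+1%:R^-1 /\
           `|z.2 - k.2%:~R / k.1.1.+1%:R| < k.1.1.+1%:R^-1].
have mB k : measurable (B k).
  have -> : B k = [set x | `|x - k.1.2%:~R / k.1.1.+1%:R| < k.1.1.+1%:R^-1] `*`
    [set x | `|x - k.2%:~R / k.1.1.+1%:R| < k.1.1.+1%:R^-1] by [].
  have mI (c r : R) : measurable [set x : R | `|x - c| < r].
    rewrite (_ : [set x | _] = `]c - r, c + r[%classic); first exact: measurable_itv.
    by apply/seteqP; split => x /=; rewrite in_itv/= ltr_distl.
  by apply: measurableX.
have -> : U = \bigcup_k (if `[< B k `<=` U >] then B k else set0).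
  apply/seteqP; split => [z Uz|z [k _]]; last by case: asboolP => [BU /BU|_ []].
  have /nbhs_ballP[e /= e0 zeU] : nbhs z U by exact: open_nbhs_nbhs.
  pose n := Num.truncn (2 / e); have n0 : 0 < n.+1%:R :> R by [].
  have ne : 2 / n.+1%:R < e.
    by rewrite ltr_pdivrMr// mulrC -ltr_pdivrMr// truncnS_gt.
  have fl (x : R) : `|x - (Num.floor (x * n.+1%:R))%:~R / n.+1%:R| < n.+1%:R^-1.
    rewrite -[X in X - _](mulfK (lt0r_neq0 n0)) -mulrBl normrM.
    rewrite [X in _ * X]ger0_norm ?invr_ge0// gtr_pMl ?invr_gt0//.
    rewrite ger0_norm ?subr_ge0 ?floor_le//.
    by have := floorD1_gt (x * n.+1%:R); rewrite intrD ltrBlDl addrC.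
  exists (n, Num.floor (z.1 * n.+1%:R), Num.floor (z.2 * n.+1%:R)) => //.
  rewrite ifT; first by split; exact: fl.
  apply/asboolP => y [/= y1 y2]; apply: zeU; split; rewrite /ball/= /ball_/=.
  - rewrite (le_lt_trans (ler_distD ((Num.floor (z.1 * n.+1%:R))%:~R / n.+1%:R) _ _))//.
    by rewrite (lt_trans _ ne)// mulr_natl mulr2n ltrD// ?fl// distrC.
  - rewrite (le_lt_trans (ler_distD ((Num.floor (z.2 * n.+1%:R))%:~R / n.+1%:R) _ _))//.
    by rewrite (lt_trans _ ne)// mulr_natl mulr2n ltrD// ?fl// distrC.
apply: countable_bigcupT_measurable; first exact: countableP.
by move=> k; case: ifP.
Qed.

Lemma continuous_plane_measurable f : continuous f -> measurable_fun setT f.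
Proof.
move=> /continuousP cf; apply: (measurability _ (RGenOpens.measurableE R)).
move=> _ [_ [a [b ->] <-]]; rewrite setTI; apply: open_plane_measurable.
exact/cf/interval_open.
Qed.

Lemma smooth_continuous phi : smooth_on setT phi -> continuous phi.
Proof. by move=> /(_ 0%N) [c _] z; exact: c. Qed.

Lemma smooth_partial phi j : smooth_on setT phi -> smooth_on setT (partial j phi).
Proof. by move=> s k; have [_ /(_ j) []] := s k.+1. Qed.

Lemma pt_shift j (t s h : R) : h *: evec j + pt j t s = pt j t (h + s).
Proof.
rewrite /pt /evec; case: (eqVneq j 0) => [->|j0] /=.
  by congr (_, _); rewrite /= /GRing.scale /= ?mulr1 ?mulr0 ?add0r.
have -> : j = 1 by apply/val_inj; case: j j0 => -[|[|//]].
by congr (_, _); rewrite /= /GRing.scale /= ?mulr1 ?mulr0 ?add0r.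
Qed.

Lemma smooth_line phi j t (s : R) : smooth_on setT phi ->
  is_derive s (1 : R) (fun s => phi (pt j t s)) (partial j phi (pt j t s)).
Proof.
move=> /(_ 1%N) [_ /(_ j) [/(_ _ I) d _]].
have E : (fun h : R => h^-1 *: (((fun s => phi (pt j t s)) \o shift s) (h *: (1 : R)) - phi (pt j t s))) =
   (fun h : R => h^-1 *: ((phi \o shift (pt j t s)) (h *: evec j) - phi (pt j t s))).
  by apply/funext => h /=; rewrite pt_shift /GRing.scale /= mulr1.
apply: DeriveDef; first by rewrite /derivable E; exact: d.
by rewrite /derive E.
Qed.

Lemma continuous_line phi j t : continuous phi -> continuous (fun s => phi (pt j t s)).
Proof.
move=> cphi s; apply: (@cvg_comp _ _ _ (pt j t) phi _ _ _ _ (cphi _)).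
rewrite /pt; case: (j == 0).
  apply: (@cvg_pair _ _ _ _ (nbhs s) (nbhs t) _ _ _ (fun x => x) (fun=> t)); first exact: cvg_id.
  exact: cvg_cst.
apply: (@cvg_pair _ _ _ _ (nbhs t) (nbhs s) _ _ _ (fun=> t) (fun x => x)); last exact: cvg_id.
exact: cvg_cst.
Qed.

(** Smooth periodic functions are [C^1] on each line. *)
Lemma smooth_ac_line j phi : smooth_on setT phi -> lattice_periodic T2 phi ->
  ac_line j phi (partial j phi).
Proof.
move=> sphi per; have sp := smooth_partial j sphi.
split.
- exact: continuous_plane_measurable (smooth_continuous sphi).
- exact: continuous_plane_measurable (smooth_continuous sp).
apply: aeW => t; apply: C1_ac_circ.
- by move=> s; exact: smooth_line.
- by apply: continuous_line; exact: smooth_continuous.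
- symmetry; apply: per; rewrite /pt; case: (j == 0).
    by exists 1%R, 0%R; rewrite /T2 /= mul1r mul0r add0r addr0.
  by exists 0%R, 1%R; rewrite /T2 /= mul1r mul0r add0r addr0.
Qed.

Lemma derive_line phi j t (s d : R) :
  is_derive s (1 : R) (fun s => phi (pt j t s)) d ->
  derivable phi (pt j t s) (evec j) /\ partial j phi (pt j t s) = d.
Proof.
have E : (fun h : R => h^-1 *: (((fun s => phi (pt j t s)) \o shift s) (h *: (1 : R)) - phi (pt j t s))) =
   (fun h : R => h^-1 *: ((phi \o shift (pt j t s)) (h *: evec j) - phi (pt j t s))).
  by apply/funext => h /=; rewrite pt_shift /GRing.scale /= mulr1.
by move=> [d1 d2]; split; [move: d1; rewrite /derivable E|move: d2; rewrite /derive E].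
Qed.

Definition along j (z : plane) := if j == 0 then z.1 else z.2.
Definition across j (z : plane) := if j == 0 then z.2 else z.1.

Lemma pt_along j z : pt j (across j z) (along j z) = z.
Proof. by rewrite /pt /along /across; case: (j == 0); case: z. Qed.

(** Test functions that separate the variables; the coefficient [c] makes the
    family stable under [partial j]. *)
Definition trig2 j (c : R) k th l et : plane -> R := fun z =>
  c * (trig k th (along j z) * trig l et (across j z)).

Lemma trig2_pt j c k th l et t s :
  trig2 j c k th l et (pt j t s) = c * (trig k th s * trig l et t).
Proof. by rewrite /trig2 /along /across /pt; case: (j == 0). Qed.

Lemma trig2_swap j i c k th l et : (i == 0) != (j == 0) ->
  trig2 j c k th l et = trig2 i c l et k th.
Proof.
move=> ij; apply/funext => z; rewrite /trig2 /along /across.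
by move: ij; case: (i == 0); case: (j == 0) => // _; rewrite [trig _ _ _ * _]mulrC.
Qed.

Lemma continuous_trig2 j c k th l et : continuous (trig2 j c k th l et).
Proof.
have cfst : continuous (fst : plane -> R) by move=> z; exact: cvg_fst.
have csnd : continuous (snd : plane -> R) by move=> z; exact: cvg_snd.
move=> z; apply: cvgM; first exact: cvg_cst.
have c1 (p : plane -> R) n (a : R) : continuous p -> trig n a (p x) @[x --> z] --> trig n a (p z).
  by move=> cp; apply: (@cvg_comp _ _ _ p (trig n a) _ _ _ (cp z)); exact: continuous_trig.
by apply: cvgM; apply: c1; rewrite /along /across; case: (j == 0).
Qed.

Lemma is_derive_trig2 j c k th l et t (s : R) :
  is_derive s (1 : R) (fun s => trig2 j c k th l et (pt j t s))
    (trig2 j (c * k%:~R) k (th + pi / 2) l et (pt j t s)).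
Proof.
rewrite trig2_pt.
have -> : (fun s => trig2 j c k th l et (pt j t s)) = (fun s => (c * trig l et t) *: trig k th s).
  by apply/funext => x; rewrite trig2_pt /GRing.scale /=; ring.
have dt := is_derive_trig k th s.
apply: (is_derive_eq (is_deriveZ (c * trig l et t) dt)).
by rewrite /GRing.scale /=; ring.
Qed.

Lemma partial_trig2 j c k th l et :
  partial j (trig2 j c k th l et) = trig2 j (c * k%:~R) k (th + pi / 2) l et.
Proof.
apply/funext => z; rewrite -(pt_along j z).
by have [] := derive_line (is_derive_trig2 j c k th l et (across j z) (along j z)).
Qed.

Lemma smooth_trig2 j c k th l et : smooth_on setT (trig2 j c k th l et).
Proof.
move=> n; elim: n j c k th l et => [|n IHn] j c k th l et.
  by split => // x _; exact: continuous_trig2.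
split=> [x _|i]; first exact: continuous_trig2.
have [ij|/negPn/eqP ij] := boolP ((i == 0) != (j == 0)).
  rewrite (trig2_swap _ _ _ _ _ ij); split; last by rewrite partial_trig2; exact: IHn.
  move=> x _; rewrite -(pt_along i x).
  by have [] := derive_line (is_derive_trig2 i c l et k th (across i x) (along i x)).
have -> : j = i.
  by apply/val_inj; move: ij; case: i => -[|[|//]] ?; case: j => -[|[|//]].
split; last by rewrite partial_trig2; exact: IHn.
move=> x _; rewrite -(pt_along i x).
by have [] := derive_line (is_derive_trig2 i c k th l et (across i x) (along i x)).
Qed.

Lemma periodic_trig2 j c k th l et : lattice_periodic T2 (trig2 j c k th l et).
Proof.
move=> x _ [a [b ->]]; rewrite /trig2 /along /across /T2 /=.
by case: (j == 0); rewrite !trig_period.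
Qed.

Lemma memLp1_summable f : memLp T2 1%E f -> summable nu f.
Proof. by move=> [_ /Lfun1_integrable] /integrable_torusE. Qed.

Lemma summable_memLp1 f : lattice_periodic T2 f -> summable nu f -> memLp T2 1%E f.
Proof. by move=> pf fi; split=> //; apply/Lfun1_integrable/integrable_torusE. Qed.

(** Every phase is a combination of the two phases [0] and [pi / 2], which
    reduces the tests needed on a line to countably many. *)
Lemma trig_phase k (th x : R) :
  trig k th x = cos th * trig k 0 x + sin th * trig k (pi / 2) x.
Proof. by rewrite /trig addr0 cosDpihalf cosD; ring. Qed.

Lemma ae_all_trig (P : int -> R -> R -> Prop) :
  (forall k th, {ae circ, forall t, P k th t}) ->
  {ae circ, forall t, forall k, P k 0 t /\ P k (pi / 2) t}.
Proof.
move=> H.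
have H1 : {ae circ, forall t, forall n : nat, P (Posz n) 0 t /\ P (Posz n) (pi / 2) t}.
  by apply/ae_foralln => n; apply: filterS2 (H (Posz n) 0) (H (Posz n) (pi / 2)) => t.
have H2 : {ae circ, forall t, forall n : nat, P (Negz n) 0 t /\ P (Negz n) (pi / 2) t}.
  by apply/ae_foralln => n; apply: filterS2 (H (Negz n) 0) (H (Negz n) (pi / 2)) => t.
by apply: filterS2 H1 H2 => t h1 h2 [] n.
Qed.

(** Test with a product of two monomials.  For a fixed monomial along the
    lines, completeness in the transversal variable gives the one-dimensional
    weak identity on almost every line; by [ae_all_trig] the same lines serve
    for all monomials, and [weak_ac_circ] applies there. *)
Lemma weak_partial_ac_line j f g : is_weak_partial T2 j f g -> ac_line j f g.
Proof.
move=> [/memLp1_summable fi /memLp1_summable gi fg].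
have mf := summable_measurable fi; have mg := summable_measurable gi.
split => //.
pose P k th t := \int[circ]_s (f (pt j t s) * (k%:~R * trig k (th + pi / 2) s)) =
  - \int[circ]_s (g (pt j t s) * trig k th s).
have bd k (th : R) s : `|k%:~R * trig k (th + pi / 2) s| <= `|k%:~R : R|.
  by rewrite normrM ler_piMr// trig_le1.
have mtk k (th : R) : measurable_fun setT (fun s : R => k%:~R * trig k (th + pi / 2) s).
  by apply: measurable_funM => //; exact: measurable_trig.
have HP k th : {ae circ, forall t, P k th t}.
  have mal i : measurable_fun setT (along i : plane -> R) 
    by rewrite /along; case: (i == 0); [exact: measurable_fst|exact: measurable_snd].
  (* The function of the transversal variable that is to vanish: the
     one-dimensional weak identity for the monomial with data [k] and [th]. *)
  pose h z := f z * (k%:~R * trig k (th + pi / 2) (along j z)) + g z * trig k th (along j z).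
  have hi : summable nu h.
    apply: summableD; under eq_fun do rewrite mulrC.
      apply: (summableMb _ (fun z => bd k th (along j z)) fi).
      exact: (measurableT_comp (mtk k th)).
    apply: (summableMb _ (fun z => trig_le1 k th (along j z)) gi).
    exact: (measurableT_comp (measurable_trig k th)).
  have h0 : trig_orth (fun t => \int[circ]_s h (pt j t s)).
    move=> l et.
    have hti : summable nu (fun z => h z * trig l et (across j z)).
      under eq_fun do rewrite mulrC.
      apply: (summableMb _ (fun z => trig_le1 l et (across j z)) hi).
      apply: (measurableT_comp (measurable_trig l et)).
      by rewrite /across; case: (j == 0); [exact: measurable_snd|exact: measurable_fst].
    transitivity (\int[nu]_z (h z * trig l et (across j z))).
      rewrite (Rint_line j hti); apply: ae_eq_Rint.
      - apply: measurable_funM; last exact: measurable_trig.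
        exact: summable_measurable (summable_Rint_line j hi).
      - exact: summable_measurable (summable_Rint_line j hti).
      apply: filterS (summable_line j hi) => t hti'.
      rewrite mulrC -RintZ//; apply: eq_Rint => s.
      by rewrite mulrC /across /pt; case: (j == 0).
    have sm := smooth_trig2 j 1 k th l et.
    have := fg _ sm (@periodic_trig2 j 1 k th l et).
    have mt c a b d e : measurable_fun setT (trig2 j c a b d e).
      exact: continuous_plane_measurable (@continuous_trig2 _ _ _ _ _ _).
    rewrite partial_trig2 !Rintegral_torusE; [|exact: measurable_funM..].
    move=> E; transitivity (\int[nu]_z (f z * trig2 j (1 * k%:~R) k (th + pi / 2) l et z +
        g z * trig2 j 1 k th l et z)).
      by apply: eq_Rint => z; rewrite /h /trig2; ring.
    rewrite RintD; first by rewrite E addNr.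
      under eq_fun do rewrite mulrC.
      apply: (@summableMb _ _ _ _ _ _ `|k%:~R|) => // z.
      by rewrite /trig2 mul1r !normrM ler_piMr// mulr_ile1// trig_le1.
    under eq_fun do rewrite mulrC.
    apply: (@summableMb _ _ _ _ _ _ 1) => // z.
    by rewrite /trig2 mul1r normrM mulr_ile1// trig_le1.
  apply: filterS2 (trig_orth_eq0 (summable_Rint_line j hi) h0) (filterI (summable_line j fi) (summable_line j gi)).
  move=> t ht [fti gti]; rewrite /P; apply/eqP; rewrite -addr_eq0; apply/eqP.
  rewrite -[RHS]ht -RintD.
  - by apply: eq_Rint => s; rewrite /h /along /pt; case: (j == 0).
  - under eq_fun do rewrite mulrC.
    exact: (summableMb (mtk k th) (bd k th) fti).
  - exact: summable_trig.
apply: filterS3 (ae_all_trig HP) (summable_line j fi) (summable_line j gi).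
move=> t Pt fti gti; apply: weak_ac_circ => // k th.
have [P0 P1] := Pt k.
have fki th' : summable circ (fun s => f (pt j t s) * (k%:~R * trig k (th' + pi / 2) s)).
  under eq_fun do rewrite mulrC.
  exact: (summableMb (mtk k th') (bd k th') fti).
have gki th' : summable circ (fun s => g (pt j t s) * trig k th' s) by exact: summable_trig.
transitivity (\int[circ]_s (cos th * (f (pt j t s) * (k%:~R * trig k (0 + pi / 2) s)) +
    sin th * (f (pt j t s) * (k%:~R * trig k (pi / 2 + pi / 2) s)))).
  apply: eq_Rint => s; rewrite /trig !addrA cosDpihalf.
  rewrite !cosDpihalf addr0 sinDpihalf sinD; ring.
rewrite RintD; [|exact: summableZ|exact: summableZ].
rewrite !RintZ// P0 P1.
rewrite (_ : \int[circ]_x (g (pt j t x) * trig k th x) = \int[circ]_x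
   (cos th * (g (pt j t x) * trig k 0 x) + sin th * (g (pt j t x) * trig k (pi / 2) x))).
  rewrite RintD; [|exact: summableZ|exact: summableZ].
  by rewrite !RintZ//; ring.
by apply: eq_Rint => s; rewrite trig_phase; ring.
Qed.

End Smooth.

(** * The Cauchy-Schwarz inequality and means on intervals *)

Section CauchySchwarz.
Context d (T : measurableType d) (R : realType) (mu : {measure set T -> \bar R}).
Implicit Types (f g : T -> R).
Local Notation sq f := (fun x => f x ^+ 2).

Lemma Rint_ge0 f : (forall x, 0 <= f x) -> 0 <= \int[mu]_x f x.
Proof. by move=> f0; apply: Rintegral_ge0. Qed.

Lemma summable_sqM f g : measurable_fun setT f -> measurable_fun setT g ->
  summable mu (sq f) -> summable mu (sq g) -> summable mu (fun x => f x * g x).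
Proof.
move=> mf mg fi gi; apply: (@summable_le _ _ _ _ _ (fun x => f x ^+ 2 + g x ^+ 2)).
- exact: measurable_funM.
- move=> x; rewrite [leRHS]ger0_norm ?addr_ge0 ?sqr_ge0// normrM.
  rewrite -(real_normK (num_real (f x))) -(real_normK (num_real (g x))).
  have := sqr_ge0 (`|f x| - `|g x|); have := sqr_ge0 (`|f x| + `|g x|); nra.
- exact: summableD.
Qed.

(** From the discriminant of [t |-> \int (t |f| - |g|)^2]. *)
Lemma cauchy_schwarz f g : measurable_fun setT f -> measurable_fun setT g ->
  summable mu (sq f) -> summable mu (sq g) ->
  (\int[mu]_x `|f x * g x|) ^+ 2 <= \int[mu]_x f x ^+ 2 * \int[mu]_x g x ^+ 2.
Proof.
move=> mf mg fi gi; have fgi := integrable_norm (summable_sqM mf mg fi gi).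
set A := \int[mu]_x f x ^+ 2; set C := \int[mu]_x g x ^+ 2.
set B := \int[mu]_x `|f x * g x|.
have A0 : 0 <= A by apply: Rint_ge0 => x; exact: sqr_ge0.
have C0 : 0 <= C by apply: Rint_ge0 => x; exact: sqr_ge0.
have B0 : 0 <= B by apply: Rint_ge0 => x.
have H t : 0 <= t ^+ 2 * A - (2 * t) * B + C.
  rewrite /A /B /C -!RintZ// -RintB; [|exact: summableZ..].
  rewrite -RintD//; last by apply: summableB; exact: summableZ.
  apply: Rint_ge0 => x; rewrite normrM.
  rewrite -(real_normK (num_real (f x))) -(real_normK (num_real (g x))).
  by have := sqr_ge0 (t * `|f x| - `|g x|); nra.
have [A00|An0] := eqVneq A 0.
  have [->|Bn0] := eqVneq B 0; first by rewrite expr0n mulr_ge0.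
  have := H ((C + 1) / (2 * B)); rewrite A00 mulr0 sub0r.
  have -> : 2 * ((C + 1) / (2 * B)) * B = C + 1 by field.
  lra.
have Ap : 0 < A by rewrite lt_neqAle eq_sym An0.
have := H (B / A).
have -> : (B / A) ^+ 2 * A - 2 * (B / A) * B + C = (A * C - B ^+ 2) / A by field.
by rewrite pmulr_lge0 ?invr_gt0// subr_ge0.
Qed.

End CauchySchwarz.

Section Average.
Context {R : realType}.
Local Notation circ := (@circ R).
Local Notation nu := (circ \x circ)%E.
Local Notation plane := (R * R)%type.
Implicit Types (a l x : R) (f g : R -> R).

Definition chi a l x : R := (a <= x < a + l)%R%:R.

Lemma chi_ge0 a l x : 0 <= chi a l x. Proof. by rewrite /chi. Qed.

Lemma chi_le1 a l x : `|chi a l x| <= 1. Proof. exact: normr_bool. Qed.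

Lemma chi_id a l x : chi a l x * chi a l x = chi a l x.
Proof. by rewrite /chi; case: (_ && _); rewrite ?mulr1 ?mulr0. Qed.

Lemma measurable_chi a l : measurable_fun setT (chi a l).
Proof.
apply: measurable_bool2R; apply: measurable_and; first exact: measurable_fun_ler.
exact: measurable_fun_ltr.
Qed.

Lemma summable_chiM a l f : summable circ f -> summable circ (fun x => chi a l x * f x).
Proof. exact: (summableMb (measurable_chi a l) (chi_le1 a l)). Qed.

Lemma summable_chi a l : summable circ (chi a l).
Proof. exact: (summable_bounded (measurable_chi a l) (chi_le1 a l)). Qed.

Lemma Rint_chi a l : 0 < l -> 0 <= a -> a + l <= 2 * pi -> \int[circ]_x chi a l x = l.
Proof.
move=> l0 a0 al.
have E : (\int[circ]_x (chi a l x)%:E = l%:E)%E; last by rewrite /Rintegral E.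
rewrite (eq_integral (fun x => (\1_(`[a, a + l[%classic) x)%:E)); last first.
  by move=> x _; rewrite /chi indicE mem_setE in_itv.
rewrite integral_indic//= setIT circE_arc; last first.
  move=> x; rewrite /arc /= !in_itv/= => /andP[ax xal].
  by rewrite (le_trans a0 ax) (lt_le_trans xal al).
rewrite lebesgue_measure_itv/= lte_fin ltrDl l0 -EFinB.
by rewrite addrAC subrr add0r.
Qed.

(** Average the bound of [ac_circ_osc] over one of the two points. *)
Lemma ac_circ_avg f f' a l : 0 < l -> 0 <= a -> a + l <= 2 * pi -> ac_circ f f' ->
  {ae circ, forall x, chi a l x * `|f x - l^-1 * \int[circ]_y (chi a l y * f y)|
     <= \int[circ]_t (chi a l t * `|f' t|)}.
Proof.
move=> l0 a0 al ff'; have [F fF Fosc] := ac_circ_osc a (a + l) ff'.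
have [mf f'i _ _] := ff'; have [C fC] := ac_circ_bounded ff'.
have fi : summable circ f.
  apply: (@summable_ae_le _ _ _ _ _ (fun=> C)) => //; last exact: summable_cst circ_lty.
  by apply: filterS fC => x fx; rewrite (le_trans fx)// ler_norm.
have nf'i : summable circ (fun t => chi a l t * `|f' t|).
  by apply: summable_chiM; exact: integrable_norm.
set A := \int[circ]_t (chi a l t * `|f' t|).
have A0 : 0 <= A by apply: Rint_ge0 => t; rewrite mulr_ge0 ?chi_ge0.
have fF' := fF; apply: filterS fF => x fxF; rewrite {1}/chi.
case: (boolP (a <= x < a + l)) => xal; last by rewrite mul0r.
rewrite mul1r -/(chi a l) fxF.
have -> : F x - l^-1 * \int[circ]_y (chi a l y * f y) =
    l^-1 * \int[circ]_y (F x * chi a l y - chi a l y * f y).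
  rewrite RintB; [|exact: (summableZ _ (summable_chi a l))|exact: summable_chiM].
  rewrite RintZ; last exact: summable_chi.
  by rewrite Rint_chi// mulrBr mulrCA mulVf ?mulr1 ?gt_eqF.
rewrite normrM ger0_norm ?invr_ge0 ?(ltW l0)//.
rewrite ler_pdivrMl//.
have -> : l * A = \int[circ]_x (A * chi a l x).
  by rewrite RintZ ?Rint_chi ?[A * l]mulrC//; exact: summable_chi.
apply: norm_Rint_le.
- by apply: summableB; [exact: (summableZ _ (summable_chi a l))|exact: summable_chiM].
- exact: (summableZ _ (summable_chi a l)).
- apply: filterS fF' => y fyF.
  rewrite mulrC -mulrBr normrM (ger0_norm (chi_ge0 a l y)) mulrC.
  rewrite {1 2}/chi; case: (boolP (a <= y < a + l)) => yal; last by rewrite !mulr0.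
  by rewrite !mulr1 fyF Fosc.
Qed.

End Average.

(** * Means on squares *)

Section Squares.
Context {R : realType}.
Local Notation circ := (@circ R).
Local Notation nu := (circ \x circ)%E.
Local Notation plane := (R * R)%type.
Implicit Types (f h : plane -> R) (j : 'I_2).

(** Apply [ae_line_eq] to the maximum of the two functions. *)
Lemma ae_line_le f h j : measurable_fun setT f -> measurable_fun setT h ->
  {ae circ, forall t, {ae circ, forall s, f (pt j t s) <= h (pt j t s)}} ->
  {ae nu, forall z, f z <= h z}.
Proof.
move=> mf mh fh.
have : {ae nu, forall z, Num.max (f z) (h z) = h z}.
  apply: (@ae_line_eq _ _ _ j) => //; first exact: measurable_maxr.
  by apply: filterS fh => t; apply: filterS => s /max_idPr.
by apply: filterS => z /max_idPr.
Qed.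

Lemma nu_lty : (nu setT < +oo)%E.
Proof.
have -> : [set: plane] = setT `*` setT by rewrite setXTT.
rewrite product_measure1E//; apply: lte_mul_pinfty; [exact: measure_ge0| |exact: circ_lty].
by rewrite ge0_fin_numE; [exact: circ_lty|exact: measure_ge0].
Qed.

Lemma nu_sq_summable f : measurable_fun setT f -> summable nu (fun z => f z ^+ 2) -> summable nu f.
Proof.
move=> mf fi; apply: (@summable_le _ _ _ _ _ (fun z => 1 + f z ^+ 2)) => //.
  move=> z; rewrite [leRHS]ger0_norm ?addr_ge0 ?sqr_ge0//.
  rewrite -(real_normK (num_real (f z))).
  by have := sqr_ge0 (`|f z| - 1); have := normr_ge0 (f z); nra.
by apply: summableD => //; apply: summable_cst; exact: nu_lty.
Qed.

Lemma Rint_prod (a b : R -> R) : summable circ a -> summable circ b ->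
  \int[nu]_z (a z.1 * b z.2) = \int[circ]_x a x * \int[circ]_y b y.
Proof.
move=> ai bi; rewrite (Rint_Fubini1 (summable_prod ai bi)) mulrC -RintZ//.
by apply: eq_Rint => x; rewrite /= RintZ// mulrC.
Qed.

Definition oth j : 'I_2 := if j == 0 then 1 else 0.

Lemma othK j : oth (oth j) = j.
Proof. by apply/val_inj; case: j => -[|[|]]. Qed.

Lemma across_oth j (z : plane) : across (oth j) z = along j z.
Proof. by rewrite /across /along /oth; case: (j == 0). Qed.

Lemma along_oth j (z : plane) : along (oth j) z = across j z.
Proof. by rewrite /across /along /oth; case: (j == 0). Qed.

Lemma along_pt j (t s : R) : along j (pt j t s) = s.
Proof. by rewrite /along /pt; case: (j == 0). Qed.

Lemma across_pt j (t s : R) : across j (pt j t s) = t.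
Proof. by rewrite /across /pt; case: (j == 0). Qed.

Lemma measurable_along j : measurable_fun setT (along j : plane -> R).
Proof. by rewrite /along; case: (j == 0); [exact: measurable_fst|exact: measurable_snd]. Qed.

Lemma measurable_across j : measurable_fun setT (across j : plane -> R).
Proof. by rewrite /across; case: (j == 0); [exact: measurable_snd|exact: measurable_fst]. Qed.

(** The indicator of the square with lower left corner [c] and side [l]. *)
Definition chiQ (c : plane) (l : R) (z : plane) : R := chi c.1 l z.1 * chi c.2 l z.2.

Lemma chiQ_pt c l j t s :
  chiQ c l (pt j t s) = chi (along j c) l s * chi (across j c) l t.
Proof. by rewrite /chiQ /pt /along /across; case: (j == 0) => //=; rewrite mulrC. Qed.

Lemma chiQ_ge0 c l z : 0 <= chiQ c l z.
Proof. by rewrite mulr_ge0 ?chi_ge0. Qed.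

Lemma chiQ_le1 c l z : `|chiQ c l z| <= 1.
Proof. by rewrite normrM mulr_ile1// chi_le1. Qed.

Lemma chiQ_id c l z : chiQ c l z * chiQ c l z = chiQ c l z.
Proof. by rewrite /chiQ mulrACA !chi_id. Qed.

Lemma measurable_chiQ c l : measurable_fun setT (chiQ c l).
Proof.
apply: measurable_funM.
  exact: (measurableT_comp (measurable_chi _ _) measurable_fst).
exact: (measurableT_comp (measurable_chi _ _) measurable_snd).
Qed.

Lemma summable_chiQM c l f : summable nu f -> summable nu (fun z => chiQ c l z * f z).
Proof. exact: (summableMb (measurable_chiQ c l) (chiQ_le1 c l)). Qed.

Lemma summable_chiQ c l : summable nu (chiQ c l).
Proof.
have := summable_chiQM c l (summable_cst 1 nu_lty).
by under eq_fun do rewrite mulr1.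
Qed.

Definition inside (c : plane) (l : R) := [/\ 0 < l, 0 <= c.1, c.1 + l <= 2 * pi,
  0 <= c.2 & c.2 + l <= 2 * pi].

Lemma inside_along c l j : inside c l -> [/\ 0 < l, 0 <= along j c & along j c + l <= 2 * pi].
Proof. by move=> [? ? ? ? ?]; rewrite /along; case: (j == 0). Qed.

Lemma Rint_chiQ c l : inside c l -> \int[nu]_z chiQ c l z = l ^+ 2.
Proof.
move=> [l0 c1 c1l c2 c2l].
by rewrite /chiQ (Rint_prod (summable_chi _ _) (summable_chi _ _)) !Rint_chi.
Qed.

Definition avgQ c l f := (l ^+ 2)^-1 * \int[nu]_z (chiQ c l z * f z).

Section OneSquare.
Variables (c : plane) (l : R) (f : plane -> R) (g : 'I_2 -> plane -> R).
Hypotheses (cl : inside c l) (fi : summable nu f)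
  (gi : forall j, summable nu (fun z => g j z ^+ 2)) (fg : forall j, ac_line j f (g j)).

Let mf : measurable_fun setT f. Proof. exact: summable_measurable fi. Qed.
Let mg j : measurable_fun setT (g j). Proof. by have [] := fg j. Qed.
Let gj j : summable nu (g j). Proof. exact: nu_sq_summable (mg j) (gi j). Qed.
Let ngj j : summable nu (fun z => `|g j z|). Proof. exact: integrable_norm. Qed.
Let l0 : 0 < l. Proof. by case: cl. Qed.
Let cj j := along j c.
Let ch j := chi (cj j) l.

Let chiM j (F : plane -> R) : summable nu F -> summable nu (fun z => ch j (along j z) * F z).
Proof.
apply: (@summableMb _ _ _ _ _ _ 1) => [|z]; last exact: chi_le1.
exact: (measurableT_comp (measurable_chi _ _) (measurable_along j)).
Qed.

Let am j t := l^-1 * \int[circ]_s (ch j s * f (pt j t s)).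
Let A j t := \int[circ]_s (ch j s * `|g j (pt j t s)|).
Let D j := l^-1 * \int[nu]_z (chiQ c l z * `|g j z|).
Let delta j := \int[nu]_z (chiQ c l z * g j z ^+ 2).
Let alpha j t := \int[circ]_s (ch j s * g j (pt j t s) ^+ 2).

Let summable_line_chi j (F : plane -> R) : summable nu F ->
  summable circ (fun t => \int[circ]_s (ch j s * F (pt j t s))).
Proof.
move=> Fi; have := summable_Rint_line j (chiM j Fi).
by under eq_fun do under eq_Rint do rewrite along_pt.
Qed.

Let Rint_line_chi j (F : plane -> R) : summable nu F ->
  \int[circ]_t (ch (oth j) t * \int[circ]_s (ch j s * F (pt j t s))) =
  \int[nu]_z (chiQ c l z * F z).
Proof.
move=> Fi; rewrite (Rint_line j (summable_chiQM c l Fi)).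
have Li := summable_line j (chiM j Fi).
apply: ae_eq_Rint.
- apply: measurable_funM; first exact: measurable_chi.
  exact: summable_measurable (summable_line_chi j Fi).
- exact: summable_measurable (summable_Rint_line j (summable_chiQM c l Fi)).
apply: filterS Li => t; under eq_fun do rewrite along_pt.
move=> Lt; rewrite -RintZ//; apply: eq_Rint => s.
by rewrite chiQ_pt /ch /cj along_oth; ring.
Qed.

Let am_summable j : summable circ (am j).
Proof. exact: summableZ (summable_line_chi j fi). Qed.

Let A_summable j : summable circ (A j).
Proof. exact: (summable_line_chi j (ngj j)). Qed.

Let A_ge0 j t : 0 <= A j t.
Proof. by apply: Rint_ge0 => s; rewrite mulr_ge0 ?chi_ge0. Qed.

Let line_osc j : {ae circ, forall t, {ae circ, forall s,
  ch j s * `|f (pt j t s) - am j t| <= A j t}}.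
Proof.
have [_ _ fgj] := fg j; have [_ cj0 cjl] := inside_along j cl.
by apply: filterS fgj => t /(ac_circ_avg l0 cj0 cjl).
Qed.

Let line_osc_nu j : {ae nu, forall z,
  ch j (along j z) * `|f z - am j (across j z)| <= A j (across j z)}.
Proof.
apply: (@ae_line_le _ _ j).
- apply: measurable_funM.
    exact: (measurableT_comp (measurable_chi _ _) (measurable_along j)).
  apply: measurableT_comp => //; apply: measurable_funB => //.
  exact: (measurableT_comp (summable_measurable (am_summable j)) (measurable_across j)).
- exact: (measurableT_comp (summable_measurable (A_summable j)) (measurable_across j)).
by apply: filterS (line_osc j) => t; apply: filterS => s; rewrite along_pt across_pt.
Qed.

Let avgQE j : avgQ c l f = l^-1 * \int[circ]_s (ch j s * am (oth j) s).
Proof.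
rewrite /avgQ -(Rint_line_chi (oth j) fi) othK expr2 invfM -mulrA; congr (_ * _).
rewrite -RintZ; last exact: summable_chiM (summable_line_chi _ fi).
by apply: eq_Rint => s; rewrite mulrCA.
Qed.

Let avg_osc j : {ae circ, forall t, ch (oth j) t * `|am j t - avgQ c l f| <= D (oth j)}.
Proof.
have DE : D (oth j) = l^-1 * \int[circ]_s (ch j s * A (oth j) s).
  by rewrite /D -(Rint_line_chi (oth j) (ngj (oth j))) othK.
have H := ae_line j (line_osc_nu (oth j)).
apply: filterS2 (summable_line j fi) H => t fti Ht.
rewrite (avgQE j) {1}/am -mulrBr normrM (ger0_norm (ltW _)) ?invr_gt0// mulrCA DE.
rewrite ler_pM2l ?invr_gt0// -RintB; last 2 first.
- exact: (summable_chiM _ _ fti).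
- exact: (summable_chiM _ _ (am_summable (oth j))).
have di : summable circ (fun s => ch j s * f (pt j t s) - ch j s * am (oth j) s).
  by apply: summableB; [exact: (summable_chiM _ _ fti)|exact: (summable_chiM _ _ (am_summable (oth j)))].
rewrite -[X in X * _](ger0_norm (chi_ge0 _ _ _)) -normrM -RintZ//.
apply: norm_Rint_le; [exact: summableZ|exact: (summable_chiM _ _ (A_summable (oth j)))|].
apply: filterS Ht => s; rewrite along_oth across_oth along_pt across_pt => Hs.
rewrite -mulrBr mulrCA !normrM (ger0_norm (chi_ge0 _ _ _)).
by rewrite (ger0_norm (chi_ge0 _ _ _)) ler_wpM2l// chi_ge0.
Qed.

(** [f] is within [A j + D] of its mean, where [A j] does not depend on the
    [j]-th coordinate: compare [f] with its mean on the line, then the latter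
    with the mean on the square by means of the lines in the other direction.
    *)
Let osc j : {ae nu, forall z, chiQ c l z * `|f z - avgQ c l f| <=
  chiQ c l z * (A j (across j z) + D (oth j))}.
Proof.
apply: (@ae_line_le _ _ j).
- apply: measurable_funM; first exact: measurable_chiQ.
  by apply: measurableT_comp => //; apply: measurable_funB.
- apply: measurable_funM; first exact: measurable_chiQ.
  apply: measurable_funD => //.
  exact: (measurableT_comp (summable_measurable (A_summable j)) (measurable_across j)).
apply: filterS2 (line_osc j) (avg_osc j) => t Ht at_; apply: filterS Ht => s Hs.
rewrite chiQ_pt across_pt -/(cj j) -/(ch j).
have -> : chi (across j c) l t = ch (oth j) t by rewrite /ch /cj along_oth.
move: Hs at_; rewrite /ch /chi.
case: (_ && _); last by rewrite !mul0r.
case: (_ && _); last by rewrite !(mul0r, mulr0).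
rewrite !mul1r => Hs at_.
by rewrite (le_trans (ler_distD (am j t) _ _))// lerD.
Qed.

Let summable_chiQ_across j (a : R -> R) : summable circ a ->
  summable nu (fun z => chiQ c l z * a (across j z)).
Proof.
move=> ai; apply: summable_chiQM.
rewrite /across; case: (j == 0).
  have := summable_prod (summable_cst 1 circ_lty) ai.
  by under eq_fun do rewrite mul1r.
have := summable_prod ai (summable_cst 1 circ_lty).
by under eq_fun do rewrite mulr1.
Qed.

Let Rint_chiQ_across j (a : R -> R) : summable circ a ->
  \int[nu]_z (chiQ c l z * a (across j z)) = l * \int[circ]_t (ch (oth j) t * a t).
Proof.
move=> ai; have [_ cj0 cjl] := inside_along j cl.
rewrite (Rint_line j (summable_chiQ_across j ai)) -RintZ; last exact: (summable_chiM _ _ ai).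
apply: eq_Rint => t.
transitivity (\int[circ]_s ((ch (oth j) t * a t) * ch j s)).
  by apply: eq_Rint => s; rewrite chiQ_pt across_pt /ch /cj along_oth; ring.
by rewrite RintZ; [rewrite (Rint_chi l0 cj0 cjl) mulrC|exact: summable_chi].
Qed.

(** Integrate [osc] for one direction. *)
Lemma square_L1 : \int[nu]_z (chiQ c l z * `|f z - avgQ c l f|) <=
  l * \int[nu]_z (chiQ c l z * (`|g 0 z| + `|g 1 z|)).
Proof.
pose j : 'I_2 := 0.
have AQ : summable nu (fun z => chiQ c l z * A j (across j z)) by exact: summable_chiQ_across.
have Qi := summable_chiQ c l.
have DQ : summable nu (fun z => D (oth j) * chiQ c l z) by exact: summableZ.
apply: (@le_trans _ _ (\int[nu]_z (chiQ c l z * A j (across j z) + D (oth j) * chiQ c l z))).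
  apply: ae_le_Rint.
  - apply: summable_chiQM; apply: integrable_norm.
    by apply: summableB => //; apply: summable_cst; exact: nu_lty.
  - exact: summableD.
  by apply: filterS (osc j) => z; rewrite mulrDr [chiQ c l z * D _]mulrC.
rewrite RintD// RintZ// Rint_chiQ// Rint_chiQ_across// (Rint_line_chi j (ngj j)).
have -> : \int[nu]_z (chiQ c l z * (`|g 0 z| + `|g 1 z|)) =
    \int[nu]_z (chiQ c l z * `|g 0 z|) + \int[nu]_z (chiQ c l z * `|g 1 z|).
  rewrite -RintD; [|exact: summable_chiQM|exact: summable_chiQM].
  by apply: eq_Rint => z; rewrite mulrDr.
rewrite mulrDr lerD2l /D (_ : oth j = 1)// expr2 mulrAC mulrA mulVf ?gt_eqF// mul1r mulrC.
by [].
Qed.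

Let alpha_summable j : summable circ (alpha j).
Proof. exact: (summable_line_chi j (gi j)). Qed.

Let A_sq j : {ae circ, forall t, A j t ^+ 2 <= l * alpha j t}.
Proof.
have [_ cj0 cjl] := inside_along j cl.
apply: filterS (summable_line j (gi j)) => t g2i.
have mgl := measurable_line j t (mg j).
have mch := measurable_chi (cj j) l.
have E : (fun x => ch j x ^+ 2) = ch j by apply/funext => x; rewrite expr2 /ch chi_id.
have E2 : (fun x => (ch j x * g j (pt j t x)) ^+ 2) = (fun s => ch j s * g j (pt j t s) ^+ 2).
  by apply/funext => s; rewrite exprMn -[in RHS]E.
have := @cauchy_schwarz _ _ _ circ (ch j) (fun s => ch j s * g j (pt j t s)) mch (measurable_funM mch mgl).
rewrite E E2 => /(_ (summable_chi _ _) (summable_chiM _ _ g2i)).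
rewrite (Rint_chi l0 cj0 cjl).
congr (_ <= _); congr (_ ^+ 2); apply: eq_Rint => s.
by rewrite mulrA /ch chi_id normrM ger0_norm ?chi_ge0.
Qed.

Let D_sq j : D j ^+ 2 <= delta j.
Proof.
have E : (fun x => chiQ c l x ^+ 2) = chiQ c l by apply/funext => x; rewrite expr2 chiQ_id.
have E2 : (fun x => (chiQ c l x * g j x) ^+ 2) = (fun s => chiQ c l s * g j s ^+ 2).
  by apply/funext => s; rewrite exprMn -[in RHS]E.
have mch := measurable_chiQ c l.
have Qi := summable_chiQ c l.
have := @cauchy_schwarz _ _ _ nu (chiQ c l) (fun s => chiQ c l s * g j s) mch (measurable_funM mch (mg j)).
rewrite E E2 => /(_ Qi (summable_chiQM _ _ (gi j))).
rewrite (Rint_chiQ cl).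
have -> : \int[nu]_x `|chiQ c l x * (chiQ c l x * g j x)| = \int[nu]_x (chiQ c l x * `|g j x|).
  by apply: eq_Rint => s; rewrite mulrA chiQ_id normrM ger0_norm ?chiQ_ge0.
by rewrite -/(delta j) /D exprMn exprVn ler_pdivrMl// exprn_gt0.
Qed.

Let p j t := 2 * (l * alpha j t + delta (oth j)).

Let p_summable j : summable circ (p j).
Proof.
apply: summableZ; apply: summableD; first exact: summableZ.
by apply: summable_cst; exact: circ_lty.
Qed.

Let osc_sq j : {ae nu, forall z, chiQ c l z * (f z - avgQ c l f) ^+ 2 <=
  chiQ c l z * p j (across j z)}.
Proof.
have H : {ae nu, forall z, A j (across j z) ^+ 2 <= l * alpha j (across j z)}.
  apply: (@ae_line_le _ _ j).
  - apply: (@measurable_funX _ _ _ _ (fun z => A j (across j z))).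
    exact: (measurableT_comp (summable_measurable (A_summable j)) (measurable_across j)).
  - apply: measurable_funM => //.
    exact: (measurableT_comp (summable_measurable (alpha_summable j)) (measurable_across j)).
  by apply: filterS (A_sq j) => t At; apply: aeW => s; rewrite across_pt.
apply: filterS2 (osc j) H => z; rewrite /chiQ /chi -!natrM mulnb.
case: (_ && _); last by rewrite !mul0r.
rewrite !mul1r /p => Hz Az.
have Dd := D_sq (oth j).
rewrite -(real_normK (num_real (f z - _))).
have A0 := A_ge0 j (across j z).
have D0 : 0 <= D (oth j).
  rewrite /D mulr_ge0 ?invr_ge0 ?(ltW l0)//.
  by apply: Rint_ge0 => y; rewrite mulr_ge0 ?chiQ_ge0.
have n0 := normr_ge0 (f z - avgQ c l f).
have := sqr_ge0 (A j (across j z) - D (oth j)).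
nra.
Qed.

Let Rint_p j : \int[circ]_t (ch (oth j) t * p j t) = 2 * l * (delta j + delta (oth j)).
Proof.
have [_ cj0 cjl] := inside_along (oth j) cl.
transitivity (\int[circ]_t (2 * l * (ch (oth j) t * alpha j t) + 2 * delta (oth j) * ch (oth j) t)).
  by apply: eq_Rint => t; rewrite /p; ring.
rewrite RintD; last 2 first.
- exact: (summableZ _ (summable_chiM _ _ (alpha_summable j))).
- exact: (summableZ _ (summable_chi _ _)).
rewrite !RintZ; [|exact: (summable_chi _ _)|exact: (summable_chiM _ _ (alpha_summable j))].
rewrite (Rint_line_chi j (gi j)) -/(delta j) (Rint_chi l0 cj0 cjl); ring.
Qed.

(** The local Sobolev inequality: on a line in direction [j] the function
    [p j] is constant, so the product of the two pointwise bounds integrates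
    to the product of two one-dimensional integrals. *)
Lemma square_L4 :
  summable nu (fun z => chiQ c l z * (f z - avgQ c l f) ^+ 4) /\
  \int[nu]_z (chiQ c l z * (f z - avgQ c l f) ^+ 4) <=
    4 * l ^+ 2 * (\int[nu]_z (chiQ c l z * (g 0 z ^+ 2 + g 1 z ^+ 2))) ^+ 2.
Proof.
(* One factor comes from each direction, and it depends on the other
   coordinate only. *)
pose P z := (ch 0 z.1 * p 1 z.1) * (ch 1 z.2 * p 0 z.2).
have i1 : summable circ (fun x => ch 0 x * p 1 x) by exact: (summable_chiM _ _ (p_summable 1)).
have i2 : summable circ (fun x => ch 1 x * p 0 x) by exact: (summable_chiM _ _ (p_summable 0)).
have Pi : summable nu P by exact: (summable_prod i1 i2).
have H : {ae nu, forall z, `|chiQ c l z * (f z - avgQ c l f) ^+ 4| <= P z}.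
  apply: filterS2 (osc_sq 0) (osc_sq 1) => z h0 h1.
  rewrite ger0_norm; last first.
    by apply: mulr_ge0; [exact: chiQ_ge0|rewrite (exprM _ 2 2) sqr_ge0].
  have -> : P z = (chiQ c l z * p 0 (across 0 z)) * (chiQ c l z * p 1 (across 1 z)).
    rewrite mulrACA chiQ_id /P /chiQ /ch /cj /along /across /=; ring.
  have -> : chiQ c l z * (f z - avgQ c l f) ^+ 4 =
    (chiQ c l z * (f z - avgQ c l f) ^+ 2) * (chiQ c l z * (f z - avgQ c l f) ^+ 2).
    by rewrite -[in LHS](chiQ_id c l z); ring.
  by apply: ler_pM => //; rewrite mulr_ge0 ?chiQ_ge0 ?sqr_ge0.
have mh : measurable_fun setT (fun z => chiQ c l z * (f z - avgQ c l f) ^+ 4).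
  apply: measurable_funM; first exact: measurable_chiQ.
  by apply: measurable_funX; apply: measurable_funB.
have hi : summable nu (fun z => chiQ c l z * (f z - avgQ c l f) ^+ 4).
  have H' : {ae nu, forall z, `|chiQ c l z * (f z - avgQ c l f) ^+ 4| <= `|P z|}.
    by apply: filterS (H) => z /le_trans; apply; exact: ler_norm.
  exact: (summable_ae_le mh H' Pi).
split=> //.
apply: (@le_trans _ _ (\int[nu]_z P z)).
  by apply: ae_le_Rint => //; apply: filterS H => z; apply: le_trans; exact: ler_norm.
rewrite /P (Rint_prod i1 i2).
have := Rint_p 0; have := Rint_p 1; rewrite (_ : oth 0 = 1)// (_ : oth 1 = 0)// => -> ->.
have -> : \int[nu]_z (chiQ c l z * (g 0 z ^+ 2 + g 1 z ^+ 2)) = delta 0 + delta 1.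
  rewrite -RintD; [|exact: (summable_chiQM _ _ (gi 0))|exact: (summable_chiQM _ _ (gi 1))].
  by apply: eq_Rint => z; rewrite mulrDr.
apply: eq_lexx; ring.
Qed.

End OneSquare.
End Squares.

(** * Dyadic squares *)

Section Dyadic.
Context {R : realType}.
Local Notation circ := (@circ R).
Local Notation nu := (circ \x circ)%E.
Local Notation plane := (R * R)%type.

Lemma chi_halves (a l x : R) : 0 < l ->
  chi a l x = chi a (l / 2) x + chi (a + l / 2) (l / 2) x.
Proof.
move=> l0; rewrite /chi -addrA -splitr.
have h0 : 0 < l / 2 by rewrite divr_gt0.
case: (leP a x) => ax /=; last first.
  by rewrite (_ : (a + l / 2 <= x) = false) ?addr0//; apply/negbTE; rewrite -ltNge ltr_wpDr// ltW.
case: (ltP x (a + l / 2)) => xh /=; last by rewrite add0r.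
by rewrite addr0 (lt_le_trans xh)// lerD2l ler_pdivrMr// ler_pMr// ler1n.
Qed.

Definition quarter (c : plane) (l : R) (b1 b2 : bool) : plane :=
  (c.1 + b1%:R * (l / 2), c.2 + b2%:R * (l / 2)).

Lemma chiQ_quarters c l z : 0 < l -> chiQ c l z =
  chiQ (quarter c l false false) (l / 2) z + chiQ (quarter c l false true) (l / 2) z +
  (chiQ (quarter c l true false) (l / 2) z + chiQ (quarter c l true true) (l / 2) z).
Proof.
by move=> l0; rewrite /chiQ /quarter /= !mul0r !mul1r !addr0 !(chi_halves _ _ l0); ring.
Qed.

Lemma chiQ_quarter c l b1 b2 z : 0 < l ->
  chiQ (quarter c l b1 b2) (l / 2) z * chiQ c l z = chiQ (quarter c l b1 b2) (l / 2) z.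
Proof.
have H a b x : 0 < l -> chi (a + (b : bool)%:R * (l / 2)) (l / 2) x * chi a l x =
    chi (a + b%:R * (l / 2)) (l / 2) x.
  move=> l0; rewrite /chi -natrM mulnb; congr (_%:R); congr (nat_of_bool _).
  have h0 : 0 < l / 2 by rewrite divr_gt0.
  case: (boolP (_ <= x < _)) => //= /andP[h1 h2].
  case: b h1 h2; rewrite ?mul1r ?mul0r ?addr0 -?addrA -?splitr => h1 h2.
    by rewrite h2 andbT (le_trans _ h1)// lerDl ltW.
  by rewrite h1 /= (lt_trans h2)// ltrD2l ltr_pdivrMr// ltr_pMr// ltr1n.
by move=> l0; rewrite /chiQ mulrACA !H.
Qed.

Lemma inside_quarter c l b1 b2 : inside c l -> inside (quarter c l b1 b2) (l / 2).
Proof.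
move=> [l0 c1 c1l c2 c2l]; rewrite /quarter.
have h0 : 0 < l / 2 by rewrite divr_gt0.
split=> //=; case: b1; case: b2; rewrite ?mul1r ?mul0r; lra.
Qed.

Let pi20 : 0 < 2 * pi :> R. Proof. by rewrite mulr_gt0// pi_gt0. Qed.

Lemma ae_whole : {ae nu, forall z, chiQ (0, 0) (2 * pi) z = 1}.
Proof.
apply: (@ae_line_eq _ (chiQ (0, 0) (2 * pi)) (fun=> 1) 0) => //; first exact: measurable_chiQ.
apply: filterS ae_circ_arc => t at_; apply: filterS ae_circ_arc => s as_.
by move: at_ as_; rewrite chiQ_pt /chi /arc /along /across /= !in_itv/= !add0r => -> ->; rewrite mulr1.
Qed.

Lemma whole : inside (0, 0) (2 * pi :> R).
Proof. by split => //=; rewrite add0r. Qed.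

Lemma Rint_whole (F : plane -> R) : measurable_fun setT F ->
  \int[nu]_z (chiQ (0, 0) (2 * pi) z * F z) = \int[nu]_z F z.
Proof.
move=> mF; apply: ae_eq_Rint => //.
  by apply: measurable_funM => //; exact: measurable_chiQ.
by apply: filterS ae_whole => z ->; rewrite mul1r.
Qed.

Lemma summable_whole (F : plane -> R) : measurable_fun setT F ->
  summable nu (fun z => chiQ (0, 0) (2 * pi) z * F z) -> summable nu F.
Proof.
move=> mF; apply: ae_summable => //.
by apply: filterS ae_whole => z ->; rewrite mul1r.
Qed.

Section Log.
Variables (f r : plane -> R) (g : 'I_2 -> plane -> R).
Hypotheses (fi : summable nu f) (f4 : summable nu (fun z => f z ^+ 4))
  (gi : forall j, summable nu (fun z => g j z ^+ 2)) (fg : forall j, ac_line j f (g j))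
  (mr : measurable_fun setT r) (r4 : summable nu (fun z => r z ^+ 4)).

Let mf : measurable_fun setT f. Proof. exact: summable_measurable fi. Qed.
Let mg j : measurable_fun setT (g j). Proof. by have [] := fg j. Qed.
Let gam z := `|g 0 z| + `|g 1 z|.
Let G := \int[nu]_z (gam z ^+ 2).
Let rho := Num.sqrt (\int[nu]_z (r z ^+ 4)).
Let E2 z := g 0 z ^+ 2 + g 1 z ^+ 2.

Let sq4 (h : plane -> R) : (fun z => (h z ^+ 2) ^+ 2) = (fun z => h z ^+ 4).
Proof. by apply/funext => z; rewrite -exprM. Qed.

Let r2 : summable nu (fun z => r z ^+ 2).
Proof. by apply: nu_sq_summable; [exact: measurable_funX|rewrite sq4]. Qed.

Let rf2 : summable nu (fun z => r z ^+ 2 * f z ^+ 2).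
Proof.
apply: (@summable_sqM _ _ _ nu (fun z => r z ^+ 2) (fun z => f z ^+ 2)); rewrite ?sq4//.
all: exact: measurable_funX.
Qed.

Let mgam : measurable_fun setT gam.
Proof. by apply: measurable_funD; apply: measurableT_comp. Qed.

Let E2i : summable nu E2. Proof. exact: summableD. Qed.

Let gam2 : summable nu (fun z => gam z ^+ 2).
Proof.
apply: (@summable_le _ _ _ _ _ (fun z => 2 * E2 z)); last exact: summableZ.
  exact: measurable_funX.
move=> z; rewrite ger0_norm ?sqr_ge0// ger0_norm ?mulr_ge0 ?addr_ge0 ?sqr_ge0//.
rewrite /gam /E2 -(real_normK (num_real (g 0 z))) -(real_normK (num_real (g 1 z))).
by have := sqr_ge0 (`|g 0 z| - `|g 1 z|); nra.
Qed.

Let gami : summable nu gam. Proof. exact: nu_sq_summable. Qed.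

(** On a single square bound [f^2] by [2 a^2 + 2 (f - mean)^2]; the second
    part is paired with [r^2] by Cauchy-Schwarz and [square_L4], which yields
    the factor [l]. *)
Let leaf_bound a l c : inside c l ->
  `|avgQ c l f| <= a ->
  \int[nu]_z (chiQ c l z * (r z ^+ 2 * f z ^+ 2)) <=
  \int[nu]_z (chiQ c l z * (2 * a ^+ 2 * r z ^+ 2 + 4 * l * rho * E2 z)).
Proof.
move=> cl fa; have [q4 qle] := square_L4 cl fi gi fg; have l0 : 0 < l by case: cl.
set m := avgQ c l f in fa q4 qle *.
pose h z := chiQ c l z * (f z - m) ^+ 2.
have mh : measurable_fun setT h.
  apply: measurable_funM; first exact: measurable_chiQ.
  by apply: measurable_funX; apply: measurable_funB.
have h2 : (fun z => h z ^+ 2) = (fun z => chiQ c l z * (f z - m) ^+ 4).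
  by apply/funext => z; rewrite /h -[in RHS](chiQ_id c l z); ring.
have h2i : summable nu (fun z => h z ^+ 2) by rewrite h2.
have mr2 : measurable_fun setT (fun z => r z ^+ 2) by exact: measurable_funX.
have r22 : summable nu (fun z => (r z ^+ 2) ^+ 2) by rewrite sq4.
have rhi := summable_sqM mr2 mh r22 h2i.
have CS : \int[nu]_z (r z ^+ 2 * h z) <= rho * (2 * l * \int[nu]_z (chiQ c l z * E2 z)).
  have E0 : 0 <= \int[nu]_z (chiQ c l z * E2 z).
    by apply: Rint_ge0 => z; rewrite mulr_ge0 ?chiQ_ge0// addr_ge0 ?sqr_ge0.
  have R0 : 0 <= rho * (2 * l * \int[nu]_z (chiQ c l z * E2 z)).
    by rewrite mulr_ge0 ?sqrtr_ge0// !mulr_ge0 ?(ltW l0).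
  have := cauchy_schwarz mr2 mh r22 h2i; rewrite sq4 h2.
  have -> : \int[nu]_z `|r z ^+ 2 * h z| = \int[nu]_z (r z ^+ 2 * h z).
    by apply: eq_Rint => z; rewrite ger0_norm// mulr_ge0 ?sqr_ge0// mulr_ge0 ?chiQ_ge0 ?sqr_ge0.
  move=> cs; rewrite -(@ler_pXn2r _ 2) ?nnegrE//; last first.
    by apply: Rint_ge0 => z; rewrite mulr_ge0 ?sqr_ge0// mulr_ge0 ?chiQ_ge0 ?sqr_ge0.
  apply: (le_trans cs); rewrite exprMn sqr_sqrtr; last first.
    by apply: Rint_ge0 => z; rewrite (exprM _ 2 2) sqr_ge0.
  apply: ler_wpM2l; first by apply: Rint_ge0 => z; rewrite (exprM _ 2 2) sqr_ge0.
  apply: (le_trans qle); rewrite !exprMn; apply: ler_wpM2r; first exact: sqr_ge0.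
  by apply: eq_lexx; ring.
have cr : summable nu (fun z => chiQ c l z * r z ^+ 2) by exact: (summable_chiQM c l r2).
have cE : summable nu (fun z => chiQ c l z * E2 z) by exact: (summable_chiQM c l E2i).
have -> : \int[nu]_z (chiQ c l z * (2 * a ^+ 2 * r z ^+ 2 + 4 * l * rho * E2 z)) =
  2 * a ^+ 2 * \int[nu]_z (chiQ c l z * r z ^+ 2) +
  2 * (rho * (2 * l * \int[nu]_z (chiQ c l z * E2 z))).
  transitivity (\int[nu]_z (2 * a ^+ 2 * (chiQ c l z * r z ^+ 2) +
      4 * l * rho * (chiQ c l z * E2 z))).
    by apply: eq_Rint => z; ring.
  rewrite RintD; [|exact: summableZ|exact: summableZ].
  by rewrite !RintZ//; ring.
apply: (@le_trans _ _ (2 * a ^+ 2 * \int[nu]_z (chiQ c l z * r z ^+ 2) +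
   2 * \int[nu]_z (r z ^+ 2 * h z))); last by rewrite lerD2l ler_wpM2l.
rewrite -!RintZ// -RintD; [|exact: summableZ|exact: summableZ].
apply: ae_le_Rint.
- exact: (summable_chiQM c l rf2).
- by apply: summableD; exact: summableZ.
apply: aeW => z; rewrite /h.
have -> : 2 * a ^+ 2 * (chiQ c l z * r z ^+ 2) + 2 * (r z ^+ 2 * (chiQ c l z * (f z - m) ^+ 2))
  = chiQ c l z * (r z ^+ 2 * (2 * a ^+ 2 + 2 * (f z - m) ^+ 2)) by ring.
apply: ler_wpM2l; first exact: chiQ_ge0.
apply: ler_wpM2l; first exact: sqr_ge0.
have : m ^+ 2 <= a ^+ 2.
  by rewrite -(real_normK (num_real m)) ler_pXn2r ?nnegrE// (le_trans _ fa).
have := sqr_ge0 (m - (f z - m)); nra.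
Qed.

(** Descending the dyadic tree.  The function [S] collects the inverse sides
    of the squares visited so far, times their indicators.  By [square_L1]
    each step changes the mean by at most [4 / l] times the integral of [gam]
    over the square, so the total change is at most [4 \int gam S].  On the
    current square [S] is a constant [s], and [s <= 1 / l] by summing the
    geometric series; this is why [\int S^2] grows by at most [3] at each
    step, and Cauchy-Schwarz gives the square root of the depth. *)
Let dyadic_tree N : forall c l (S : plane -> R) s (m : nat) a0,
  inside c l -> measurable_fun setT S -> (exists C, forall z, `|S z| <= C) ->
  (forall z, chiQ c l z * S z = chiQ c l z * s) -> 0 <= s <= l^-1 ->
  \int[nu]_z (S z ^+ 2) <= 3 * m%:R ->
  `|avgQ c l f - a0| <= 4 * \int[nu]_z (gam z * S z) ->
  \int[nu]_z (chiQ c l z * (r z ^+ 2 * f z ^+ 2)) <=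
  \int[nu]_z (chiQ c l z * (2 * (`|a0| + 4 * Num.sqrt (G * (3 * (m + N)%:R))) ^+ 2 * r z ^+ 2
     + 4 * (l / 2 ^+ N) * rho * E2 z)).
Proof.
elim: N => [|N IHN] c l S s m a0 cl mS [C SC] Ss /andP[s0 sl] Sm fa.
  rewrite expr0 divr1 addn0; apply: leaf_bound => //.
  have S2 : summable nu (fun z => S z ^+ 2).
    have := summableMb (mu := nu) (measurable_funX 2 mS) (C := C ^+ 2) _ (summable_cst 1 nu_lty).
    under eq_fun do rewrite mulr1; apply => z.
    by rewrite normrX ler_pXn2r ?nnegrE// (le_trans _ (SC z)).
  rewrite -[avgQ c l f](subrK a0) addrC (le_trans (ler_normD _ _))// lerD2l.
  apply: (le_trans fa); rewrite ler_pM2l//.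
  rewrite (le_trans (ler_norm _))// -sqrtr_sqr ler_sqrt; last first.
    by rewrite mulr_ge0 ?mulr_ge0//; apply: Rint_ge0 => z; exact: sqr_ge0.
  have cs := cauchy_schwarz mgam mS gam2 S2.
  apply: (@le_trans _ _ ((\int[nu]_x `|gam x * S x|) ^+ 2)).
    rewrite -(real_normK (num_real (\int[nu]_z _))) ler_pXn2r ?nnegrE//; last first.
      by apply: Rint_ge0.
    by apply: le_normr_Rintegral => //; exact: summable_sqM.
  apply: (le_trans cs); apply: ler_wpM2l => //.
  by apply: Rint_ge0 => z; exact: sqr_ge0.
have l0 : 0 < l by case: cl.
(* The current square joins the list of ancestors of its four quarters. *)
pose S' z := S z + l^-1 * chiQ c l z.
have Qi := summable_chiQ c l.
have S2 : summable nu (fun z => S z ^+ 2).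
  have := summableMb (mu := nu) (measurable_funX 2 mS) (C := C ^+ 2) _ (summable_cst 1 nu_lty).
  under eq_fun do rewrite mulr1; apply => z.
  by rewrite normrX ler_pXn2r ?nnegrE// (le_trans _ (SC z)).
have gS : summable nu (fun z => gam z * S z) by exact: summable_sqM.
have gQ : summable nu (fun z => chiQ c l z * gam z) by exact: summable_chiQM.
have mS' : measurable_fun setT S'.
  by apply: measurable_funD => //; apply: measurable_funM => //; exact: measurable_chiQ.
have S'C : exists C', forall z, `|S' z| <= C'.
  exists (C + l^-1) => z; rewrite (le_trans (ler_normD _ _))// lerD// normrM.
  by rewrite ger0_norm ?invr_ge0 ?(ltW l0)// ler_piMr ?invr_ge0 ?(ltW l0)// chiQ_le1.
have s'l : 0 <= s + l^-1 <= (l / 2)^-1.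
  rewrite addr_ge0 ?invr_ge0 ?(ltW l0)//= invfM invrK mulr_natr mulr2n.
  by rewrite lerD2r.
(* The cross term is [2 s l <= 2] because [s <= 1 / l]. *)
have S'm : \int[nu]_z (S' z ^+ 2) <= 3 * m.+1%:R.
  have -> : \int[nu]_z (S' z ^+ 2) =
      \int[nu]_z (S z ^+ 2 + (2 * s * l^-1 + l^-1 ^+ 2) * chiQ c l z).
    apply/eq_Rint => z; rewrite /S'.
    transitivity (S z ^+ 2 + 2 * l^-1 * (chiQ c l z * S z) + l^-1 ^+ 2 * (chiQ c l z * chiQ c l z)).
      by ring.
    by rewrite Ss chiQ_id; ring.
  rewrite RintD//; last exact: summableZ.
  rewrite RintZ// Rint_chiQ// -[m.+1%:R]natr1 mulrDr mulr1; apply: lerD => //.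
  have -> : (2 * s * l^-1 + l^-1 ^+ 2) * l ^+ 2 = 2 * (s * l) + 1 by field; rewrite gt_eqF.
  have : s * l <= 1 by rewrite -ler_pdivlMr// div1r.
  lra.
have IH b1 b2 := IHN (quarter c l b1 b2) (l / 2) S' (s + l^-1) m.+1 a0
  (inside_quarter b1 b2 cl) mS' S'C.
have step b1 b2 : `|avgQ (quarter c l b1 b2) (l / 2) f - a0| <= 4 * \int[nu]_z (gam z * S' z).
  set q := quarter _ _ _ _.
  have -> : \int[nu]_z (gam z * S' z) = \int[nu]_z (gam z * S z) + l^-1 * \int[nu]_z (chiQ c l z * gam z).
    rewrite -RintZ// -RintD//; last exact: summableZ.
    by apply: eq_Rint => z; rewrite /S'; ring.
  rewrite (le_trans (ler_distD (avgQ c l f) _ _))// mulrDr addrC lerD//.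
  have qi := inside_quarter b1 b2 cl.
  have fm : summable nu (fun z => f z - avgQ c l f).
    by apply: summableB => //; apply: summable_cst; exact: nu_lty.
  have -> : avgQ q (l / 2) f - avgQ c l f =
      ((l / 2) ^+ 2)^-1 * \int[nu]_z (chiQ q (l / 2) z * (f z - avgQ c l f)).
    transitivity (((l / 2) ^+ 2)^-1 * (\int[nu]_z (chiQ q (l / 2) z * f z) - avgQ c l f * (l / 2) ^+ 2)).
      rewrite mulrBr mulrCA mulVf ?mulr1// expf_neq0// mulf_neq0// ?gt_eqF//.
    have Qq := summable_chiQ q (l / 2).
    rewrite -(Rint_chiQ qi) -RintZ// -RintB//; [|exact: summable_chiQM|exact: summableZ].
    by congr (_ * _); apply: eq_Rint => z; ring.
  rewrite normrM ger0_norm ?invr_ge0 ?sqr_ge0//.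
  have Qf : summable nu (fun z => chiQ c l z * `|f z - avgQ c l f|).
    by apply: summable_chiQM; exact: integrable_norm.
  have : `|\int[nu]_z (chiQ q (l / 2) z * (f z - avgQ c l f))| <=
      \int[nu]_z (chiQ c l z * `|f z - avgQ c l f|).
    apply: norm_Rint_le => //; first exact: summable_chiQM.
    apply: aeW => z; rewrite normrM; apply: ler_wpM2r => //.
    rewrite ger0_norm ?chiQ_ge0// -(chiQ_quarter c b1 b2 z l0) -[leRHS]mul1r.
    by apply: ler_wpM2r; [exact: chiQ_ge0|exact: (le_trans (ler_norm _) (chiQ_le1 _ _ _))].
  move=> /le_trans /(_ (square_L1 cl fi gi fg)) H.
  have -> : 4 * (l^-1 * \int[nu]_z (chiQ c l z * gam z)) =
      ((l / 2) ^+ 2)^-1 * (l * \int[nu]_z (chiQ c l z * gam z)) by field; rewrite gt_eqF.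
  by apply: ler_wpM2l => //; rewrite invr_ge0 sqr_ge0.
have Ss' b1 b2 z : chiQ (quarter c l b1 b2) (l / 2) z * S' z =
    chiQ (quarter c l b1 b2) (l / 2) z * (s + l^-1).
  rewrite /S' -(chiQ_quarter c b1 b2 z l0) -mulrA mulrDr Ss mulrCA chiQ_id.
  by ring.
have {IH} IH b1 b2 := IH b1 b2 (Ss' b1 b2) s'l S'm (step b1 b2).
have Qsum (F : plane -> R) : summable nu F -> \int[nu]_z (chiQ c l z * F z) =
    \int[nu]_z (chiQ (quarter c l false false) (l / 2) z * F z) +
    \int[nu]_z (chiQ (quarter c l false true) (l / 2) z * F z) +
    (\int[nu]_z (chiQ (quarter c l true false) (l / 2) z * F z) +
     \int[nu]_z (chiQ (quarter c l true true) (l / 2) z * F z)).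
  move=> Fi; rewrite -!RintD; try by [exact: summable_chiQM | apply: summableD; exact: summable_chiQM].
  by apply: eq_Rint => z; rewrite (chiQ_quarters c z l0) !mulrDl.
rewrite (Qsum _ rf2) [leRHS]Qsum; last by apply: summableD; exact: summableZ.
have lE : l / 2 / 2 ^+ N = l / 2 ^+ N.+1 by rewrite exprS invfM mulrA.
by rewrite -lE -addSnnS !lerD ?IH.
Qed.

(** Run [dyadic_tree] from the whole torus, where the mean of [f] and hence the
    starting values [a0] and [S] vanish. *)
Lemma dyadic_product N : \int[nu]_z f z = 0 ->
  \int[nu]_z (r z ^+ 2 * f z ^+ 2) <=
  (192 * N%:R * \int[nu]_z (r z ^+ 2) + 8 * pi / 2 ^+ N * rho) * \int[nu]_z E2 z.
Proof.
move=> f0.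
have a00 : avgQ (0, 0) (2 * pi) f = 0 by rewrite /avgQ (Rint_whole mf) f0 mulr0.
have b0 : exists C : R, forall z : plane, `|(fun=> 0 : R) z| <= C.
  by exists 0 => z; rewrite normr0.
have c0 (z : plane) : chiQ (0, 0) (2 * pi) z * 0 = chiQ (0, 0) (2 * pi) z * 0 by [].
have s0 : 0 <= (0 : R) <= (2 * pi : R)^-1.
  by apply/andP; split; [exact: lexx|rewrite invr_ge0 ltW].
have m0 : \int[nu]_z ((fun=> 0 : R) z ^+ 2) <= 3 * 0%:R.
  by under eq_Rint do rewrite expr0n; rewrite Rint0 mulr0.
have d0 : `|avgQ (0, 0) (2 * pi) f - 0| <= 4 * \int[nu]_z (gam z * (fun=> 0 : R) z).
  by rewrite a00 subrr normr0; under eq_Rint do rewrite mulr0; rewrite Rint0 mulr0.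
have := dyadic_tree N whole (measurable_cst _) b0 c0 s0 m0 d0.
rewrite !Rint_whole; last 2 first.
- by apply: measurable_funD; apply: measurable_funM => //; [exact: measurable_funX|exact: summable_measurable E2i].
- exact: summable_measurable rf2.
move=> /le_trans; apply.
rewrite RintD; [|exact: summableZ|exact: summableZ].
rewrite !RintZ// normr0 add0r add0n exprMn sqr_sqrtr; last first.
  by rewrite mulr_ge0// Rint_ge0// => z; exact: sqr_ge0.
rewrite [leRHS]mulrDl; apply: lerD; last by apply: eq_lexx; field.
have GE : G <= 2 * \int[nu]_z E2 z.
  rewrite -RintZ//; apply: ae_le_Rint => //; first exact: summableZ.
  apply: aeW => z; rewrite /gam /E2 -(real_normK (num_real (g 0 z))) -(real_normK (num_real (g 1 z))).
  by have := sqr_ge0 (`|g 0 z| - `|g 1 z|); nra.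
have R0 : 0 <= \int[nu]_z (r z ^+ 2) by apply: Rint_ge0 => z; exact: sqr_ge0.
rewrite (_ : 2 * (4 ^+ 2 * (G * (3 * N%:R))) = 96 * N%:R * G); last by ring.
rewrite (_ : 192 * _ * _ * _ = (96 * N%:R * (2 * \int[nu]_z E2 z)) * \int[nu]_z (r z ^+ 2)); last by ring.
by apply: ler_wpM2r => //; apply: ler_wpM2l => //; rewrite mulr_ge0.
Qed.

End Log.
End Dyadic.

(** * Sobolev embedding and the logarithmic product estimate *)

Section Sobolev.
Context {R : realType}.
Local Notation circ := (@circ R).
Local Notation nu := (circ \x circ)%E.
Local Notation plane := (R * R)%type.

Let pi20 : 0 < 2 * pi :> R. Proof. by rewrite mulr_gt0// pi_gt0. Qed.

Lemma Rint_nu_cst (k : R) : \int[nu]_z k = k * (2 * pi) ^+ 2.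
Proof.
rewrite -(Rint_whole (measurable_cst k)) -(Rint_chiQ whole) -RintZ; last exact: summable_chiQ.
by apply: eq_Rint => z; rewrite mulrC.
Qed.

(** Cauchy-Schwarz against the constant [1]. *)
Lemma cauchy_schwarz1 (h : plane -> R) : measurable_fun setT h ->
  summable nu (fun z => h z ^+ 2) ->
  (\int[nu]_z `|h z|) ^+ 2 <= \int[nu]_z (h z ^+ 2) * (2 * pi) ^+ 2.
Proof.
move=> mh h2.
have := cauchy_schwarz mh (measurable_cst (1 : R)) h2 (summable_cst (1 ^+ 2) nu_lty).
have -> : \int[nu]_x (cst (1 : R) x ^+ 2) = (2 * pi) ^+ 2.
  by rewrite -[RHS]mul1r -Rint_nu_cst; apply: eq_Rint => z; rewrite expr1n.
have -> // : \int[nu]_x `|h x * cst 1 x| = \int[nu]_x `|h x|.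
by apply: eq_Rint => z; rewrite mulr1.
Qed.

Section OneFunction.
Variables (f : plane -> R) (g : 'I_2 -> plane -> R).
Hypotheses (fi : summable nu f) (gi : forall j, summable nu (fun z => g j z ^+ 2))
  (fg : forall j, ac_line j f (g j)).
Let E := \int[nu]_z (g 0 z ^+ 2 + g 1 z ^+ 2).
Let mf : measurable_fun setT f. Proof. exact: summable_measurable fi. Qed.
Let E0 : 0 <= E. Proof. by apply: Rint_ge0 => z; rewrite addr_ge0 ?sqr_ge0. Qed.

Let meas4 (h : plane -> R) (a : R) : measurable_fun setT h -> measurable_fun setT (fun z => (h z - a) ^+ 4).
Proof. by move=> mh; apply: measurable_funX; apply: measurable_funB. Qed.

Let dev4 (a := avgQ (0, 0) (2 * pi) f) : summable nu (fun z => (f z - a) ^+ 4) /\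
  \int[nu]_z ((f z - a) ^+ 4) <= (4 * pi * E) ^+ 2.
Proof.
have [s le] := square_L4 whole fi gi fg.
have m4 := meas4 a mf.
split; first exact: (summable_whole m4 s).
rewrite -(Rint_whole m4); apply: (le_trans le); rewrite Rint_whole.
  by rewrite -/E; apply: eq_lexx; ring.
by apply: summable_measurable; exact: (summableD (gi 0) (gi 1)).
Qed.

(** [square_L4] on the whole torus bounds [f] minus its mean; the mean is
    controlled by the [L^2] norm. *)
Lemma L4_embedding : summable nu (fun z => f z ^+ 2) ->
  summable nu (fun z => f z ^+ 4) /\
  \int[nu]_z (f z ^+ 4) <= (12 * pi * (\int[nu]_z (f z ^+ 2) + E)) ^+ 2.
Proof.
move=> f2; have [] := dev4; set a := avgQ _ _ f => ds dle.
set B := \int[nu]_z (f z ^+ 2).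
have B0 : 0 <= B by apply: Rint_ge0 => z; exact: sqr_ge0.
have f4 : {ae nu, forall z, f z ^+ 4 <= 8 * (f z - a) ^+ 4 + 8 * a ^+ 4}.
  apply: aeW => z; have -> : f z = (f z - a) + a by rewrite subrK.
  rewrite addrK; move: (f z - a) => x.
  have h1 : (x + a) ^+ 2 <= 2 * (x ^+ 2 + a ^+ 2) by have := sqr_ge0 (x - a); nra.
  have h2 : ((x + a) ^+ 2) ^+ 2 <= (2 * (x ^+ 2 + a ^+ 2)) ^+ 2.
    by rewrite ler_pXn2r ?nnegrE ?sqr_ge0// mulr_ge0// addr_ge0 ?sqr_ge0.
  rewrite !(exprM _ 2 2); apply: (le_trans h2).
  by have := sqr_ge0 (x ^+ 2 - a ^+ 2); nra.
have dom : summable nu (fun z => 8 * (f z - a) ^+ 4 + 8 * a ^+ 4).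
  by apply: summableD; [exact: summableZ|apply: summable_cst; exact: nu_lty].
have sf4 : summable nu (fun z => f z ^+ 4).
  apply: (summable_ae_le (measurable_funX 4 mf) _ dom); apply: filterS f4 => z h.
  rewrite ger0_norm; last by rewrite (exprM _ 2 2) sqr_ge0.
  by rewrite (le_trans h)// ler_norm.
split=> //; apply: (le_trans (ae_le_Rint sf4 dom f4)).
rewrite RintD; [|exact: summableZ|by apply: summable_cst; exact: nu_lty].
rewrite RintZ// Rint_nu_cst.
have aB : (2 * pi) ^+ 2 * a ^+ 2 <= B.
  have := cauchy_schwarz1 mf f2; rewrite -/B.
  have : (\int[nu]_z f z) ^+ 2 <= (\int[nu]_z `|f z|) ^+ 2.
    rewrite -(real_normK (num_real (\int[nu]_z f z))) ler_pXn2r ?nnegrE//; last first.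
      by apply: Rint_ge0.
    exact: le_normr_Rintegral.
  move=> /le_trans /[apply].
  rewrite /a /avgQ (Rint_whole mf); move: (\int[nu]_z f z) => I h.
  have p4 : 0 < (2 * pi : R) ^+ 2 by rewrite exprn_gt0.
  have -> : (2 * pi) ^+ 2 * (((2 * pi) ^+ 2)^-1 * I) ^+ 2 = I ^+ 2 / (2 * pi) ^+ 2.
    have : 2 * pi != 0 :> R by rewrite gt_eqF.
    by move: (2 * pi) => p pn; field.
  by rewrite ler_pdivrMr.
have pi2 := @pi_ge2 R; have p0 := @pi_gt0 R.
have a2 : 0 <= a ^+ 2 := sqr_ge0 a.
have a4 : a ^+ 4 * (2 * pi) ^+ 2 <= B ^+ 2.
  have p1 : 1 <= (2 * pi : R) ^+ 2 by nra.
  have h1 : a ^+ 2 <= B by nra.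
  by rewrite (exprM _ 2 2); nra.
have -> : (12 * pi * (B + E)) ^+ 2 = 144 * pi ^+ 2 * B ^+ 2 + 288 * pi ^+ 2 * (B * E) + 144 * pi ^+ 2 * E ^+ 2 by ring.
have BE : 0 <= pi ^+ 2 * (B * E) by apply: mulr_ge0; [exact: sqr_ge0|exact: mulr_ge0].
have pB : B ^+ 2 <= pi ^+ 2 * B ^+ 2.
  by rewrite -[leLHS]mul1r ler_wpM2r ?sqr_ge0//; nra.
have pE : 0 <= pi ^+ 2 * E ^+ 2 by apply: mulr_ge0; exact: sqr_ge0.
have -> : 8 * a ^+ 4 * (2 * pi) ^+ 2 = 8 * (a ^+ 4 * (2 * pi) ^+ 2) by ring.
have dle' : \int[nu]_x (f x - a) ^+ 4 <= 16 * (pi ^+ 2 * E ^+ 2).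
  by apply: (le_trans dle); apply: eq_lexx; ring.
have B2 : 0 <= B ^+ 2 := sqr_ge0 B.
lra.
Qed.

Lemma L4_mean0 : \int[nu]_z f z = 0 ->
  summable nu (fun z => f z ^+ 4) /\ \int[nu]_z (f z ^+ 4) <= (4 * pi * E) ^+ 2.
Proof.
move=> f0; have := dev4; rewrite /avgQ (Rint_whole mf) f0 mulr0.
have -> // : (fun z => (f z - 0) ^+ 4) = (fun z => f z ^+ 4).
by apply/funext => z; rewrite subr0.
Qed.

(** The Poincare inequality, from [L4_mean0] by Cauchy-Schwarz. *)
Lemma poincare_mean0 : \int[nu]_z f z = 0 -> summable nu (fun z => f z ^+ 2) ->
  \int[nu]_z (f z ^+ 2) <= 8 * pi ^+ 2 * E.
Proof.
move=> f0 f2; have [f4 f4le] := L4_mean0 f0.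
have pi0 := @pi_gt0 R.
have B0 : 0 <= \int[nu]_z (f z ^+ 2) by apply: Rint_ge0 => z; exact: sqr_ge0.
have sq4 : (fun z => (f z ^+ 2) ^+ 2) = (fun z => f z ^+ 4).
  by apply/funext => z; rewrite -exprM.
have f22 : summable nu (fun z => (f z ^+ 2) ^+ 2) by rewrite sq4.
have := cauchy_schwarz1 (measurable_funX 2 mf) f22; rewrite sq4.
have -> : \int[nu]_x `|f x ^+ 2| = \int[nu]_x f x ^+ 2.
  by apply: eq_Rint => z; rewrite ger0_norm ?sqr_ge0.
move=> h; rewrite -(@ler_pXn2r _ 2) ?nnegrE//; last first.
  by apply: mulr_ge0 => //; apply: mulr_ge0 => //; exact: sqr_ge0.
apply: (le_trans h); apply: (@le_trans _ _ ((4 * pi * E) ^+ 2 * (2 * pi) ^+ 2)).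
  by rewrite ler_wpM2r ?sqr_ge0.
by apply: eq_lexx; ring.
Qed.

End OneFunction.

Lemma expR_half_le2 : expR (2^-1) <= 2 :> R.
Proof.
have := expR_ge1Dx (- 2^-1 : R); rewrite expRN => h.
have e0 := expR_gt0 (2^-1 : R).
have : 2^-1 <= (expR 2^-1)^-1 :> R by apply: le_trans h; lra.
by rewrite lef_pV2 ?posrE.
Qed.

(** Any base at most [2] would do for the second bound; [exp (1/2)] turns it
    into a lower bound on [N] that is linear in the logarithm. *)
Lemma scales (q : R) : 0 <= q -> exists N : nat,
  N%:R <= 2 * (1 + ln (1 + q)) /\ 1 + q <= 2 ^+ N.
Proof.
move=> q0; have q1 : 0 < 1 + q by rewrite ltr_pwDl.
have l0 : 0 <= ln (1 + q) by rewrite ln_ge0// lerDl.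
(* Rounding up [2 ln (1 + q)] makes [exp (N / 2)] at least [1 + q]. *)
exists (Num.truncn (2 * ln (1 + q))).+1.
have := truncn_itv (mulr_ge0 (ler0n R 2) l0) => /andP[h1 h2].
split; first by rewrite -natr1; lra.
rewrite -{1}(lnK q1).
apply: (@le_trans _ _ (expR (2^-1) ^+ (Num.truncn (2 * ln (1 + q))).+1)); last first.
  by rewrite ler_pXn2r ?nnegrE ?expR_ge0 ?expR_half_le2.
rewrite -expRM_natl ler_expR; lra.
Qed.

(** Once [2^N] is at least [1 + H / a], the remainder of [dyadic_product] is
    at most a multiple of [2^-N H <= a], by the Sobolev embedding of [r]. *)
Lemma log_product (f r : plane -> R) (g gr : 'I_2 -> plane -> R) :
  summable nu f -> (forall j, summable nu (fun z => g j z ^+ 2)) ->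
  (forall j, ac_line j f (g j)) -> \int[nu]_z f z = 0 ->
  (forall j, summable nu (fun z => gr j z ^+ 2)) -> (forall j, ac_line j r (gr j)) ->
  summable nu (fun z => r z ^+ 2) -> 0 < \int[nu]_z (r z ^+ 2) ->
  let a := \int[nu]_z (r z ^+ 2) in
  let H := a + \int[nu]_z (gr 0 z ^+ 2 + gr 1 z ^+ 2) in
  \int[nu]_z (r z ^+ 2 * f z ^+ 2) <= (384 + 96 * pi ^+ 2) * a * (1 + ln (1 + H / a))
     * \int[nu]_z (g 0 z ^+ 2 + g 1 z ^+ 2).
Proof.
move=> fi gi fg f0 gri rgr r2 a0; cbv zeta.
set a := \int[nu]_z (r z ^+ 2) in a0 *; set H := a + _.
have mr : measurable_fun setT r by have [] := rgr 0.
have ri := nu_sq_summable mr r2.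
have [r4 r4le] := L4_embedding ri gri rgr r2.
have [f4 _] := L4_mean0 fi gi fg f0.
have E0 : 0 <= \int[nu]_z (g 0 z ^+ 2 + g 1 z ^+ 2).
  by apply: Rint_ge0 => z; rewrite addr_ge0 ?sqr_ge0.
have Er0 : 0 <= \int[nu]_z (gr 0 z ^+ 2 + gr 1 z ^+ 2).
  by apply: Rint_ge0 => z; rewrite addr_ge0 ?sqr_ge0.
have H0 : 0 <= H by rewrite addr_ge0// ltW.
have q0 : 0 <= H / a by rewrite divr_ge0// ltW.
have [N [Nle N2]] := scales q0.
apply: (le_trans (dyadic_product fi f4 gi fg mr r4 N f0)).
apply: ler_wpM2r => //; rewrite -/a.
have pi0 := @pi_gt0 R.
have rho : Num.sqrt (\int[nu]_z r z ^+ 4) <= 12 * pi * H.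
  have p : 0 <= 12 * pi * H by rewrite mulr_ge0// mulr_ge0// ltW.
  by rewrite -(ger0_norm p) -sqrtr_sqr ler_sqrt ?sqr_ge0.
have p2 : 0 < 2 ^+ N :> R by rewrite exprn_gt0.
have Hq : H / 2 ^+ N <= a.
  rewrite ler_pdivrMr//; apply: le_trans (ler_wpM2l (ltW a0) N2).
  by rewrite mulrDr mulr1 mulrCA mulfV ?gt_eqF// mulr1 lerDr ltW.
have h1 : 8 * pi / 2 ^+ N * Num.sqrt (\int[nu]_z r z ^+ 4) <= 96 * pi ^+ 2 * a.
  apply: (@le_trans _ _ (8 * pi / 2 ^+ N * (12 * pi * H))).
    by apply: ler_wpM2l => //; rewrite divr_ge0 ?(ltW p2)// mulr_ge0// ltW.
  have -> : 8 * pi / 2 ^+ N * (12 * pi * H) = 96 * pi ^+ 2 * (H / 2 ^+ N) by move: pi (_^-1) => p i; ring.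
  by apply: ler_wpM2l => //; rewrite mulr_ge0 ?sqr_ge0.
have l0 : 0 <= ln (1 + H / a) by rewrite ln_ge0// lerDl.
have h2 : 192 * N%:R * a <= 384 * a * (1 + ln (1 + H / a)).
  have : N%:R * a <= 2 * (1 + ln (1 + H / a)) * a by rewrite ler_wpM2r// ltW.
  nra.
have h3 : 96 * pi ^+ 2 * a <= 96 * pi ^+ 2 * a * (1 + ln (1 + H / a)).
  by rewrite ler_peMr ?lerDl// mulr_ge0 ?(ltW a0)// mulr_ge0 ?sqr_ge0.
nra.
Qed.

End Sobolev.

(** * The pointwise identity *)

Lemma ord2P (i : 'I_2) : i = 0 \/ i = 1.
Proof. by case: i => [[|[|k]] h] //; [left|right]; exact/val_inj. Qed.

Section Graded.
Context {R : realType}.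
Local Notation circ := (@circ R).
Local Notation nu := (circ \x circ)%E.
Local Notation plane := (R * R)%type.
Variables X Y : plane -> R.
Hypothesis X1 : forall z, 1 <= X z.
Implicit Types (F G : plane -> R) (k : nat).

(** [X] stands for the size of the undifferentiated fields and [Y] for that of
    their derivatives.  A function of degree [k] has size [X^k] and a
    derivative of size [X^(k-1) Y]; the second bound is multiplied by [X] so
    as to make sense for [k = 0]. *)
Definition graded j k F F' := ac_line j F F' /\ exists2 c, 0 <= c &
  {ae nu, forall z, `|F z| <= c * X z ^+ k /\ `|F' z| * X z <= c * X z ^+ k * Y z}.

Let X0 z : 0 <= X z. Proof. exact: le_trans ler01 (X1 z). Qed.
Lemma gradedD j k F F' G G' : graded j k F F' -> graded j k G G' ->
  graded j k (fun z => F z + G z) (fun z => F' z + G' z).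
Proof.
move=> [aF [c c0 hF]] [aG [d d0 hG]]; split; first exact: ac_line_add.
exists (c + d); first exact: addr_ge0.
apply: filterS2 hF hG => z [h1 h2] [h3 h4]; split.
  by rewrite mulrDl (le_trans (ler_normD _ _))// lerD.
rewrite mulrDl mulrDl; apply: (@le_trans _ _ ((`|F' z| + `|G' z|) * X z)).
  by rewrite ler_wpM2r// ler_normD.
by rewrite mulrDl lerD.
Qed.

Lemma gradedZ j k a F F' : graded j k F F' ->
  graded j k (fun z => a * F z) (fun z => a * F' z).
Proof.
move=> [aF [c c0 hF]]; split; first exact: ac_line_scale.
exists (`|a| * c); first exact: mulr_ge0.
apply: filterS hF => z [h1 h2]; rewrite !normrM -!mulrA.
by split; rewrite ler_wpM2l// !mulrA.
Qed.

Lemma gradedM j k l F F' G G' : graded j k F F' -> graded j l G G' ->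
  graded j (k + l) (fun z => F z * G z) (fun z => F' z * G z + F z * G' z).
Proof.
move=> [aF [c c0 hF]] [aG [d d0 hG]]; split; first exact: ac_line_mul.
exists (2 * (c * d)); first by rewrite mulr_ge0// mulr_ge0.
apply: filterS2 hF hG => z [h1 h2] [h3 h4].
have Xk i : 0 <= X z ^+ i by exact: exprn_ge0.
have p : `|F z| * `|G z| <= c * X z ^+ k * (d * X z ^+ l) by exact: ler_pM.
have p1 : `|F' z| * X z * `|G z| <= c * X z ^+ k * Y z * (d * X z ^+ l).
  by apply: ler_pM => //; exact: mulr_ge0.
have p2 : `|F z| * (`|G' z| * X z) <= c * X z ^+ k * (d * X z ^+ l * Y z).
  by apply: ler_pM => //; exact: mulr_ge0.
have cd : 0 <= c * X z ^+ k * (d * X z ^+ l) by rewrite !mulr_ge0.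
rewrite exprD; split.
  by rewrite normrM (le_trans p)// -subr_ge0; apply: le_trans cd _; apply: eq_lexx; ring.
apply: (@le_trans _ _ ((`|F' z| * `|G z| + `|F z| * `|G' z|) * X z)).
  by rewrite ler_wpM2r// -!normrM ler_normD.
have -> : (`|F' z| * `|G z| + `|F z| * `|G' z|) * X z
  = `|F' z| * X z * `|G z| + `|F z| * (`|G' z| * X z) by ring.
apply: (le_trans (lerD p1 p2)).
by apply: eq_lexx; ring.
Qed.

(** In degree three the derivative has size [X^2 Y <= X^4 + Y^2], hence it is
    summable, and [ac_line_int0] applies. *)
Lemma graded_int0 j F F' : measurable_fun setT X -> measurable_fun setT Y ->
  summable nu (fun z => X z ^+ 4) -> summable nu (fun z => Y z ^+ 2) ->
  graded j 3 F F' -> summable nu F' /\ \int[nu]_z F' z = 0.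
Proof.
move=> mX mY X4 Y2 [aF [c c0 h]].
suff s : summable nu F' by split => //; exact: ac_line_int0 aF s.
have [_ mF' _] := aF.
apply: (summable_ae_le mF' _ (summableZ c (summableD X4 Y2))).
apply: filterS h => z [_ h]; rewrite [leRHS]ger0_norm; last first.
  by apply: mulr_ge0 => //; rewrite addr_ge0 ?sqr_ge0 ?exprn_ge0.
have Xp : 0 < X z by exact: lt_le_trans ltr01 (X1 z).
have {h} : `|F' z| <= c * (X z ^+ 2 * Y z).
  rewrite -(ler_pM2r Xp); apply: (le_trans h).
  by apply: eq_lexx; ring.
move=> /le_trans; apply; apply: ler_wpM2l => //.
rewrite (exprM _ 2 2); have := sqr_ge0 (X z ^+ 2 - Y z).
have := sqr_ge0 (X z ^+ 2); have := sqr_ge0 (Y z); nra.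
Qed.

End Graded.

Section Pointwise.
Context {R : realFieldType}.
Implicit Types (e u m : 'I_2 -> R) (E U W : 'I_2 -> 'I_2 -> R) (i j : 'I_2).

(** The components of the rotated field [n = perp m]. *)
Definition rot m i : R := if i == 0 then - m 1 else m 0.
(** Throughout, [E i j], [U i j] and [W i j] stand for the [j]-th derivatives
    of [e i], [u i] and [m i]; a definition with the prefix [d] is the formal
    derivative of its namesake. *)
Definition drot W i j : R := if i == 0 then - W 1 j else W 0 j.
Definition pair e m : R := e 0 * m 0 + e 1 * m 1.
Definition dpair e m E W j : R :=
  (E 0 j * m 0 + e 0 * W 0 j) + (E 1 j * m 1 + e 1 * W 1 j).
(** The shear defect [D_n n - (div n) n]. *)
Definition defect m W i : R :=
  drot W i 0 * rot m 0 + drot W i 1 * rot m 1 - (drot W 0 0 + drot W 1 1) * rot m i.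
Definition inertia e U : R := \sum_(i < 2) \sum_(j < 2) e j * U i j * e i.
(** The [j]-th component of [s^2 w n + 2 r s w m]. *)
Definition flux e u m j : R :=
  pair e (rot m) * pair e (rot m) * (pair u (rot m) * rot m j)
  + 2 * (pair e m * m j * (pair e (rot m) * pair u (rot m))).
Definition dflux e u m E U W j : R :=
  let s := pair e (rot m) in let w := pair u (rot m) in
  let ds := dpair e (rot m) E (drot W) j in let dw := dpair u (rot m) U (drot W) j in
  (ds * s + s * ds) * (w * rot m j) + s * s * (dw * rot m j + w * drot W j j)
  + 2 * ((dpair e m E W j * m j + pair e m * W j j) * (s * w)
         + pair e m * m j * (ds * w + s * dw)).
(** The cofactor of [r] in the integrand, once the flux has been split off. *)
Definition remainder e u m E U W : R :=
  let s := pair e (rot m) in let w := pair u (rot m) in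
  \sum_(i < 2) \sum_(j < 2)
    (pair e m * m i * m j + s * (m i * rot m j + rot m i * m j)) * U i j
  - 2 * \sum_(j < 2) m j * (dpair e (rot m) E (drot W) j * w
                            + s * dpair u (rot m) U (drot W) j).

(** Stated for arbitrary numbers this is a polynomial identity: the right-hand
    side collects what vanishes when [|m| = 1], [div e = 0] and [m . d_j m =
    0]. *)
Lemma shear_identity0 e u m E U W :
  let mu := m 0 * m 0 + m 1 * m 1 in
  inertia e U - (dflux e u m E U W 0 + dflux e u m E U W 1
    - pair e (rot m) ^+ 2 * pair u (defect m W) + pair e m * remainder e u m E U W)
  = (1 - mu ^+ 2) * inertia e U - 2 * pair e (rot m) * pair u (rot m) *
     (mu * (E 0 0 + E 1 1) + 2 * (e 0 * pair m (fun i => W i 0) + e 1 * pair m (fun i => W i 1))).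
Proof.
rewrite /inertia /dflux /remainder /dpair /pair /defect /drot /rot /=.
rewrite !big_ord_recl !big_ord0 /=.
have -> : lift ord0 ord0 = 1 :> 'I_2 by apply/val_inj.
have -> : ord0 = 0 :> 'I_2 by [].
rewrite /=.
ring.
Qed.

(** The error terms of [shear_identity0] vanish. *)
Lemma shear_identity e u m E U W : m 0 * m 0 + m 1 * m 1 = 1 ->
  E 0 0 + E 1 1 = 0 -> (forall j, pair m (fun i => W i j) = 0) ->
  inertia e U = dflux e u m E U W 0 + dflux e u m E U W 1
    - pair e (rot m) ^+ 2 * pair u (defect m W) + pair e m * remainder e u m E U W.
Proof.
move=> m1 dE mW; apply/eqP; rewrite -subr_eq0; apply/eqP.
have := shear_identity0 e u m E U W; cbv zeta => ->.
by rewrite m1 dE !mW; ring.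
Qed.

Definition l1_vec e : R := `|e 0| + `|e 1|.
Definition l1_mat E : R := `|E 0 0| + `|E 0 1| + (`|E 1 0| + `|E 1 1|).

(** For a unit vector [m] every factor [m i] or [rot m i] is at most [1], and
    every derivative of one at most [M]. *)
Lemma remainder_le e u m E U W M : m 0 * m 0 + m 1 * m 1 = 1 ->
  (forall i j, `|W i j| <= M) ->
  `|remainder e u m E U W| <=
    2 * (l1_mat E * l1_vec u) + 5 * (l1_mat U * l1_vec e) + 8 * M * (l1_vec e * l1_vec u).
Proof.
move=> mm WM.
have mi i : `|m i| <= 1.
  suff : `|m i| ^+ 2 <= 1 by rewrite expr_le1.
  rewrite real_normK ?num_real//.
  have [-> | ->] := ord2P i.
    by rewrite expr2 -mm lerDl -expr2 sqr_ge0.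
  by rewrite expr2 -mm lerDr -expr2 sqr_ge0.
have ni i : `|rot m i| <= 1 by rewrite /rot; case: ifP => _; rewrite ?normrN.
have DW i j : `|drot W i j| <= M by rewrite /drot; case: ifP => _; rewrite ?normrN.
have pl v k : (forall i, `|k i| <= 1) -> `|pair v k| <= l1_vec v.
  move=> k1; apply: (le_trans (ler_normD _ _)); rewrite !normrM.
  by apply: lerD; rewrite ler_piMr.
have dl v k F Z j : (forall i, `|k i| <= 1) -> (forall i j, `|Z i j| <= M) ->
    `|dpair v k F Z j| <= `|F 0 j| + `|F 1 j| + M * l1_vec v.
  move=> k1 Z1; apply: (le_trans (ler_normD _ _)).
  have h i : `|F i j * k i + v i * Z i j| <= `|F i j| + M * `|v i|.
    apply: (le_trans (ler_normD _ _)); rewrite !normrM; apply: lerD.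
      by rewrite ler_piMr.
    by rewrite mulrC ler_wpM2r.
  by apply: (le_trans (lerD (h 0) (h 1))); rewrite /l1_vec; apply: eq_lexx; ring.
have s1 := pl e _ ni; have w1 := pl u _ ni; have r1 := pl e _ mi.
have M0 : 0 <= M by exact: le_trans (normr_ge0 _) (WM 0 0).
have S0 v : 0 <= l1_vec v by rewrite addr_ge0.
rewrite /remainder; apply: (le_trans (ler_normB _ _)).
have ha i j : `|(pair e m * m i * m j + pair e (rot m) * (m i * rot m j + rot m i * m j)) * U i j|
    <= 3 * (l1_vec e * `|U i j|).
  rewrite normrM mulrA ler_wpM2r//; apply: (le_trans (ler_normD _ _)).
  have -> : 3 * l1_vec e = l1_vec e * 1 * 1 + l1_vec e * (1 + 1) by ring.
  apply: lerD; rewrite !normrM.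
    by apply: ler_pM => //; (exact: mulr_ge0 || exact: ler_pM).
  apply: ler_pM => //; apply: (le_trans (ler_normD _ _)); rewrite !normrM.
  by apply: lerD; rewrite -[leRHS]mulr1; apply: ler_pM.
have hb j : `|m j * (dpair e (rot m) E (drot W) j * pair u (rot m)
      + pair e (rot m) * dpair u (rot m) U (drot W) j)| <=
    (`|E 0 j| + `|E 1 j| + M * l1_vec e) * l1_vec u + l1_vec e * (`|U 0 j| + `|U 1 j| + M * l1_vec u).
  rewrite normrM -[leRHS]mul1r; apply: ler_pM => //.
  apply: (le_trans (ler_normD _ _)); rewrite !normrM.
  by apply: lerD; apply: ler_pM => //; exact: dl.
rewrite !big_ord_recl !big_ord0 /= !addr0.
have -> : lift ord0 ord0 = 1 :> 'I_2 by apply/val_inj.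
have -> : ord0 = 0 :> 'I_2 by [].
have h0 : forall a b c d : R, `|a + b + (c + d)| <= `|a| + `|b| + (`|c| + `|d|).
  by move=> a b c d; apply: (le_trans (ler_normD _ _)); apply: lerD; exact: ler_normD.
have hbs := le_trans (ler_normD _ _) (lerD (hb 0) (hb 1)).
have has := le_trans (h0 _ _ _ _) (lerD (lerD (ha 0 0) (ha 0 1)) (lerD (ha 1 0) (ha 1 1))).
have h2 x : `|2 * x| = 2 * `|x| :> R by rewrite normrM ger0_norm.
rewrite [X in _ + X <= _]h2; apply: (le_trans (lerD has (ler_wpM2l _ hbs))) => //.
rewrite /l1_mat.
by apply: eq_lexx; ring.
Qed.

End Pointwise.

(** * Mean-zero fields with square-summable gradient *)

Section Core.
Context {R : realType}.
Local Notation circ := (@circ R).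
Local Notation nu := (circ \x circ)%E.
Local Notation plane := (R * R)%type.

Lemma summable_sqD (f g : plane -> R) : measurable_fun setT f -> measurable_fun setT g ->
  summable nu (fun z => f z ^+ 2) -> summable nu (fun z => g z ^+ 2) ->
  summable nu (fun z => (f z + g z) ^+ 2).
Proof.
move=> mf mg f2 g2; apply: (summable_le _ _ (summableZ 2 (summableD f2 g2))).
  by apply: measurable_funX; exact: measurable_funD.
move=> z; rewrite !ger0_norm ?sqr_ge0//; last by rewrite mulr_ge0// addr_ge0 ?sqr_ge0.
by have := sqr_ge0 (f z - g z); nra.
Qed.

Lemma summable_p4D (f g : plane -> R) : measurable_fun setT f -> measurable_fun setT g ->
  summable nu (fun z => f z ^+ 4) -> summable nu (fun z => g z ^+ 4) ->
  summable nu (fun z => (f z + g z) ^+ 4).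
Proof.
move=> mf mg f4 g4.
have sq (h : plane -> R) : (fun z => h z ^+ 4) = (fun z => (h z ^+ 2) ^+ 2).
  by apply/funext => z; rewrite -exprM.
rewrite sq in f4; rewrite sq in g4; rewrite sq.
have h := summable_sqD (measurable_funX 2 mf) (measurable_funX 2 mg) f4 g4.
apply: (summable_le _ _ (summableZ 4 h)).
  by do 2 apply: measurable_funX; exact: measurable_funD.
move=> z; rewrite !ger0_norm ?sqr_ge0//; last by apply: mulr_ge0 => //; exact: sqr_ge0.
have -> : 4 * (f z ^+ 2 + g z ^+ 2) ^+ 2 = (2 * (f z ^+ 2 + g z ^+ 2)) ^+ 2 by ring.
rewrite ler_pXn2r ?nnegrE ?sqr_ge0//; last by rewrite mulr_ge0// addr_ge0 ?sqr_ge0.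
by have := sqr_ge0 (f z - g z); nra.
Qed.

Lemma cauchy_schwarz_le (f g : plane -> R) (a b : R) :
  measurable_fun setT f -> measurable_fun setT g ->
  summable nu (fun z => f z ^+ 2) -> summable nu (fun z => g z ^+ 2) ->
  0 <= a -> 0 <= b -> \int[nu]_z (f z ^+ 2) <= a ^+ 2 -> \int[nu]_z (g z ^+ 2) <= b ^+ 2 ->
  \int[nu]_z `|f z * g z| <= a * b.
Proof.
move=> mf mg f2 g2 a0 b0 fa gb.
have i0 : 0 <= \int[nu]_z `|f z * g z| by exact: Rint_ge0.
rewrite -(@ler_pXn2r _ 2) ?nnegrE//; last exact: mulr_ge0.
apply: (le_trans (cauchy_schwarz mf mg f2 g2)); rewrite exprMn.
by apply: ler_pM => //; apply: Rint_ge0 => z; exact: sqr_ge0.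
Qed.

Definition energy (E : 'I_2 -> 'I_2 -> plane -> R) :=
  \int[nu]_z (E 0 0 z ^+ 2 + E 0 1 z ^+ 2) + \int[nu]_z (E 1 0 z ^+ 2 + E 1 1 z ^+ 2).

Lemma energy_ge0 E : 0 <= energy E.
Proof. by rewrite addr_ge0//; apply: Rint_ge0 => z; rewrite addr_ge0 ?sqr_ge0. Qed.

(** What the estimates use of a field of [V] and of its weak gradient. *)
Record mean0_field (e : 'I_2 -> plane -> R) (E : 'I_2 -> 'I_2 -> plane -> R) : Prop :=
  Mean0Field {
    mf_summable : forall i, summable nu (e i);
    mf_sq : forall i, summable nu (fun z => e i z ^+ 2);
    mf_mean : forall i, \int[nu]_z e i z = 0;
    mf_grad : forall i j, summable nu (fun z => E i j z ^+ 2);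
    mf_ac_line : forall i j, ac_line j (e i) (E i j) }.

Section Field.
Variables (e : 'I_2 -> plane -> R) (E : 'I_2 -> 'I_2 -> plane -> R).
Hypothesis eE : mean0_field e E.

Lemma mf_meas i : measurable_fun setT (e i).
Proof. exact: summable_measurable (mf_summable eE i). Qed.

Lemma mf_meas_grad i j : measurable_fun setT (E i j).
Proof. by have [] := mf_ac_line eE i j. Qed.

Lemma mf_p4 i : summable nu (fun z => e i z ^+ 4).
Proof. by have [] := L4_mean0 (mf_summable eE i) (mf_grad eE i) (mf_ac_line eE i) (mf_mean eE i). Qed.

Lemma meas_l1_vec : measurable_fun setT (fun z => l1_vec (e^~ z)).
Proof. by apply: measurable_funD; apply: measurableT_comp => //; exact: mf_meas. Qed.

Lemma meas_l1_mat : measurable_fun setT (fun z => l1_mat (fun i j => E i j z)).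
Proof.
by apply: measurable_funD; apply: measurable_funD; apply: measurableT_comp => //; exact: mf_meas_grad.
Qed.

Lemma p4_l1_vec : summable nu (fun z => l1_vec (e^~ z) ^+ 4).
Proof.
have h i : summable nu (fun z => `|e i z| ^+ 4).
  rewrite (_ : (fun _ => _) = (fun z => e i z ^+ 4)); first exact: mf_p4.
  by apply/funext => z; rewrite -normrX ger0_norm// (exprM _ 2 2) sqr_ge0.
by apply: summable_p4D => //; apply: measurableT_comp => //; exact: mf_meas.
Qed.

Lemma sq_l1_vec : summable nu (fun z => l1_vec (e^~ z) ^+ 2).
Proof.
have h i : summable nu (fun z => `|e i z| ^+ 2).
  rewrite (_ : (fun _ => _) = (fun z => e i z ^+ 2)); first exact: mf_sq eE i.
  by apply/funext => z; rewrite real_normK ?num_real.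
by apply: summable_sqD => //; apply: measurableT_comp => //; exact: mf_meas.
Qed.

Lemma sq_l1_mat : summable nu (fun z => l1_mat (fun i j => E i j z) ^+ 2).
Proof.
have mE i j : measurable_fun setT (fun z => `|E i j z|).
  by apply: measurableT_comp => //; exact: mf_meas_grad.
have h i j : summable nu (fun z => `|E i j z| ^+ 2).
  rewrite (_ : (fun _ => _) = (fun z => E i j z ^+ 2)); first exact: mf_grad eE i j.
  by apply/funext => z; rewrite real_normK ?num_real.
by apply: summable_sqD; [exact: measurable_funD|exact: measurable_funD|exact: summable_sqD|exact: summable_sqD].
Qed.

Lemma Rint_l1_mat_sq : \int[nu]_z (l1_mat (fun i j => E i j z) ^+ 2) <= 4 * energy E.
Proof.
have g i j := mf_grad eE i j.
rewrite /energy -RintD; [|exact: summableD|exact: summableD].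
rewrite -RintZ; last by apply: summableD; exact: summableD.
apply: ae_le_Rint; [exact: sq_l1_mat|by apply: summableZ; apply: summableD; exact: summableD|].
apply: aeW => z; rewrite /l1_mat.
rewrite -(real_normK (num_real (E 0 0 z))) -(real_normK (num_real (E 0 1 z))).
rewrite -(real_normK (num_real (E 1 0 z))) -(real_normK (num_real (E 1 1 z))).
move: `|E 0 0 z| `|E 0 1 z| `|E 1 0 z| `|E 1 1 z| => a b c d.
have := sqr_ge0 (a - b); have := sqr_ge0 (c - d); have := sqr_ge0 (a - c).
have := sqr_ge0 (a - d); have := sqr_ge0 (b - c); have := sqr_ge0 (b - d); nra.
Qed.

Lemma Rint_l1_vec_sq : \int[nu]_z (l1_vec (e^~ z) ^+ 2) <= 16 * pi ^+ 2 * energy E.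
Proof.
have g i := mf_sq eE i.
have P i := poincare_mean0 (mf_summable eE i) (mf_grad eE i) (mf_ac_line eE i) (mf_mean eE i) (g i).
apply: (@le_trans _ _ (2 * (\int[nu]_z (e 0 z ^+ 2) + \int[nu]_z (e 1 z ^+ 2)))).
  rewrite -RintD// -RintZ; last exact: summableD.
  apply: ae_le_Rint; [exact: sq_l1_vec|by apply: summableZ; exact: summableD|].
  apply: aeW => z; rewrite /l1_vec.
  rewrite -(real_normK (num_real (e 0 z))) -(real_normK (num_real (e 1 z))).
  by have := sqr_ge0 (`|e 0 z| - `|e 1 z|); nra.
have := P 0; have := P 1; rewrite /energy.
move: (\int[nu]_z (E 0 0 z ^+ 2 + _)) (\int[nu]_z (E 1 0 z ^+ 2 + _)) => a b.
move: (pi ^+ 2) => p; lra.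
Qed.

(** [L4_mean0] for each component. *)
Lemma Rint_l1_vec_p4 : \int[nu]_z ((e 0 z ^+ 2 + e 1 z ^+ 2) ^+ 2) <= (8 * pi * energy E) ^+ 2.
Proof.
have g i := mf_p4 i.
have P i := L4_mean0 (mf_summable eE i) (mf_grad eE i) (mf_ac_line eE i) (mf_mean eE i).
have [_ P0] := P 0; have [_ P1] := P 1.
apply: (@le_trans _ _ (2 * (\int[nu]_z (e 0 z ^+ 4) + \int[nu]_z (e 1 z ^+ 4)))).
  have s : summable nu (fun x => 2 * (e 0 x ^+ 4 + e 1 x ^+ 4)) by apply: summableZ; exact: summableD.
  have le z : (e 0 z ^+ 2 + e 1 z ^+ 2) ^+ 2 <= 2 * (e 0 z ^+ 4 + e 1 z ^+ 4).
    by rewrite !(exprM _ 2 2); have := sqr_ge0 (e 0 z ^+ 2 - e 1 z ^+ 2); nra.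
  rewrite -RintD// -RintZ; last exact: summableD.
  apply: ae_le_Rint => //; last exact: aeW.
  apply: (summable_le _ _ s).
    by apply: measurable_funX; apply: measurable_funD; apply: measurable_funX; exact: mf_meas.
  by move=> z; rewrite ger0_norm ?sqr_ge0//; apply: (le_trans (le z)); exact: ler_norm.
move: P0 P1; rewrite /energy.
have a0 : 0 <= \int[nu]_z (E 0 0 z ^+ 2 + E 0 1 z ^+ 2).
  by apply: Rint_ge0 => z; rewrite addr_ge0 ?sqr_ge0.
have b0 : 0 <= \int[nu]_z (E 1 0 z ^+ 2 + E 1 1 z ^+ 2).
  by apply: Rint_ge0 => z; rewrite addr_ge0 ?sqr_ge0.
move: (\int[nu]_z (E 0 0 z ^+ 2 + _)) (\int[nu]_z (E 1 0 z ^+ 2 + _)) a0 b0 => a b a0 b0.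
have -> : (4 * pi * a) ^+ 2 = 16 * (pi ^+ 2 * a ^+ 2) by ring.
have -> : (4 * pi * b) ^+ 2 = 16 * (pi ^+ 2 * b ^+ 2) by ring.
have -> : (8 * pi * (a + b)) ^+ 2 = 64 * (pi ^+ 2 * a ^+ 2) + 64 * (pi ^+ 2 * b ^+ 2) + 128 * (pi ^+ 2 * (a * b)) by ring.
have : 0 <= (pi : R) ^+ 2 * (a * b) by apply: mulr_ge0; [exact: sqr_ge0|exact: mulr_ge0].
have : 0 <= (pi : R) ^+ 2 * a ^+ 2 by apply: mulr_ge0; exact: sqr_ge0.
have : 0 <= (pi : R) ^+ 2 * b ^+ 2 by apply: mulr_ge0; exact: sqr_ge0.
move: (pi ^+ 2 * a ^+ 2) (pi ^+ 2 * b ^+ 2) (pi ^+ 2 * (a * b)) => x y z; lra.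
Qed.

End Field.
End Core.

(** * Integrating the identity *)

Section Estimate.
Context {R : realType}.
Local Notation circ := (@circ R).
Local Notation nu := (circ \x circ)%E.
Local Notation plane := (R * R)%type.
Variables (e u m : 'I_2 -> plane -> R) (E U W : 'I_2 -> 'I_2 -> plane -> R) (M : R).
Hypotheses (eE : mean0_field e E) (uU : mean0_field u U).
Hypotheses (mW : forall i j, ac_line j (m i) (W i j))
  (mm : {ae nu, forall z, m 0 z * m 0 z + m 1 z * m 1 z = 1})
  (M0 : 0 <= M) (WM : {ae nu, forall z, forall i j, `|W i j z| <= M})
  (dE : {ae nu, forall z, E 0 0 z + E 1 1 z = 0}).

Local Notation at1 v z := (fun i => v i z).
Local Notation at2 V z := (fun i j => V i j z).

(** Differentiate [|m|^2 = 1]. *)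
Lemma unit_orthogonal : {ae nu, forall z, forall j, pair (at1 m z) (fun i => W i j z) = 0}.
Proof.
have h j : {ae nu, forall z, pair (at1 m z) (fun i => W i j z) = 0}.
  have a := ac_line_add (ac_line_mul (mW 0 j) (mW 0 j)) (ac_line_mul (mW 1 j) (mW 1 j)).
  apply: filterS (ac_line_unique a (ac_line_cst j 1) mm) => z h.
  by rewrite /pair; lra.
by apply: filterS2 (h 0) (h 1) => z h0 h1 j; have [->|->] := ord2P j.
Qed.

Lemma unit_le1 : {ae nu, forall z, forall i, `|m i z| <= 1}.
Proof.
apply: filterS mm => z mz i.
suff : `|m i z| ^+ 2 <= 1 by rewrite expr_le1.
rewrite real_normK ?num_real//.
have [-> | ->] := ord2P i.
  by rewrite expr2 -mz lerDl -expr2 sqr_ge0.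
by rewrite expr2 -mz lerDr -expr2 sqr_ge0.
Qed.

Let r z := pair (at1 e z) (at1 m z).
Let s z := pair (at1 e z) (rot (at1 m z)).
Let Se z := l1_vec (at1 e z).
Let Su z := l1_vec (at1 u z).
Let SE z := l1_mat (at2 E z).
Let SU z := l1_mat (at2 U z).

Lemma ac_line_rot i j : ac_line j (fun z => rot (at1 m z) i) (fun z => drot (at2 W z) i j).
Proof.
rewrite /rot /drot; case: (i == 0) => //.
have -> : (fun z => - m 1 z) = (fun z => (-1) * m 1 z) by apply/funext => z; rewrite mulN1r.
have -> : (fun z => - W 1 j z) = (fun z => (-1) * W 1 j z) by apply/funext => z; rewrite mulN1r.
exact: ac_line_scale.
Qed.

Lemma ac_line_pair j : ac_line j r (fun z => dpair (at1 e z) (at1 m z) (at2 E z) (at2 W z) j).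
Proof.
exact: (ac_line_add (ac_line_mul (mf_ac_line eE 0 j) (mW 0 j)) (ac_line_mul (mf_ac_line eE 1 j) (mW 1 j))).
Qed.

Lemma sq_dpair j :
  summable nu (fun z => dpair (at1 e z) (at1 m z) (at2 E z) (at2 W z) j ^+ 2).
Proof.
have [_ md _] := ac_line_pair j.
have mSE := meas_l1_mat eE; have mSe := meas_l1_vec eE.
have dom := summable_sqD mSE (measurable_funM (measurable_cst M) mSe) (sq_l1_mat eE) _.
have h : summable nu (fun z => (cst M z * Se z) ^+ 2).
  rewrite (_ : (fun _ => _) = (fun z => M ^+ 2 * Se z ^+ 2)).
    by apply: summableZ; exact: (sq_l1_vec eE).
  by apply/funext => z; rewrite exprMn.
apply: (summable_ae_le (measurable_funX 2 md) _ (dom h)).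
apply: filterS2 unit_le1 WM => z m1 W1.
rewrite [leRHS]ger0_norm ?sqr_ge0// normrX ler_pXn2r ?nnegrE//; last first.
  apply: addr_ge0; first by rewrite !addr_ge0.
  by apply: mulr_ge0; [exact: le_trans (normr_ge0 _) (W1 0 0)|rewrite addr_ge0].
have hi i : `|E i j z * m i z + e i z * W i j z| <= `|E i j z| + M * `|e i z|.
  apply: (le_trans (ler_normD _ _)); rewrite !normrM; apply: lerD.
    by rewrite ler_piMr.
  by rewrite mulrC ler_wpM2r.
rewrite /dpair; apply: (le_trans (ler_normD _ _)); apply: (le_trans (lerD (hi 0) (hi 1))).
rewrite /l1_mat /l1_vec /=.
have : `|E 0 j z| <= `|E 0 0 z| + `|E 0 1 z| by have [->|->] := ord2P j; rewrite ?lerDl ?lerDr.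
have : `|E 1 j z| <= `|E 1 0 z| + `|E 1 1 z| by have [->|->] := ord2P j; rewrite ?lerDl ?lerDr.
lra.
Qed.

Lemma sq_pair : summable nu (fun z => r z ^+ 2).
Proof.
have [mr _ _] := ac_line_pair 0.
apply: (summable_ae_le (measurable_funX 2 mr) _ (sq_l1_vec eE)).
apply: filterS unit_le1 => z m1.
rewrite [leRHS]ger0_norm ?sqr_ge0// normrX ler_pXn2r ?nnegrE ?addr_ge0//.
apply: (le_trans (ler_normD _ _)); rewrite !normrM.
by apply: lerD; rewrite ler_piMr.
Qed.

Let X z := 1 + (Se z + Su z).
Let Y z := X z + (SE z + SU z).

Let Se0 z : 0 <= Se z. Proof. by rewrite addr_ge0. Qed.
Let Su0 z : 0 <= Su z. Proof. by rewrite addr_ge0. Qed.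
Let SE0 z : 0 <= SE z. Proof. by rewrite !addr_ge0. Qed.
Let SU0 z : 0 <= SU z. Proof. by rewrite !addr_ge0. Qed.
Let X1 z : 1 <= X z. Proof. by rewrite lerDl addr_ge0. Qed.
Let XY z : X z <= Y z. Proof. by rewrite lerDl addr_ge0. Qed.
Let X0 z : 0 <= X z. Proof. exact: le_trans (X1 z). Qed.

Lemma graded_field v V : mean0_field v V -> (forall z, l1_vec (at1 v z) <= X z) ->
  (forall z, l1_mat (at2 V z) <= Y z) -> forall i j, graded X Y j 1 (v i) (V i j).
Proof.
move=> vV vX VY i j; split; first exact: mf_ac_line vV i j.
exists 1 => //; apply: aeW => z; rewrite expr1 !mul1r; split.
  by apply: le_trans (vX z); rewrite /l1_vec; have [->|->] := ord2P i; rewrite ?lerDl ?lerDr.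
rewrite mulrC ler_wpM2l//; apply: le_trans (VY z); rewrite /l1_mat.
have a0 k l : 0 <= `|V k l z| by [].
by have [->|->] := ord2P i; have [->|->] := ord2P j; have := a0 0 0; have := a0 0 1; have := a0 1 0; have := a0 1 1; lra.
Qed.

Lemma graded_bounded f f' (C : R) j : ac_line j f f' ->
  {ae nu, forall z, `|f z| <= 1 /\ `|f' z| <= C} -> graded X Y j 0 f f'.
Proof.
move=> a h; split=> //; exists (1 + `|C|); first by rewrite addr_ge0.
apply: filterS h => z [h1 h2]; rewrite expr0 mulr1; split.
  by rewrite (le_trans h1)// lerDl.
apply: ler_pM => //; apply: (le_trans h2); apply: (le_trans (ler_norm _)).
by rewrite lerDr.
Qed.

Let ge i j : graded X Y j 1 (e i) (E i j).
Proof.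
apply: graded_field => // z; first by rewrite /X -/(Se z); have := Su0 z; lra.
by rewrite /Y -/(SE z); have := X0 z; have := SU0 z; lra.
Qed.

Let gu i j : graded X Y j 1 (u i) (U i j).
Proof.
apply: graded_field => // z; first by rewrite /X -/(Su z); have := Se0 z; lra.
by rewrite /Y -/(SU z); have := X0 z; have := SE0 z; lra.
Qed.

Let gm i j : graded X Y j 0 (m i) (W i j).
Proof. by apply: (@graded_bounded _ _ M) => //; apply: filterS2 unit_le1 WM. Qed.

Let gn i j : graded X Y j 0 (fun z => rot (at1 m z) i) (fun z => drot (at2 W z) i j).
Proof.
apply: (@graded_bounded _ _ M); first exact: ac_line_rot.
apply: filterS2 unit_le1 WM => z m1 W1; rewrite /rot /drot.
by case: ifP => _; rewrite ?normrN.
Qed.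

(** The flux is cubic: each of [r], [s] and [w] has degree one, and the
    components of [m] and [n] have degree zero. *)
Lemma graded_flux j : graded X Y j 3 (fun z => flux (at1 e z) (at1 u z) (at1 m z) j)
  (fun z => dflux (at1 e z) (at1 u z) (at1 m z) (at2 E z) (at2 U z) (at2 W z) j).
Proof.
have gr : graded X Y j 1 r (fun z => dpair (at1 e z) (at1 m z) (at2 E z) (at2 W z) j).
  exact: (gradedD X1 (gradedM X1 (ge 0 j) (gm 0 j)) (gradedM X1 (ge 1 j) (gm 1 j))).
have gs : graded X Y j 1 s
    (fun z => dpair (at1 e z) (rot (at1 m z)) (at2 E z) (drot (at2 W z)) j).
  exact: (gradedD X1 (gradedM X1 (ge 0 j) (gn 0 j)) (gradedM X1 (ge 1 j) (gn 1 j))).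
have gw : graded X Y j 1 (fun z => pair (at1 u z) (rot (at1 m z)))
    (fun z => dpair (at1 u z) (rot (at1 m z)) (at2 U z) (drot (at2 W z)) j).
  exact: (gradedD X1 (gradedM X1 (gu 0 j) (gn 0 j)) (gradedM X1 (gu 1 j) (gn 1 j))).
have g1 := gradedM X1 (gradedM X1 gs gs) (gradedM X1 gw (gn j j)).
have g2 := gradedZ 2 (gradedM X1 (gradedM X1 gr (gm j j)) (gradedM X1 gs gw)).
exact: (gradedD X1 g1 g2).
Qed.

Let mX : measurable_fun setT X.
Proof. by apply: measurable_funD => //; apply: measurable_funD; [exact: meas_l1_vec eE|exact: meas_l1_vec uU]. Qed.

Let mY : measurable_fun setT Y.
Proof.
apply: measurable_funD => //; apply: measurable_funD; [exact: meas_l1_mat eE|exact: meas_l1_mat uU].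
Qed.

Let X4 : summable nu (fun z => X z ^+ 4).
Proof.
have mS := measurable_funD (meas_l1_vec eE) (meas_l1_vec uU).
have S4 := summable_p4D (meas_l1_vec eE) (meas_l1_vec uU) (p4_l1_vec eE) (p4_l1_vec uU).
exact: (summable_p4D (measurable_cst (1 : R)) mS (summable_cst (1 ^+ 4) nu_lty) S4).
Qed.

Let Y2 : summable nu (fun z => Y z ^+ 2).
Proof.
have mS := measurable_funD (meas_l1_vec eE) (meas_l1_vec uU).
have mG := measurable_funD (meas_l1_mat eE) (meas_l1_mat uU).
have S2 := summable_sqD (meas_l1_vec eE) (meas_l1_vec uU) (sq_l1_vec eE) (sq_l1_vec uU).
have G2 := summable_sqD (meas_l1_mat eE) (meas_l1_mat uU) (sq_l1_mat eE) (sq_l1_mat uU).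
have X2 := summable_sqD (measurable_cst (1 : R)) mS (summable_cst (1 ^+ 2) nu_lty) S2.
exact: (summable_sqD mX mG X2 G2).
Qed.

Lemma Rint_flux j :
  let d z := dflux (at1 e z) (at1 u z) (at1 m z) (at2 E z) (at2 U z) (at2 W z) j in
  summable nu d /\ \int[nu]_z d z = 0.
Proof. exact: (graded_int0 X1 mX mY X4 Y2 (graded_flux j)). Qed.

Let b z := inertia (at1 e z) (at2 U z).
Let D z := pair (at1 u z) (defect (at1 m z) (at2 W z)).
Let rest z := remainder (at1 e z) (at1 u z) (at1 m z) (at2 E z) (at2 U z) (at2 W z).
Let Q z := 2 * (SE z * Su z) + 5 * (SU z * Se z) + 8 * M * (Se z * Su z).

Let mb : measurable_fun setT b.
Proof.
have me i := mf_meas eE i; have mU i j := mf_meas_grad uU i j.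
rewrite /b /inertia; under eq_fun do rewrite !big_ord_recl !big_ord0.
have h i j : measurable_fun setT (fun z => e j z * U i j z * e i z).
  by apply: measurable_funM => //; exact: measurable_funM.
by repeat apply: measurable_funD.
Qed.

(** Integrate [shear_identity]; the two flux terms integrate to zero. *)
Lemma inertia_le (F G : plane -> R) : summable nu F -> summable nu G ->
  {ae nu, forall z, s z ^+ 2 * `|D z| <= F z} ->
  {ae nu, forall z, `|r z| * Q z <= G z} ->
  `|\int[nu]_z b z| <= \int[nu]_z F z + \int[nu]_z G z.
Proof.
move=> Fi Gi hF hG.
pose d0 z := dflux (at1 e z) (at1 u z) (at1 m z) (at2 E z) (at2 U z) (at2 W z) 0.
pose d1 z := dflux (at1 e z) (at1 u z) (at1 m z) (at2 E z) (at2 U z) (at2 W z) 1.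
have [i0 f0] : summable nu d0 /\ \int[nu]_z d0 z = 0 by exact: Rint_flux.
have [i1 f1] : summable nu d1 /\ \int[nu]_z d1 z = 0 by exact: Rint_flux.
have di : summable nu (fun z => d0 z + d1 z) by exact: summableD.
have le : {ae nu, forall z, `|b z - (d0 z + d1 z)| <= F z + G z}.
  near=> z.
  have mmz : m 0 z * m 0 z + m 1 z * m 1 z = 1 by near: z.
  have dEz : E 0 0 z + E 1 1 z = 0 by near: z.
  have uo : forall j, pair (at1 m z) (fun i => W i j z) = 0 by near: z; exact: unit_orthogonal.
  have WMz : forall i j, `|W i j z| <= M by near: z.
  have Fz : s z ^+ 2 * `|D z| <= F z by near: z.
  have Gz : `|r z| * Q z <= G z by near: z.
  rewrite /b (@shear_identity _ (at1 e z) (at1 u z) (at1 m z) (at2 E z) (at2 U z) (at2 W z) mmz dEz uo) -/(d0 z) -/(d1 z).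
  rewrite -/(D z) -/(s z) -/(r z) -/(rest z).
  have -> : d0 z + d1 z - s z ^+ 2 * D z + r z * rest z - (d0 z + d1 z) = - (s z ^+ 2 * D z) + r z * rest z by ring.
  apply: (le_trans (ler_normD _ _)); rewrite normrN (normrM (s z ^+ 2)) (normrM (r z)) (ger0_norm (sqr_ge0 (s z))).
  apply: lerD => //; apply: le_trans Gz; apply: ler_wpM2l => //.
  exact: remainder_le.
have FG := summableD Fi Gi.
have bi : summable nu (fun z => b z - (d0 z + d1 z)).
  apply: (summable_ae_le _ _ FG); first exact: measurable_funB mb (summable_measurable di).
  by apply: filterS le => z h; exact: le_trans h (ler_norm _).
have -> : \int[nu]_z b z = \int[nu]_z (b z - (d0 z + d1 z)).
  have -> : \int[nu]_z b z = \int[nu]_z ((b z - (d0 z + d1 z)) + (d0 z + d1 z)).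
    by apply: eq_Rint => z; rewrite subrK.
  by rewrite (RintD bi di) (RintD i0 i1) f0 f1 !addr0.
by rewrite -RintD//; exact: norm_Rint_le.
Unshelve. all: by end_near. Qed.

Let mr : measurable_fun setT r. Proof. by have [] := ac_line_pair 0. Qed.

Lemma pair_le_l1_vec : {ae nu, forall z, `|r z| <= Se z}.
Proof.
apply: filterS unit_le1 => z m1; apply: (le_trans (ler_normD _ _)); rewrite !normrM.
by apply: lerD; rewrite ler_piMr.
Qed.

Lemma p4_pair : summable nu (fun z => r z ^+ 4).
Proof.
apply: (summable_ae_le (measurable_funX 4 mr) _ (p4_l1_vec eE)).
apply: filterS pair_le_l1_vec => z h; rewrite !normrX.
by rewrite ler_pXn2r ?nnegrE//; apply: (le_trans h); exact: ler_norm.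
Qed.

Lemma sq_pairM v V : mean0_field v V -> forall i, summable nu (fun z => r z ^+ 2 * v i z ^+ 2).
Proof.
move=> vV i; have sq (h : plane -> R) : (fun z => (h z ^+ 2) ^+ 2) = (fun z => h z ^+ 4).
  by apply/funext => z; rewrite -exprM.
apply: (summable_sqM (measurable_funX 2 mr) (measurable_funX 2 (mf_meas vV i))).
  by rewrite sq; exact: p4_pair.
by rewrite sq; exact: mf_p4 vV i.
Qed.

Lemma sq_pair_l1_vec v V : mean0_field v V ->
  summable nu (fun z => (`|r z| * l1_vec (at1 v z)) ^+ 2) /\
  \int[nu]_z ((`|r z| * l1_vec (at1 v z)) ^+ 2) <=
  2 * (\int[nu]_z (r z ^+ 2 * v 0 z ^+ 2) + \int[nu]_z (r z ^+ 2 * v 1 z ^+ 2)).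
Proof.
move=> vV; have h := sq_pairM vV; have hD := summableZ 2 (summableD (h 0) (h 1)).
have le z : (`|r z| * l1_vec (at1 v z)) ^+ 2 <= 2 * (r z ^+ 2 * v 0 z ^+ 2 + r z ^+ 2 * v 1 z ^+ 2).
  have -> : 2 * (r z ^+ 2 * v 0 z ^+ 2 + r z ^+ 2 * v 1 z ^+ 2) = r z ^+ 2 * (2 * (v 0 z ^+ 2 + v 1 z ^+ 2)) by ring.
  rewrite /l1_vec exprMn real_normK ?num_real//; apply: ler_wpM2l; first exact: sqr_ge0.
  rewrite -(real_normK (num_real (v 0 z))) -(real_normK (num_real (v 1 z))).
  by have := sqr_ge0 (`|v 0 z| - `|v 1 z|); nra.
have i1 : summable nu (fun z => (`|r z| * l1_vec (at1 v z)) ^+ 2).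
  apply: (summable_le _ _ hD).
    apply: measurable_funX; apply: measurable_funM; last exact: meas_l1_vec vV.
    exact: measurableT_comp.
  by move=> z; rewrite ger0_norm ?sqr_ge0//; apply: (le_trans (le z)); exact: ler_norm.
split => //; rewrite -RintD// -RintZ; last exact: summableD.
by apply: ae_le_Rint => //; exact: aeW.
Qed.

(** [kappa] stands for the norm of multiplication by [r] from [H^1] to [L^2].
    Leaving it open treats the logarithmic bound and the case [r = 0] at once.
    *)
Lemma inertia_bound (alpha kappa : R) : 0 <= alpha -> 0 <= kappa ->
  {ae nu, forall z, Num.sqrt (defect (at1 m z) (at2 W z) 0 ^+ 2
                              + defect (at1 m z) (at2 W z) 1 ^+ 2) <= alpha} ->
  \int[nu]_z ((`|r z| * Se z) ^+ 2) <= kappa ^+ 2 * energy E ->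
  \int[nu]_z ((`|r z| * Su z) ^+ 2) <= kappa ^+ 2 * energy U ->
  `|\int[nu]_z b z| <=
   8 * pi * (alpha * Num.sqrt (\int[nu]_z (u 0 z ^+ 2) + \int[nu]_z (u 1 z ^+ 2))) * energy E
   + (14 + 32 * pi * M) * (Num.sqrt (energy U) * Num.sqrt (energy E) * kappa).
Proof.
move=> al0 k0 hal kE kU.
have EE := energy_ge0 E; have EU := energy_ge0 U.
have pi0 := @pi_ge0 R.
have mre : measurable_fun setT (fun z => `|r z|) by exact: measurableT_comp.
have mSe := meas_l1_vec eE; have mSu := meas_l1_vec uU.
have mSE := meas_l1_mat eE; have mSU := meas_l1_mat uU.
have [re2 _] := sq_pair_l1_vec eE; have [ru2 _] := sq_pair_l1_vec uU.
have sE : energy E = Num.sqrt (energy E) ^+ 2 by rewrite sqr_sqrtr.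
have sU : energy U = Num.sqrt (energy U) ^+ 2 by rewrite sqr_sqrtr.
have qE := sqrtr_ge0 (energy E); have qU := sqrtr_ge0 (energy U).
set gE := Num.sqrt (energy E) in sE qE *; set gU := Num.sqrt (energy U) in sU qU *.
have mR1 := measurable_funM mre mSe; have mR2 := measurable_funM mre mSu.
have B1 : \int[nu]_z `|SE z * (`|r z| * Su z)| <= (2 * gE) * (kappa * gU).
  apply: cauchy_schwarz_le => //; [exact: sq_l1_mat eE|exact: mulr_ge0|exact: mulr_ge0| |].
    by rewrite exprMn -sE; apply: (le_trans (Rint_l1_mat_sq eE)); rewrite expr2 -natrM.
  by rewrite exprMn -sU.
have B2 : \int[nu]_z `|SU z * (`|r z| * Se z)| <= (2 * gU) * (kappa * gE).
  apply: cauchy_schwarz_le => //; [exact: sq_l1_mat uU|exact: mulr_ge0|exact: mulr_ge0| |].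
    by rewrite exprMn -sU; apply: (le_trans (Rint_l1_mat_sq uU)); rewrite expr2 -natrM.
  by rewrite exprMn -sE.
have B3 : \int[nu]_z `|Su z * (`|r z| * Se z)| <= (4 * pi * gU) * (kappa * gE).
  apply: cauchy_schwarz_le => //; [exact: sq_l1_vec uU|by rewrite !mulr_ge0|exact: mulr_ge0| |].
    rewrite exprMn -sU; apply: (le_trans (Rint_l1_vec_sq uU)).
    by apply: eq_lexx; ring.
  by rewrite exprMn -sE.
have i1 := summable_sqM mSE mR2 (sq_l1_mat eE) ru2.
have i2 := summable_sqM mSU mR1 (sq_l1_mat uU) re2.
have i3 := summable_sqM mSu mR1 (sq_l1_vec uU) re2.
have n1 := integrable_norm i1; have n2 := integrable_norm i2; have n3 := integrable_norm i3.
have Gi : summable nu (fun z => 2 * `|SE z * (`|r z| * Su z)| + 5 * `|SU z * (`|r z| * Se z)|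
    + 8 * M * `|Su z * (`|r z| * Se z)|).
  by apply: summableD; [apply: summableD|]; apply: summableZ.
have u2 i := mf_sq uU i.
have mu i := mf_meas uU i; have me i := mf_meas eE i.
pose nu2 z := Num.sqrt (u 0 z ^+ 2 + u 1 z ^+ 2).
have nu2sq : (fun z => nu2 z ^+ 2) = (fun z => u 0 z ^+ 2 + u 1 z ^+ 2).
  by apply/funext => z; rewrite sqr_sqrtr// addr_ge0 ?sqr_ge0.
have mnu2 : measurable_fun setT nu2.
  apply: measurableT_comp; first exact: (continuous_measurable_fun (@sqrt_continuous R)).
  by apply: measurable_funD; apply: measurable_funX.
pose e2 z := e 0 z ^+ 2 + e 1 z ^+ 2.
have me2 : measurable_fun setT e2 by apply: measurable_funD; apply: measurable_funX.
have e4 : summable nu (fun z => e2 z ^+ 2).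
  apply: (summable_le _ _ (p4_l1_vec eE)); first exact: measurable_funX.
  move=> z; rewrite !ger0_norm ?sqr_ge0//; last by rewrite (exprM _ 2 2) sqr_ge0.
  rewrite (exprM _ 2 2) ler_pXn2r ?nnegrE ?sqr_ge0// ?addr_ge0 ?sqr_ge0//.
  rewrite /e2 /l1_vec -(real_normK (num_real (e 0 z))) -(real_normK (num_real (e 1 z))).
  have := mulr_ge0 (normr_ge0 (e 0 z)) (normr_ge0 (e 1 z)).
  move=> /(mulr_ge0 (ler0n R 2)) h; rewrite -subr_ge0; apply: (le_trans h).
  by apply: eq_lexx; ring.
have nu2i : summable nu (fun z => nu2 z ^+ 2) by rewrite nu2sq; exact: summableD.
have I4 := summable_sqM me2 mnu2 e4 nu2i.
have u20 : 0 <= \int[nu]_z (u 0 z ^+ 2) + \int[nu]_z (u 1 z ^+ 2).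
  by apply: addr_ge0; apply: Rint_ge0 => z; exact: sqr_ge0.
have B4 : \int[nu]_z `|e2 z * nu2 z| <= (8 * pi * energy E) *
    Num.sqrt (\int[nu]_z (u 0 z ^+ 2) + \int[nu]_z (u 1 z ^+ 2)).
  apply: cauchy_schwarz_le => //; [by rewrite !mulr_ge0|exact: Rint_l1_vec_p4 eE|].
  by rewrite nu2sq RintD// sqr_sqrtr.
have Fi := summableZ alpha (integrable_norm I4).
have hF : {ae nu, forall z, s z ^+ 2 * `|D z| <= alpha * `|e2 z * nu2 z|}.
  apply: filterS2 mm hal => z mz az.
  have s2 : s z ^+ 2 <= e2 z.
    rewrite /s /e2 /pair /rot /=.
    have -> : e 0 z ^+ 2 + e 1 z ^+ 2 = (e 0 z ^+ 2 + e 1 z ^+ 2) * (m 0 z * m 0 z + m 1 z * m 1 z) by rewrite mz mulr1.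
    rewrite -subr_ge0; apply: le_trans (sqr_ge0 (e 0 z * m 0 z + e 1 z * m 1 z)) _.
    by apply: eq_lexx; ring.
  have d2 : `|D z| <= nu2 z * alpha.
    apply: (le_trans _ (ler_wpM2l (sqrtr_ge0 _) az)).
    rewrite /nu2 -sqrtrM ?addr_ge0 ?sqr_ge0// -sqrtr_sqr ler_sqrt ?mulr_ge0 ?addr_ge0 ?sqr_ge0//.
    rewrite /D /pair; move: (defect _ _ 0) (defect _ _ 1) (u 0 z) (u 1 z) => a c x y.
    rewrite -subr_ge0; apply: le_trans (sqr_ge0 (x * c - y * a)) _.
    by apply: eq_lexx; ring.
  have e20 : 0 <= e2 z by rewrite addr_ge0 ?sqr_ge0.
  rewrite [`|e2 z * _|]ger0_norm ?mulr_ge0 ?sqrtr_ge0//.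
  have -> : alpha * (e2 z * nu2 z) = e2 z * (nu2 z * alpha) by ring.
  by apply: ler_pM => //; exact: sqr_ge0.
have hG : {ae nu, forall z, `|r z| * Q z <= 2 * `|SE z * (`|r z| * Su z)|
    + 5 * `|SU z * (`|r z| * Se z)| + 8 * M * `|Su z * (`|r z| * Se z)|}.
  apply: aeW => z; have n x y : 0 <= x -> 0 <= y -> `|x * (`|r z| * y)| = x * (`|r z| * y).
    by move=> x0 y0; rewrite ger0_norm// !mulr_ge0.
  rewrite !n//; by rewrite /Q; apply: eq_lexx; ring.
apply: (le_trans (inertia_le Fi Gi hF hG)).
apply: lerD.
  rewrite RintZ; last exact: integrable_norm.
  apply: (le_trans (ler_wpM2l al0 B4)).
  by apply: eq_lexx; ring.
rewrite RintD; [|by apply: summableD; apply: summableZ|exact: summableZ].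
rewrite RintD; [|exact: summableZ|exact: summableZ].
rewrite !RintZ//.
have := ler_wpM2l (ler0n R 2) B1; have := ler_wpM2l (ler0n R 5) B2.
have := ler_wpM2l (mulr_ge0 (ler0n R 8) M0) B3.
move: (\int[nu]_z `|SE z * (`|r z| * Su z)|) (\int[nu]_z `|SU z * (`|r z| * Se z)|)
  (\int[nu]_z `|Su z * (`|r z| * Se z)|) => x1 x2 x3 h3 h2 h1.
apply: (le_trans (lerD (lerD h1 h2) h3)).
by apply: eq_lexx; ring.
Qed.

End Estimate.

Section Final.
Context {R : realType}.
Local Notation circ := (@circ R).
Local Notation nu := (circ \x circ)%E.
Local Notation plane := (R * R)%type.

Lemma Rint_sq_eq0 (f : plane -> R) : measurable_fun setT f ->
  summable nu (fun z => f z ^+ 2) -> \int[nu]_z (f z ^+ 2) = 0 ->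
  {ae nu, forall z, f z = 0}.
Proof.
move=> mf f2 f0.
have mf2 : measurable_fun setT (EFin \o (fun z => f z ^+ 2)).
  by apply/measurable_EFinP; exact: measurable_funX.
have : (\int[nu]_z `|(EFin \o (fun z => (f z ^+ 2)%R)) z| = 0)%E.
  rewrite -[RHS]/(0%:E) -f0 -(RintE f2); apply: eq_integral => z _ /=.
  by rewrite ger0_norm ?sqr_ge0.
move=> /(ae_eq_integral_abs nu measurableT mf2); apply: filterS => z /(_ I) /= [/eqP].
by rewrite sqrf_eq0 => /eqP.
Qed.

Variables (e u m : 'I_2 -> plane -> R) (E U W : 'I_2 -> 'I_2 -> plane -> R) (M : R).
Hypotheses (eE : mean0_field e E) (uU : mean0_field u U).
Hypotheses (mW : forall i j, ac_line j (m i) (W i j))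
  (mm : {ae nu, forall z, m 0 z * m 0 z + m 1 z * m 1 z = 1})
  (M0 : 0 <= M) (WM : {ae nu, forall z, forall i j, `|W i j z| <= M})
  (dE : {ae nu, forall z, E 0 0 z + E 1 1 z = 0}).

Local Notation at1 v z := (fun i => v i z).
Local Notation at2 V z := (fun i j => V i j z).
Let r z := pair (at1 e z) (at1 m z).
Let dr j z := dpair (at1 e z) (at1 m z) (at2 E z) (at2 W z) j.
Let a := \int[nu]_z (r z ^+ 2).
Let Lam := if a == 0 then 1 else
  1 + ln (1 + (a + \int[nu]_z (dr 0 z ^+ 2 + dr 1 z ^+ 2)) / a).

Definition log_cst : R := 2 * (384 + 96 * pi ^+ 2).

Lemma log_cst_ge0 : 0 <= log_cst.
Proof.
apply: mulr_ge0; [exact: ler0n|apply: addr_ge0; [exact: ler0n|]].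
by apply: mulr_ge0; [exact: ler0n|exact: sqr_ge0].
Qed.
Let a0 : 0 <= a. Proof. by apply: Rint_ge0 => z; exact: sqr_ge0. Qed.

Let Lam0 : 0 <= Lam.
Proof.
rewrite /Lam; case: ifP => // _; rewrite addr_ge0// ln_ge0// lerDl divr_ge0// addr_ge0//.
by apply: Rint_ge0 => z; rewrite addr_ge0 ?sqr_ge0.
Qed.

Let kappa := Num.sqrt (log_cst * a * Lam).

Let kappa_sq : kappa ^+ 2 = log_cst * a * Lam.
Proof.
have h : 0 <= log_cst * a * Lam by apply: mulr_ge0 => //; apply: mulr_ge0 => //; exact: log_cst_ge0.
by rewrite /kappa sqr_sqrtr.
Qed.

Transparent log_cst.
(** [log_product] for each component if [r] is not zero; otherwise the
    left-hand side vanishes. *)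
Lemma pair_l1_vec_le v V : mean0_field v V ->
  \int[nu]_z ((`|r z| * l1_vec (at1 v z)) ^+ 2) <= kappa ^+ 2 * energy V.
Proof.
move=> vV; have [_ h] := sq_pair_l1_vec eE mW mm vV; apply: (le_trans h).
have mr : measurable_fun setT r by have [] := ac_line_pair eE mW 0.
have r2 : summable nu (fun z => r z ^+ 2) by exact: sq_pair eE mW mm.
rewrite kappa_sq /Lam; have [az|an] := eqVneq a 0.
  have r0 := Rint_sq_eq0 mr r2 az.
  have z0 i : \int[nu]_z (r z ^+ 2 * v i z ^+ 2) = 0.
    rewrite -(Rint0 nu); apply: ae_eq_Rint => //.
      by apply: measurable_funM; apply: measurable_funX => //; exact: mf_meas vV i.
    by apply: filterS r0 => z ->; rewrite expr0n mul0r.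
  by rewrite -!/(r _) !z0 addr0 mulr0 az mulr0 !mul0r.
have ap : 0 < a by rewrite lt_def an.
have P i := log_product (mf_summable vV i) (mf_grad vV i) (mf_ac_line vV i) (mf_mean vV i)
  (sq_dpair eE mW mm WM) (ac_line_pair eE mW) r2 ap.
have := lerD (P 0) (P 1); rewrite -mulrDr => /(ler_wpM2l (ler0n R 2)) /le_trans; apply.
rewrite /energy /log_cst -/a !mulrA.
by apply: lexx.
Qed.

Opaque log_cst.
(** The estimate for component functions with given derivatives on lines. *)
Lemma shear_estimate (alpha : R) : 0 <= alpha ->
  {ae nu, forall z, Num.sqrt (defect (at1 m z) (at2 W z) 0 ^+ 2
                              + defect (at1 m z) (at2 W z) 1 ^+ 2) <= alpha} ->
  `|\int[nu]_z inertia (at1 e z) (at2 U z)| <=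
   8 * pi * (alpha * Num.sqrt (\int[nu]_z (u 0 z ^+ 2) + \int[nu]_z (u 1 z ^+ 2))) * energy E
   + (14 + 32 * pi * M) * Num.sqrt log_cst *
     (Num.sqrt (energy U) * Num.sqrt (energy E) * Num.sqrt a * Num.sqrt Lam).
Proof.
move=> al0 hal.
have := inertia_bound eE uU mW mm M0 WM dE al0 (sqrtr_ge0 _) hal
  (pair_l1_vec_le eE) (pair_l1_vec_le uU).
move=> /le_trans; apply; rewrite lerD2l /kappa.
rewrite sqrtrM; last by apply: mulr_ge0 => //; exact: log_cst_ge0.
rewrite (sqrtrM _ log_cst_ge0).
by apply: eq_lexx; ring.
Qed.

End Final.

(** * Norms and weak derivatives *)

Section Weak.
Context {R : realType}.
Local Notation circ := (@circ R).
Local Notation nu := (circ \x circ)%E.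
Local Notation plane := (R * R)%type.
Implicit Types (f g phi : plane -> R) (j : 'I_2).

Lemma L2norm_sq f : measurable_fun setT f -> L2norm f ^+ 2 = \int[nu]_z (f z ^+ 2).
Proof.
move=> mf; have i0 : 0 <= \int[nu]_z (f z ^+ 2) by apply: Rint_ge0 => z; exact: sqr_ge0.
rewrite /L2norm unlock fine_poweR.
have -> : (\int[torus_measure T2]_x `|(EFin \o f) x| `^ 2)%E
    = (\int[torus_measure T2]_x (f x ^+ 2)%:E)%E.
  by apply: eq_integral => z _ /=; rewrite powR_mulrn// real_normK ?num_real.
have -> : fine (\int[torus_measure T2]_x (f x ^+ 2)%:E)%E = \int[nu]_z (f z ^+ 2).
  by rewrite -(Rintegral_torusE (measurable_funX 2 mf)).
by rewrite powR12_sqrt// sqr_sqrtr.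
Qed.

Lemma L2norm_ge0 f : 0 <= L2norm f.
Proof. by rewrite /L2norm fine_ge0// Lnorm_ge0. Qed.

Lemma Lfun_measurable p f : f \in Lfun (torus_measure T2) p -> measurable_fun setT f.
Proof. by rewrite inE => /andP[/[!inE]]. Qed.

Lemma memLp2_sq f : memLp T2 2%:E f -> measurable_fun setT f /\ summable nu (fun z => f z ^+ 2).
Proof.
move=> [_ f2]; split; first exact: Lfun_measurable f2.
exact/integrable_torusE/Lfun2_integrable_sqr.
Qed.

(** A weak derivative is the derivative on lines, hence unique up to a null
    set; the choice made by [weak_partial] is immaterial. *)
Lemma weak_partialP j f g : is_weak_partial T2 j f g ->
  is_weak_partial T2 j f (weak_partial T2 j f) /\
  {ae nu, forall z, weak_partial T2 j f z = g z}.
Proof.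
move=> fg; have w : is_weak_partial T2 j f (weak_partial T2 j f).
  by rewrite /weak_partial; case: xgetP => [h -> //|/(_ g)] /(_ fg).
split => //; apply: (ac_line_unique (weak_partial_ac_line w) (weak_partial_ac_line fg)); exact: aeW.
Qed.

(** The cell of the torus is contained in a compact square. *)
Lemma continuous_ae_bounded phi : continuous phi ->
  exists C, {ae nu, forall z, `|phi z| <= C}.
Proof.
move=> cphi; pose K := (`[0, 2 * pi] `*` `[0, 2 * pi] : set plane)%classic.
have cK : compact K by apply: compact_setX; exact: segment_compact.
have : compact (phi @` K) by apply: continuous_compact => //; exact: continuous_subspaceT.
move=> /compact_bounded [C [_ HC]]; exists (C + 1).
apply: filterS ae_whole => z h; apply: HC; first by rewrite ltrDl.
exists z => //; move: h; rewrite /chiQ /chi /= !add0r.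
move=> h; split; rewrite /= in_itv /=.
  case: (boolP (0 <= z.1 < 2 * pi)) h => [/andP[-> /ltW ->] //|_ /eqP].
  by rewrite mul0r eq_sym oner_eq0.
case: (boolP (0 <= z.2 < 2 * pi)) h => [/andP[-> /ltW ->] //|_ /eqP].
by rewrite mulr0 eq_sym oner_eq0.
Qed.

Lemma summable_continuousM f phi : continuous phi -> summable nu f ->
  summable nu (fun z => f z * phi z).
Proof.
move=> cphi fi; have [C bC] := continuous_ae_bounded cphi.
have mphi := continuous_plane_measurable cphi.
apply: (summable_ae_le _ _ (summableZ C fi)).
  by apply: measurable_funM => //; exact: summable_measurable fi.
apply: filterS bC => z bz; rewrite mulrC !normrM ler_wpM2r//.
exact: le_trans bz (ler_norm _).
Qed.

(** Integrate the derivative of the product with a test function. *)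
Lemma ac_line_weak j f g : lattice_periodic T2 f -> lattice_periodic T2 g ->
  summable nu f -> summable nu g -> ac_line j f g -> is_weak_partial T2 j f g.
Proof.
move=> pf pg fi gi fg; split; [exact: summable_memLp1|exact: summable_memLp1|].
move=> phi sphi pphi.
have cphi := smooth_continuous sphi; have cd := smooth_continuous (smooth_partial j sphi).
have mphi := continuous_plane_measurable cphi; have md := continuous_plane_measurable cd.
have mf := summable_measurable fi; have mg := summable_measurable gi.
have i1 := summable_continuousM cphi gi; have i2 := summable_continuousM cd fi.
rewrite !Rintegral_torusE; [|exact: measurable_funM..].
have := ac_line_int0 (ac_line_mul fg (smooth_ac_line j sphi pphi)) (summableD i1 i2).
by rewrite (RintD i1 i2) => /eqP; rewrite addr_eq0 => /eqP ->; rewrite opprK.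
Qed.

End Weak.

(** * Fields of the space V *)

Opaque weak_partial.

Section Spaces.
Context {R : realType}.
Local Notation circ := (@circ R).
Local Notation nu := (circ \x circ)%E.
Local Notation plane := (R * R)%type.
Implicit Types (f g phi : plane -> R) (j : 'I_2) (e u m : plane -> plane).

Definition comps u (i : 'I_2) : plane -> R := cmp i \o u.
Definition grads u (i j : 'I_2) : plane -> R := weak_partial T2 j (cmp i \o u).

Lemma big_ord2 (V : nmodType) (F : 'I_2 -> V) : \sum_(i < 2) F i = F 0 + F 1.
Proof.
rewrite !big_ord_recl big_ord0 /= addr0; congr (F _ + F _); exact/val_inj.
Qed.

Lemma sobolev1_grad f j : sobolev T2 2%:E 1 f ->
  is_weak_partial T2 j f (weak_partial T2 j f) /\
  summable nu (fun z => weak_partial T2 j f z ^+ 2).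
Proof.
move=> [_ /(_ j) [g fg [/memLp2_sq [mg g2] _]]]; have [w wg] := weak_partialP fg; split => //.
have [_ mw _] := weak_partial_ac_line w.
apply: (ae_summable (measurable_funX 2 mw) _ g2).
by apply: filterS wg => z ->.
Qed.

Lemma inV_weak u i j : inV u -> is_weak_partial T2 j (comps u i) (grads u i j).
Proof. by move=> [/(_ i) h _]; have [] := sobolev1_grad j h. Qed.

Lemma inV_field u : inV u -> mean0_field (comps u) (grads u).
Proof.
move=> uV; have [sob [mem _ mean]] := uV.
have h i := memLp2_sq (mem i).
have s i : summable nu (comps u i) by have [m1 m2] := h i; exact: nu_sq_summable.
split => //.
- by move=> i; have [] := h i.
- by move=> i; rewrite -(mean i) Rintegral_torusE//; have [] := h i.
- by move=> i j; have [] := sobolev1_grad j (sob i).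
- by move=> i j; apply: weak_partial_ac_line; exact: inV_weak.
Qed.

(** By incompressibility the divergence has the property that defines a weak
    derivative of the zero function, so it vanishes by uniqueness. *)
Lemma inV_divergence u : inV u -> {ae nu, forall z, grads u 0 0 z + grads u 1 1 z = 0}.
Proof.
move=> uV; have uU := inV_field uV; have [_ [_ div0 _]] := uV.
have w i := inV_weak i i uV.
have gi i : summable nu (grads u i i) by have [_ /memLp1_summable] := w i.
have pg i : lattice_periodic T2 (grads u i i) by have [_ []] := w i.
have hi := summableD (gi 0) (gi 1).
(* The direction [0] of this derivative is arbitrary. *)
have w0 : is_weak_partial T2 0 (fun=> 0 : R) (fun z => grads u 0 0 z + grads u 1 1 z).
  split.
  - by apply: summable_memLp1 => //; apply: summable_cst; exact: nu_lty.
  - apply: summable_memLp1 => // x y xy; by rewrite (pg 0 _ _ xy) (pg 1 _ _ xy).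
  move=> phi sphi pphi.
  have cphi := smooth_continuous sphi; have mphi := continuous_plane_measurable cphi.
  have cd i := smooth_continuous (smooth_partial i sphi).
  have md i := continuous_plane_measurable (cd i).
  have mh := summable_measurable hi.
  rewrite !Rintegral_torusE; [|exact: measurable_funM..].
  have -> : \int[nu]_z (0 * partial 0 phi z) = 0.
    by rewrite -[RHS](Rint0 nu); apply: eq_Rint => z; rewrite mul0r.
  have -> : \int[nu]_z ((grads u 0 0 z + grads u 1 1 z) * phi z) =
      \int[nu]_z (grads u 0 0 z * phi z + grads u 1 1 z * phi z).
    by apply: eq_Rint => z; rewrite mulrDl.
  rewrite RintD; [|exact: summable_continuousM..].
  have E i : \int[nu]_z (grads u i i z * phi z) = - \int[nu]_z (comps u i z * partial i phi z).
    have [_ _ /(_ phi sphi pphi)] := w i.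
    have mU := mf_meas_grad uU i i; have mu := mf_meas uU i.
    rewrite !Rintegral_torusE; [|exact: measurable_funM..].
    by move=> ->; rewrite opprK.
  have ci i : summable nu (fun z => comps u i z * partial i phi z).
    by apply: summable_continuousM => //; exact: mf_summable uU i.
  have S : \int[nu]_z (comps u 0 z * partial 0 phi z) + \int[nu]_z (comps u 1 z * partial 1 phi z) = 0.
    apply: (etrans (esym (RintD (ci 0) (ci 1)))).
    have := div0 phi sphi pphi; rewrite Rintegral_torusE; last first.
      under eq_fun do rewrite big_ord2; apply: measurable_funD; apply: measurable_funM => //.
        exact: mf_meas uU 0.
      exact: mf_meas uU 1.
    by apply: etrans; apply: eq_Rint => z; rewrite big_ord2.
  suff Z : \int[nu]_z (grads u 0 0 z * phi z) + \int[nu]_z (grads u 1 1 z * phi z) = 0.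
    by rewrite Z oppr0.
  apply: (etrans (congr2 +%R (E 0) (E 1))).
  by rewrite -opprD S oppr0.
apply: (ac_line_unique (weak_partial_ac_line w0) (ac_line_cst 0 0)); exact: aeW.
Qed.

Lemma L2normv_sq u : inV u ->
  L2normv u ^+ 2 = \int[nu]_z (comps u 0 z ^+ 2) + \int[nu]_z (comps u 1 z ^+ 2).
Proof.
move=> uV; have uU := inV_field uV.
rewrite /L2normv sqr_sqrtr; last by apply: sumr_ge0 => i _; exact: sqr_ge0.
have h i : L2norm (cmp i \o u) ^+ 2 = \int[nu]_z (comps u i z ^+ 2) by apply: L2norm_sq; exact: mf_meas uU i.
by rewrite big_ord2 (h 0) (h 1).
Qed.

Lemma L2norm_grad_sq u : inV u -> L2norm_grad u ^+ 2 = energy (grads u).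
Proof.
move=> uV; have uU := inV_field uV; have g i j := mf_grad uU i j.
have m i j := mf_meas_grad uU i j.
rewrite /L2norm_grad sqr_sqrtr; last first.
  by apply: sumr_ge0 => i _; apply: sumr_ge0 => j _; exact: sqr_ge0.
have h i j : L2norm (weak_partial T2 j (cmp i \o u)) ^+ 2 = \int[nu]_z (grads u i j z ^+ 2) by apply: L2norm_sq; exact: m.
have hh i := etrans (congr2 +%R (h i 0) (h i 1)) (esym (RintD (g i 0) (g i 1))).
rewrite !big_ord2; exact: (congr2 +%R (hh 0) (hh 1)).
Qed.

Lemma trilinearE e u : inV e -> inV u ->
  trilinear e u e = \int[nu]_z inertia (fun i => comps e i z) (fun i j => grads u i j z).
Proof.
move=> /inV_field eE /inV_field uU; rewrite /trilinear Rintegral_torusE//.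
under eq_fun do rewrite !big_ord2.
have h i j : measurable_fun setT (fun z => comps e j z * grads u i j z * comps e i z).
  have := mf_meas eE i; have := mf_meas eE j; have := mf_meas_grad uU i j.
  by move=> *; apply: measurable_funM => //; exact: measurable_funM.
exact: (measurable_funD (measurable_funD (h 0 0) (h 0 1)) (measurable_funD (h 1 0) (h 1 1))).
Qed.

End Spaces.

(** * The unit field and its shear defect *)

Section UnitField.
Context {R : realType}.
Local Notation circ := (@circ R).
Local Notation nu := (circ \x circ)%E.
Local Notation plane := (R * R)%type.
Implicit Types (f g phi : plane -> R) (j : 'I_2) (e u m : plane -> plane).

(** On a space of measure zero the [L^oo] norm is zero by convention, so that
    it would bound nothing. *)
Lemma torus_pos : (0 < @torus_measure R T2 setT)%E.
Proof.
have -> : torus_measure T2 setT = (circ setT * circ setT)%E.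
  by rewrite -[LHS]/(tor setT) torus_measureE// -setXTT product_measure1E.
have -> : circ setT = (2 * pi)%:E by exact: circT.
by rewrite -EFinM lte_fin mulr_gt0// mulr_gt0// pi_gt0.
Qed.

Lemma Linf_normP f (c : R) : (Linf_norm T2 f <= c%:E)%E <-> {ae nu, forall z, `|f z| <= c}.
Proof.
rewrite /Linf_norm unlock torus_pos.
split=> h; last by apply/ess_supP/ae_torusE; apply: filterS h => z /=; rewrite lee_fin.
have h2 : {ae nu, forall z, (abse ((EFin \o f) z) <= c%:E)%E}.
  by apply/ae_torusE; exact/ess_supP.
by apply: filterS h2 => z /=; rewrite lee_fin.
Qed.

Lemma bigmax2 (F : 'I_2 -> \bar R) j : (F j <= \big[Order.max/0%E]_(i < 2) F i)%E.
Proof.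
rewrite !big_ord_recl big_ord0.
have -> : lift ord0 ord0 = 1 :> 'I_2 by exact/val_inj.
by have [->|->] := ord2P j; rewrite !le_max lexx ?orbT.
Qed.

Lemma defect_le (n : 'I_2 -> R) (D : 'I_2 -> 'I_2 -> R) (M : R) i :
  (forall i, `|n i| <= 1) -> (forall i j, `|D i j| <= M) ->
  `|D i 0 * n 0 + D i 1 * n 1 - (D 0 0 + D 1 1) * n i| <= 4 * M.
Proof.
move=> n1 DM.
have p k l h : `|D k l * n h| <= M by rewrite normrM -[leRHS]mulr1; exact: ler_pM.
rewrite mulrDl; apply: (le_trans (ler_normB _ _)).
have -> : 4 * M = (M + M) + (M + M) by ring.
by apply: lerD; apply: (le_trans (ler_normD _ _)); exact: lerD.
Qed.

Section WithBound.
Variables (m : plane -> plane) (M : R).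
Hypothesis mM : Winf_normv T2 2 m = M%:E.

Lemma Winf_comp i : (Winf_norm T2 2 (comps m i) <= M%:E)%E.
Proof.
rewrite -mM; exact: (bigmax2 (fun i => Winf_norm T2 2 (comps m i)) i).
Qed.

Lemma Winf_sobolev i : sobolev T2 +oo%E 2 (comps m i) /\ (max_partials T2 2 (comps m i) <= M%:E)%E.
Proof. by have := Winf_comp i; rewrite /Winf_norm; case: asboolP. Qed.

Lemma unit_weak i j : is_weak_partial T2 j (comps m i) (grads m i j).
Proof.
have [[_ /(_ j) [g fg _]] _] := Winf_sobolev i.
by have [] := weak_partialP fg.
Qed.

Lemma unit_ac_line i j : ac_line j (comps m i) (grads m i j).
Proof. exact: weak_partial_ac_line (unit_weak i j). Qed.

Lemma unit_grad_le : {ae nu, forall z, forall i j, `|grads m i j z| <= M}.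
Proof.
have h i j : {ae nu, forall z, `|grads m i j z| <= M}.
  apply/Linf_normP; have [_ h] := Winf_sobolev i; apply: le_trans h.
  have h1 : (Linf_norm T2 (grads m i j) <= max_partials T2 1 (grads m i j))%E.
    by rewrite [leRHS]/(Order.max _ _) le_max lexx.
  have h2 := bigmax2 (fun j => max_partials T2 1 (grads m i j)) j.
  by apply: (le_trans h1); apply: (le_trans h2); rewrite [leRHS]/(Order.max _ _) le_max lexx orbT.
apply: filterS2 (filterI (h 0 0) (h 0 1)) (filterI (h 1 0) (h 1 1)) => z [a b] [c d] i j.
by have [->|->] := ord2P i; have [->|->] := ord2P j.
Qed.

Hypothesis m1 : unit_field m.

Lemma unit_dot : {ae nu, forall z, comps m 0 z * comps m 0 z + comps m 1 z * comps m 1 z = 1}.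
Proof. by move/ae_torusE: m1; apply: filterS => z; rewrite /dot big_ord2. Qed.

Lemma unit_periodic i : lattice_periodic T2 (comps m i).
Proof. by have [[[]]] := Winf_sobolev i. Qed.

Lemma unit_grad_periodic i j : lattice_periodic T2 (grads m i j).
Proof. by have [_ []] := unit_weak i j. Qed.

Lemma rotE i z : rot ((comps m)^~ z) i = cmp i (perp (m z)).
Proof. by have [->|->] := ord2P i. Qed.

(** Rotating [m] commutes with weak differentiation, seen on lines. *)
Lemma grads_perp i j : {ae nu, forall z,
  grads (perp \o m) i j z = drot (fun i j => grads m i j z) i j}.
Proof.
have su k : summable nu (comps m k) by have [/memLp1_summable] := unit_weak k j.
have sg k : summable nu (grads m k j) by have [_ /memLp1_summable] := unit_weak k j.
suff w : is_weak_partial T2 j (cmp i \o (perp \o m)) (fun z => drot (fun i j => grads m i j z) i j).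
  by have [] := weak_partialP w.
have -> : cmp i \o (perp \o m) = (fun z => rot ((comps m)^~ z) i).
  by apply/funext => z; rewrite rotE.
apply: ac_line_weak; last exact: ac_line_rot unit_ac_line i j.
- move=> x y xy; rewrite /rot (unit_periodic 0 xy) (unit_periodic 1 xy) //.
- by move=> x y xy; rewrite /drot (unit_grad_periodic 0 j xy) (unit_grad_periodic 1 j xy).
- have [->|->] := ord2P i; rewrite /rot /=; last exact: su.
  by under eq_fun do rewrite -mulN1r; exact: summableZ.
- have [->|->] := ord2P i; rewrite /drot /=; last exact: sg.
  by under eq_fun do rewrite -mulN1r; exact: summableZ.
Qed.

Lemma shear_defectE : {ae nu, forall z, forall i,
  shear_defect m i z = defect ((comps m)^~ z) (fun i j => grads m i j z) i}.
Proof.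
apply: filterS2 (filterI (grads_perp 0 0) (grads_perp 0 1)) (filterI (grads_perp 1 0) (grads_perp 1 1)).
move=> z [a b] [c d] i.
have E : (fun i j => grads (perp \o m) i j z) = drot (fun i j => grads m i j z).
  by apply/funext => k; apply/funext => l; have [->|->] := ord2P k; have [->|->] := ord2P l.
pose G (D : 'I_2 -> 'I_2 -> R) := cmp 0 (perp (m z)) * D i 0 + cmp 1 (perp (m z)) * D i 1
  - (D 0 0 + D 1 1) * cmp i (perp (m z)).
rewrite /shear_defect /dirder /divergence !big_ord2; apply: (etrans (congr1 G E)).
rewrite /defect /G -!rotE; move: (drot _) (rot _) => D n; ring.
Qed.

(** [shear_defect_norm] is the real part of an extended real; the bound on the
    gradient of [m] shows that this number is finite. *)
Lemma shear_defect_le : {ae nu, forall z,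
  Num.sqrt (defect ((comps m)^~ z) (fun i j => grads m i j z) 0 ^+ 2 +
    defect ((comps m)^~ z) (fun i j => grads m i j z) 1 ^+ 2) <= shear_defect_norm m}.
Proof.
pose F z := Num.sqrt (\sum_(i < 2) shear_defect m i z ^+ 2).
have bF : {ae nu, forall z, `|F z| <= Num.sqrt ((4 * M) ^+ 2 + (4 * M) ^+ 2)}.
  apply: filterS3 shear_defectE unit_grad_le (unit_le1 unit_dot) => z Az Wz mz.
  rewrite /F ger0_norm ?sqrtr_ge0// ler_sqrt ?addr_ge0 ?sqr_ge0// big_ord2 !Az.
  have M0 : 0 <= M by exact: le_trans (normr_ge0 _) (Wz 0 0).
  have dW i j : `|drot (fun i j => grads m i j z) i j| <= M by rewrite /drot; case: ifP => _; rewrite ?normrN.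
  have rm i : `|rot ((comps m)^~ z) i| <= 1 by rewrite /rot; case: ifP => _; rewrite ?normrN.
  have D i : defect ((comps m)^~ z) (fun i j => grads m i j z) i ^+ 2 <= (4 * M) ^+ 2.
    rewrite -real_normK ?num_real// ler_pXn2r ?nnegrE ?mulr_ge0//.
    exact: defect_le.
  exact: (lerD (D 0) (D 1)).
have fin : Linf_norm T2 F \is a fin_num.
  rewrite fin_numElt; apply/andP; split; first exact: lt_le_trans (ltNyr 0) (Lnorm_ge0 _ _ _).
  by apply: le_lt_trans (ltry _); apply/Linf_normP; exact: bF.
have : {ae nu, forall z, `|F z| <= shear_defect_norm m}.
  by apply/Linf_normP; rewrite /shear_defect_norm fineK.
apply: filterS2 shear_defectE => z Az; rewrite /F big_ord2 !Az; exact: le_trans (ler_norm _).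
Qed.

Lemma shear_defect_norm_ge0 : 0 <= shear_defect_norm m.
Proof. by rewrite /shear_defect_norm fine_ge0// Lnorm_ge0. Qed.

Variable e : plane -> plane.
Hypothesis eV : inV e.
Let eE := inV_field eV.
Let r (z : plane) := dot (e z) (m z).
Let r' (z : plane) := pair ((comps e)^~ z) ((comps m)^~ z).
Let dr j (z : plane) := dpair ((comps e)^~ z) ((comps m)^~ z) (fun i j => grads e i j z)
  (fun i j => grads m i j z) j.

Let rE : r = r'. Proof. by apply/funext => z; rewrite /r /dot big_ord2. Qed.

Let mr : measurable_fun setT r'. Proof. by have [] := ac_line_pair eE unit_ac_line 0. Qed.
Let r2 : summable nu (fun z => r' z ^+ 2). Proof. exact: sq_pair eE unit_ac_line unit_dot. Qed.
Let dr2 j : summable nu (fun z => dr j z ^+ 2).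
Proof. exact: sq_dpair eE unit_ac_line unit_dot unit_grad_le j. Qed.
Let mdr j : measurable_fun setT (dr j). Proof. by have [] := ac_line_pair eE unit_ac_line j. Qed.

(** The product rule on lines gives the weak gradient of [r = e . m]. *)
Lemma pair_weak j : is_weak_partial T2 j r (dr j).
Proof.
rewrite rE; apply: ac_line_weak; last exact: ac_line_pair eE unit_ac_line j.
- move=> x y xy; have pe i : lattice_periodic T2 (comps e i) by have [[]] := inV_weak i j eV.
  by rewrite /r' /pair !(unit_periodic _ xy) !(pe _ _ _ xy).
- move=> x y xy; have pe i : lattice_periodic T2 (comps e i) by have [[]] := inV_weak i j eV.
  have pE i : lattice_periodic T2 (grads e i j) by have [_ []] := inV_weak i j eV.
  by rewrite /dr /dpair !(unit_periodic _ xy) !(unit_grad_periodic _ _ xy) !(pe _ _ _ xy) !(pE _ _ _ xy).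
- exact: nu_sq_summable.
- exact: nu_sq_summable.
Qed.

Lemma L2norm_pair_sq : L2norm r ^+ 2 = \int[nu]_z (r' z ^+ 2).
Proof. by rewrite rE L2norm_sq. Qed.

Lemma H1norm_pair_sq : H1norm r ^+ 2 = \int[nu]_z (r' z ^+ 2)
  + \int[nu]_z (dr 0 z ^+ 2 + dr 1 z ^+ 2).
Proof.
rewrite /H1norm sqr_sqrtr; last first.
  by rewrite addr_ge0 ?sqr_ge0//; apply: sumr_ge0 => i _; exact: sqr_ge0.
rewrite L2norm_pair_sq big_ord2 RintD//; congr (_ + _).
have h j : L2norm (weak_partial T2 j r) ^+ 2 = \int[nu]_z dr j z ^+ 2.
  have [w wd] := weak_partialP (pair_weak j); have [_ mw _] := weak_partial_ac_line w.
  rewrite L2norm_sq//; apply: ae_eq_Rint; [exact: measurable_funX|exact: measurable_funX|].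
  by apply: filterS wd => z ->.
exact: (congr2 +%R (h 0) (h 1)).
Qed.

Lemma Lm_pair : Lm r = if \int[nu]_z (r' z ^+ 2) == 0 then 1 else
  1 + ln (1 + (\int[nu]_z (r' z ^+ 2) + \int[nu]_z (dr 0 z ^+ 2 + dr 1 z ^+ 2))
    / \int[nu]_z (r' z ^+ 2)).
Proof.
rewrite /Lm H1norm_pair_sq L2norm_pair_sq; case: asboolP => [/ae_torusE r0|rn0].
  rewrite ifT//; apply/eqP; rewrite -(Rint0 nu); apply: ae_eq_Rint => //.
    exact: measurable_funX.
  by apply: filterS r0 => z; rewrite rE => ->; rewrite expr0n.
rewrite ifF//; apply/negbTE/eqP => a0; apply: rn0; apply/ae_torusE.
by rewrite rE; exact: Rint_sq_eq0.
Qed.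

Variable u : plane -> plane.
Hypothesis uV : inV u.

(** The estimate without a Poincare constant. *)
Lemma trilinear_estimate :
  `|trilinear e u e| <=
    8 * pi * (shear_defect_norm m * L2normv u) * L2norm_grad e ^+ 2
    + (14 + 32 * pi * `|M|) * Num.sqrt (@log_cst R) *
      (L2norm_grad u * L2norm_grad e * L2norm r * Num.sqrt (Lm r)).
Proof.
have WM : {ae nu, forall z, forall i j, `|grads m i j z| <= `|M|}.
  by apply: filterS unit_grad_le => z h i j; exact: le_trans (h i j) (ler_norm _).
have := shear_estimate eE (inV_field uV) unit_ac_line unit_dot (normr_ge0 M) WM
  (inV_divergence eV) shear_defect_norm_ge0 shear_defect_le.
rewrite -trilinearE// -L2normv_sq// -!L2norm_grad_sq// -L2norm_pair_sq.
have sq (x : R) : 0 <= x -> Num.sqrt (x ^+ 2) = x by move=> x0; rewrite sqrtr_sqr ger0_norm.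
have qu : Num.sqrt (L2normv u ^+ 2) = L2normv u by apply: sq; exact: sqrtr_ge0.
have qU : Num.sqrt (L2norm_grad u ^+ 2) = L2norm_grad u by apply: sq; exact: sqrtr_ge0.
have qE : Num.sqrt (L2norm_grad e ^+ 2) = L2norm_grad e by apply: sq; exact: sqrtr_ge0.
have qr : Num.sqrt (L2norm r ^+ 2) = L2norm r by apply: sq; exact: L2norm_ge0.
rewrite qu qU qE qr Lm_pair -L2norm_pair_sq.
by apply.
Qed.

End WithBound.
End UnitField.

(** * The choice of the constant *)

Section Constants.
Context {R : realType}.
Local Notation plane := (R * R)%type.

Lemma Lm_ge0 (r : plane -> R) : 0 <= Lm r.
Proof.
rewrite /Lm; case: asboolP => // _.
by rewrite addr_ge0// ln_ge0// lerDl divr_ge0// sqr_ge0.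
Qed.

(** A Poincare constant cannot exceed the Rayleigh quotient of any one nonzero
    field of [V], so it is bounded above by a number chosen once and for all;
    if [V] had no nonzero field, both sides would vanish. *)
Lemma poincare_bounded : exists2 B : R, 0 <= B & forall lambda1, poincare_constant lambda1 ->
  forall u : plane -> plane, inV u -> L2normv u <= B * (Num.sqrt lambda1)^-1 * L2normv u.
Proof.
have n0 (u : plane -> plane) : 0 <= L2normv u by exact: sqrtr_ge0.
case: (pselect (exists2 e0 : plane -> plane, inV e0 & L2normv e0 != 0)) => [[e0 e0V e00]|no].
  have ep : 0 < L2normv e0 by rewrite lt_def e00 n0.
  have g0 : 0 <= L2norm_grad e0 by exact: sqrtr_ge0.
  exists (L2norm_grad e0 / L2normv e0); first by rewrite divr_ge0.
  move=> l [l0 hl] u uV; rewrite -[leLHS]mul1r; apply: ler_wpM2r => //.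
  have sl : 0 < Num.sqrt l by rewrite sqrtr_gt0.
  rewrite ler_pdivlMr// mul1r ler_pdivlMr//.
  rewrite -(@ler_pXn2r _ 2) ?nnegrE//; last exact: mulr_ge0 (ltW sl) _.
  by rewrite exprMn sqr_sqrtr ?(ltW l0)//; exact: hl.
exists 0 => // l _ u uV.
have [->|un] := eqVneq (L2normv u) 0; first by rewrite mulr0.
by exfalso; apply: no; exists u.
Qed.

Lemma young (C x y eps : R) : 0 < eps -> C * (x * y) <= eps * y ^+ 2 + C ^+ 2 / eps * x ^+ 2.
Proof.
move=> e0; rewrite -subr_ge0.
have -> : eps * y ^+ 2 + C ^+ 2 / eps * x ^+ 2 - C * (x * y)
  = eps * ((y - C * x / (2 * eps)) ^+ 2 + 3 / 4 * (C * x / eps) ^+ 2).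
  by field; rewrite gt_eqF.
apply: mulr_ge0 (ltW e0) _; rewrite addr_ge0 ?sqr_ge0// mulr_ge0 ?sqr_ge0//.
Qed.

End Constants.

Theorem theorem4p6 (R : realType)
    (L : R * R) (Phi : R * R -> R * R) (q : R * R -> R) (M : R) :
  exists2 K : R, 0 < K &
  forall m : R * R -> R * R,
    Winf_normv T2 2 m = M%:E ->
    unit_field m ->
    controlled_adapted_covering m L Phi q ->
  forall lambda1 : R, poincare_constant lambda1 ->
  forall u e : R * R -> R * R, inV u -> inV e ->
  let r := fun x => dot (e x) (m x) in
  `|trilinear e u e| <=
      K * (Num.sqrt lambda1)^-1 * L2normv u * shear_defect_norm m
        * L2norm_grad e ^+ 2
      + K * L2norm_grad u * L2norm_grad e * L2norm r * Num.sqrt (Lm r)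
  /\
  forall eps : R, 0 < eps ->
  `|trilinear e u e| <=
      (K * (Num.sqrt lambda1)^-1 * L2normv u * shear_defect_norm m + eps)
        * L2norm_grad e ^+ 2
      + K / eps * L2norm_grad u ^+ 2 * Lm r * L2norm r ^+ 2.
Proof.
have [B B0 hB] := @poincare_bounded R.
pose C : R := (14 + 32 * pi * `|M|) * Num.sqrt log_cst.
have C0 : 0 <= C.
  apply: mulr_ge0; last exact: sqrtr_ge0.
  by rewrite addr_ge0// mulr_ge0// mulr_ge0// pi_ge0.
pose A : R := 8 * pi * B.
have A0 : 0 <= A by rewrite /A !mulr_ge0 ?pi_ge0.
have C2 : 0 <= C ^+ 2 := sqr_ge0 C.
(* The first bound asks for [A] and [C]; Young's inequality in the second one
   produces [C ^+ 2]. *)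
exists (1 + A + C + C ^+ 2); first lra.
set K := 1 + A + C + C ^+ 2.
move=> m mM m1 _ l lP u e uV eV r.
have := trilinear_estimate mM m1 eV uV; rewrite -/C -/r.
set N := L2normv u; set ge := L2norm_grad e; set gu := L2norm_grad u.
set al := shear_defect_norm m; set nr := L2norm r; set Lr := Num.sqrt (Lm r).
have N0 : 0 <= N := sqrtr_ge0 _; have ge0 : 0 <= ge := sqrtr_ge0 _.
have gu0 : 0 <= gu := sqrtr_ge0 _; have nr0 : 0 <= nr := L2norm_ge0 r.
have Lr0 : 0 <= Lr := sqrtr_ge0 _; have al0 : 0 <= al := shear_defect_norm_ge0 m.
have sl0 : 0 <= (Num.sqrt l)^-1 by rewrite invr_ge0 sqrtr_ge0.
have KA : A <= K by rewrite /K; lra.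
have KC : C <= K by rewrite /K; lra.
have KC2 : C ^+ 2 <= K by rewrite /K; lra.
have first_term : 8 * pi * (al * N) * ge ^+ 2 <= K * (Num.sqrt l)^-1 * N * al * ge ^+ 2.
  apply: ler_wpM2r; first exact: sqr_ge0.
  have -> : 8 * pi * (al * N) = 8 * pi * N * al by ring.
  apply: ler_wpM2r => //.
  apply: (@le_trans _ _ (A * (Num.sqrt l)^-1 * N)).
    have -> : A * (Num.sqrt l)^-1 * N = 8 * pi * (B * (Num.sqrt l)^-1 * N) by rewrite /A; ring.
    by apply: ler_wpM2l; [rewrite mulr_ge0 ?pi_ge0|exact: hB lP _ uV].
  by do 2 apply: ler_wpM2r => //.
move=> est; split.
  apply: (le_trans est); apply: lerD first_term _.
  have -> : K * gu * ge * nr * Lr = K * (gu * ge * nr * Lr) by ring.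
  by apply: ler_wpM2r => //; rewrite !mulr_ge0.
move=> eps e0; apply: (le_trans est); rewrite [X in _ <= X + _]mulrDl -[leRHS]addrA.
apply: lerD first_term _.
have -> : gu * ge * nr * Lr = (gu * nr * Lr) * ge by ring.
apply: (le_trans (young C _ _ e0)); rewrite lerD2l.
have -> : K / eps * gu ^+ 2 * Lm r * nr ^+ 2 = K / eps * (gu * nr * Lr) ^+ 2.
  by rewrite !exprMn [Lr ^+ 2]sqr_sqrtr ?Lm_ge0//; ring.
apply: ler_wpM2r; first exact: sqr_ge0.
by apply: ler_wpM2r KC2; rewrite invr_ge0 ltW.
Qed.
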